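(* Let $q\ge 2$ be a prime power, let $N\ge 3$ be an integer, let $K\in\mathcal{M}_N$ and let $h$ be an integer with $1\le h\le N-2$. Let $f$ be a Steinhaus random multiplicative function over $\mathbb{F}_q[t]$ and let $$\mathcal{A}=\mathcal{I}(K,h):=\{F\in\mathcal{M}_N:\ \deg(F-K)\le h\}.$$ Then $$\frac{1}{\sqrt{|\mathcal{A}|}}\sum_{F\in\mathcal{A}}f(F)\xrightarrow{d}\mathcal{CN}(0,1)$$ in both of the following cases: (a) as $q^h\to\infty$, provided $q^{h+1}=o(q^N/N)$; (b) as $h\to\infty$, provided $q^{h+1}=o(q^N/N^c)$ for some fixed $c>2\log 2-1$.
   Context: $\mathcal{M}$ is the set of monic polynomials in $\mathbb{F}_q[t]$ and $\mathcal{M}_N$ is the subset of those of degree $N$; the zero polynomial is regarded as having degree $\le h$ for every $h$. A Steinhaus random multiplicative function over $\mathbb{F}_q[t]$ is the random function $f:\mathcal{M}\to\mathbb{C}$ obtained from independent random variables $(f(P))_P$, indexed by the monic irreducible polynomials $P$ and each uniformly distributed on the complex unit circle, by $f(1)=1$ and $f(F)=f(P_1)^{a_1}\cdots f(P_r)^{a_r}$, where $F=P_1^{a_1}\cdots P_r^{a_r}$ is the factorization of $F$ into powers of distinct monic irreducibles. $\xrightarrow{d}$ is convergence in distribution and $\mathcal{CN}(0,1)$ is the standard complex normal distribution (mean 0, variance 1: real and imaginary parts are independent real normals with mean $0$ and variance $1/2$). All parameters $q,N,K,h$ may vary and depend on each other arbitrarily: the limits are along arbitrary sequences of tuples $(q,N,K,h)$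 with $q^h\to\infty$ (case (a)) or $h\to\infty$ (case (b)) along which the stated $o(\cdot)$ condition holds. $\log$ is the natural logarithm. *)

(* Defs.v *)
From mathcomp Require Export all_boot all_order all_algebra.
From mathcomp Require Export all_classical all_reals all_analysis.
From mathcomp Require Export qpoly complex.
Export Order.TTheory GRing.Theory Num.Theory numFieldNormedType.Exports.

Set Implicit Arguments.
Unset Strict Implicit.
Unset Printing Implicit Defensive.

Local Open Scope classical_set_scope.
Local Open Scope ring_scope.
Local Open Scope complex_scope.

(* R[i] carries no sigma-algebra in the library: random variables with complex
   values are handled through the identification of R[i] with R * R, equipped
   with the product sigma-algebra and the product topology. *)
Definition complex_pair (R : realType) (z : R[i]) : R * R :=
  (complex.Re z, complex.Im z).

Definition uniform_on_circle (R : realType) (d : measure_display)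
    (T : measurableType d) (P : probability T R) (X : T -> R[i]) : Prop :=
  forall A : set (R * R), measurable A ->
    P [set w | A (complex_pair (X w))] =
    uniform_prob (@ltr01 R)
      [set u | A (cos (2 * pi * u), sin (2 * pi * u))].

(* Mutual independence of the family (X i), i ranging over the set D. *)
Definition mutually_independent (R : realType) (d : measure_display)
    (T : measurableType d) (P : probability T R) (I : choiceType) (D : set I)
    (X : I -> T -> R[i]) : Prop :=
  forall (s : seq I) (A : I -> set (R * R)),
    uniq s -> (forall i, i \in s -> D i) ->
    (forall i, i \in s -> measurable (A i)) ->
    P [set w | forall i, i \in s -> A i (complex_pair (X i w))] =
    (\prod_(i <- s) P [set w | A i (complex_pair (X i w))])%E.

Definition monic_irreducible (F : finFieldType) : set {poly F} :=
  [set p | p \is monic /\ irreducible_poly p].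

(* Only the values of f at monic polynomials are constrained. *)
Record steinhaus (R : realType) (F : finFieldType) (d : measure_display)
    (T : measurableType d) (P : probability T R)
    (f : {poly F} -> T -> R[i]) : Prop := Steinhaus {
  steinhaus_measurable : forall p, monic_irreducible p ->
    measurable_fun setT (fun w => complex_pair (f p w));
  steinhaus_uniform : forall p, monic_irreducible p ->
    uniform_on_circle P (f p);
  steinhaus_independent : mutually_independent P (@monic_irreducible F) f;
  steinhaus_one : forall w, f 1 w = 1;
  steinhaus_factor : forall (r : nat) (p : 'I_r -> {poly F}) (a : 'I_r -> nat),
    injective p -> (forall i, monic_irreducible (p i)) ->
    forall w, f (\prod_(i < r) p i ^+ a i) w = \prod_(i < r) f (p i) w ^+ a i
}.

(* Monic polynomials G of degree N with deg (G - K) <= h.  [size] is the degree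
   plus one, and 0 for the zero polynomial; {poly_N.+1 F} is the finite type of
   polynomials of degree at most N. *)
Definition short_interval (F : finFieldType) (N : nat) (K : {poly F})
    (h : nat) : {set {poly_N.+1 F}} :=
  [set G : {poly_N.+1 F} |
    [&& (G : {poly F}) \is monic, size (G : {poly F}) == N.+1
      & (size ((G : {poly F}) - K)%R <= h.+1)%N]].

Definition normalized_sum (R : realType) (F : finFieldType)
    (T : Type) (f : {poly F} -> T -> R[i]) (N : nat) (A : {set {poly_N.+1 F}})
    (w : T) : R[i] :=
  ((Num.sqrt (#|A|%:R : R))^-1)%:C * \sum_(G in A) f (G : {poly F}) w.

(* [measurableTypeR R] is R with its Borel sigma-algebra, the type on which the
   library defines [normal_prob]. *)
Definition plane (R : realType) :=
  (measurableTypeR R * measurableTypeR R)%type.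

(* Independent real and imaginary parts, normal with mean 0 and standard
   deviation 1 / sqrt 2. *)
Definition complex_normal (R : realType) : probability (plane R) R :=
  let nu : probability (measurableTypeR R) R :=
    normal_prob 0 (Num.sqrt 2)^-1 in
  (nu \x nu)%E.

(* The X n may live on different probability spaces. *)
Definition cvg_in_distribution (R : realType) (d : nat -> measure_display)
    (T : forall n, measurableType (d n)) (P : forall n, probability (T n) R)
    (X : forall n, T n -> R[i])
    (mu : probability (plane R) R) : Prop :=
  forall g : R * R -> R, continuous g -> (exists M : R, forall z, `|g z| <= M) ->
    (\int[P n]_w (g (complex_pair (X n w)))%:E)%E @[n --> \oo] -->
    (\int[mu]_z (g z)%:E)%E.

(* Main.v *)
Require Import Defs.
From mathcomp Require Import measurable_realfun.
From mathcomp Require Import ring lra zify.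

(** The proof is Stein's method for the test functions cos (t Y + c), where
    Y = |A|^(-1/2) sum_(F in A) u_F with u_F = Re (xi f(F)).  To each F in a
    subset S of A of density close to 1 one attaches an irreducible sel F dividing F.
    Once the terms divisible by sel F are deleted from Y, u_F is orthogonal to every
    function of what remains, so E (u_F sin (t Y)) is given by a Taylor expansion, and
    the characteristic function of Y satisfies phi' = - t v phi up to an error controlled
    by the number of pairs (F, G) in S with sel F | G and by the number of nondiagonal
    solutions of F1 F2 = G1 G2 in S.

    Such a solution is F1 = g a, F2 = k b, G1 = g b, G2 = k a.  For bounded h one takes
    S = A and counts trivially: about N q^(H - N) |A|^2 solutions, with H = h + 1.  For
    large h, S consists of the F whose number omega(F) of irreducible divisors of degree
    between l ~ log h and h / 16 l is close to its mean sigma ~ log h, and which are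
    divisible by no square of these irreducibles.  There 2^(- omega) is multiplicative and
    at least 2^(- (1 + eps) sigma), while its mean over short intervals, bounded by
    Bonferroni's inequalities, is about e^(- sigma / 2).  This replaces the factor N by
    N^(2 log 2 - 1 + o(1)), whence the exponent in case (b).  Case (a) for large h is
    case (b) with c = 1. *)

Set Implicit Arguments.
Unset Strict Implicit.
Unset Printing Implicit Defensive.

Local Open Scope classical_set_scope.
Local Open Scope ring_scope.

(** Smallness of the pair and solution counts [pe] alone does not suffice. The second-order
    remainder in Stein's expansion is of order [sqrt (pe * W)], where [W], the total relative
    variance of the deleted parts, is only known to be at most about [log h]. This is why the
    selected irreducibles have degree above [l], so that pairs have density at most [2 ^ (- l)].

    The weight [w = 2 ^ (- omega)] is Rankin's trick: a solution is counted with
    [w g * w k * w a * w b = w F1 * w F2], at the price of about [N ^ (2 log 2)], while the four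
    means contribute about [1 / (m (N - m))] for [deg g = m], hence [log N / N] in total. With
    [z ^ omega] and [z >= 1/2] the exponent would be [4 z - 3 - 2 log z], least at [z = 1/2]: this
    is the origin of [2 log 2 - 1].

    The variables [k], [a], [b] only run over intervals, so the mean of [w] is needed there, and the
    sieve provides it when [N - H < 2 l]. Otherwise [q ^ (H - N) <= h ^ (- 2)], and the trivial
    count is enough. *)

Section Expectation.

(** * Expectations of bounded random variables *)

Context (d : measure_display) (T : measurableType d) (R : realType).
Variable P : probability T R.
Implicit Types X Y : T -> R.

Definition bounded_measurable X :=
  measurable_fun setT X /\ exists M : R, forall w, `|X w| <= M.

Definition Ex X : R := Rintegral P setT X.

Lemma bounded_measurable_integrable X : bounded_measurable X ->
  P.-integrable setT (EFin \o X).
Proof.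
move=> [mX [M XM]]; apply: (@le_integrable _ _ _ P setT measurableT _ (EFin \o cst M)).
- exact/measurable_EFinP.
- by move=> w _ /=; rewrite lee_fin (le_trans (XM w)) // ler_norm.
- exact: finite_measure_integrable_cst.
Qed.

Lemma bounded_measurable_cst c : bounded_measurable (cst c).
Proof. by split; [exact: measurable_cst | exists `|c|]. Qed.

Lemma bounded_measurableD X Y : bounded_measurable X -> bounded_measurable Y ->
  bounded_measurable (fun w => X w + Y w).
Proof.
move=> [mX [M XM]] [mY [N YN]]; split; first exact: measurable_funD.
by exists (M + N) => w; rewrite (le_trans (ler_normD _ _)) // lerD.
Qed.

Lemma bounded_measurableN X : bounded_measurable X ->
  bounded_measurable (fun w => - X w).
Proof.
move=> [mX [M XM]]; split; first exact: measurableT_comp.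
by exists M => w; rewrite normrN.
Qed.

Lemma bounded_measurableB X Y : bounded_measurable X -> bounded_measurable Y ->
  bounded_measurable (fun w => X w - Y w).
Proof. by move=> bX /bounded_measurableN; exact: bounded_measurableD. Qed.

Lemma bounded_measurableM X Y : bounded_measurable X -> bounded_measurable Y ->
  bounded_measurable (fun w => X w * Y w).
Proof.
move=> [mX [M XM]] [mY [N YN]]; split; first exact: measurable_funM.
by exists (M * N) => w; rewrite normrM ler_pM.
Qed.

Lemma bounded_measurableZ c X : bounded_measurable X ->
  bounded_measurable (fun w => c * X w).
Proof. by move=> bX; apply: bounded_measurableM => //; exact: bounded_measurable_cst. Qed.

Lemma bounded_measurableX X n : bounded_measurable X ->
  bounded_measurable (fun w => X w ^+ n).
Proof.
move=> bX; elim: n => [|n IH].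
  by under eq_fun do rewrite expr0; exact: bounded_measurable_cst.
by under eq_fun do rewrite exprS; exact: bounded_measurableM.
Qed.

Lemma bounded_measurable_norm X : bounded_measurable X ->
  bounded_measurable (fun w => `|X w|).
Proof.
move=> [mX [M XM]]; split; first exact: measurableT_comp.
by exists M => w; rewrite normr_id.
Qed.

Lemma bounded_measurable_sum (I : Type) (s : seq I) (Q : pred I) (X : I -> T -> R) :
  (forall i, bounded_measurable (X i)) ->
  bounded_measurable (fun w => \sum_(i <- s | Q i) X i w).
Proof.
move=> bX; elim: s => [|i s IH].
  by under eq_fun do rewrite big_nil; exact: bounded_measurable_cst.
under eq_fun do rewrite big_cons.
by case: (Q i) => //; exact: bounded_measurableD.
Qed.

Lemma bounded_measurable_cos X : measurable_fun setT X ->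
  bounded_measurable (fun w => cos (X w)).
Proof.
move=> mX; split.
  apply: measurableT_comp => //; apply: continuous_measurable_fun.
  exact: continuous_cos.
by exists 1 => w; rewrite ler_norml cos_geN1 cos_le1.
Qed.

Lemma bounded_measurable_sin X : measurable_fun setT X ->
  bounded_measurable (fun w => sin (X w)).
Proof.
move=> mX; split.
  apply: measurableT_comp => //; apply: continuous_measurable_fun.
  exact: continuous_sin.
by exists 1 => w; rewrite ler_norml sin_geN1 sin_le1.
Qed.

Lemma bounded_measurable_indic (A : set T) : measurable A ->
  bounded_measurable (\1_A : T -> R).
Proof.
move=> mA; split; first exact: measurable_indic.
by exists 1 => w; rewrite indicE; case: (_ \in _); rewrite ?normr1 ?normr0.
Qed.

Lemma Ex_cst c : Ex (cst c) = c.
Proof.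
rewrite /Ex Rintegral_cst //.
by rewrite -[RHS]mulr1; congr (_ * _); exact: (congr1 fine (probability_setT P)).
Qed.

Lemma ExD X Y : bounded_measurable X -> bounded_measurable Y ->
  Ex (fun w => X w + Y w) = Ex X + Ex Y.
Proof.
by move=> bX bY; rewrite /Ex RintegralD //; exact: bounded_measurable_integrable.
Qed.

Lemma ExZ c X : bounded_measurable X -> Ex (fun w => c * X w) = c * Ex X.
Proof.
by move=> bX; rewrite /Ex RintegralZl //; exact: bounded_measurable_integrable.
Qed.

Lemma ExN X : bounded_measurable X -> Ex (fun w => - X w) = - Ex X.
Proof. by move=> bX; rewrite -mulN1r -ExZ //; congr Ex; apply/funext => w; rewrite mulN1r. Qed.

Lemma ExB X Y : bounded_measurable X -> bounded_measurable Y ->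
  Ex (fun w => X w - Y w) = Ex X - Ex Y.
Proof. by move=> bX bY; rewrite ExD ?ExN //; exact: bounded_measurableN. Qed.

Lemma Ex_sum (I : Type) (s : seq I) (Q : pred I) (X : I -> T -> R) :
  (forall i, bounded_measurable (X i)) ->
  Ex (fun w => \sum_(i <- s | Q i) X i w) = \sum_(i <- s | Q i) Ex (X i).
Proof.
move=> bX; elim: s => [|i s IH].
  by under eq_fun do rewrite big_nil; rewrite big_nil; exact: Ex_cst.
under eq_fun do rewrite big_cons; rewrite big_cons -IH.
by case: (Q i) => //; rewrite ExD //; exact: bounded_measurable_sum.
Qed.

Lemma le_Ex X Y : bounded_measurable X -> bounded_measurable Y ->
  (forall w, X w <= Y w) -> Ex X <= Ex Y.
Proof.
by move=> bX bY XY; apply: le_Rintegral => //; exact: bounded_measurable_integrable.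
Qed.

Lemma le_norm_Ex X : bounded_measurable X -> `|Ex X| <= Ex (fun w => `|X w|).
Proof.
by move=> bX; apply: le_normr_Rintegral => //; exact: bounded_measurable_integrable.
Qed.

Lemma le_norm_Ex_sub X Y Z : bounded_measurable X -> bounded_measurable Y ->
  bounded_measurable Z -> (forall w, `|X w - Y w| <= Z w) ->
  `|Ex X - Ex Y| <= Ex Z.
Proof.
move=> bX bY bZ XYZ; have bXY := bounded_measurableB bX bY.
rewrite -ExB // (le_trans (le_norm_Ex _)) // le_Ex //.
exact: bounded_measurable_norm.
Qed.

Lemma Ex_indic (A : set T) : measurable A -> Ex (\1_A) = fine (P A).
Proof. by move=> mA; rewrite /Ex /Rintegral integral_indic // setIT. Qed.

Lemma Ex_EFin X : bounded_measurable X -> (\int[P]_w (X w)%:E)%E = (Ex X)%:E.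
Proof.
move=> bX; rewrite fineK //; apply: integrable_fin_num => //.
exact: bounded_measurable_integrable.
Qed.

Lemma Ex_ae_eq X Y (A : set T) : measurable A -> P A = 0%E ->
  measurable_fun setT X -> measurable_fun setT Y ->
  (forall w, ~ A w -> X w = Y w) -> Ex X = Ex Y.
Proof.
move=> mA PA mX mY XY; congr fine; apply: ae_eq_integral => //.
- exact/measurable_EFinP.
- exact/measurable_EFinP.
exists A; split => // w /= h; apply: contrapT => nA; apply: h => _.
by rewrite XY.
Qed.

(* Layer-cake: a bounded function is a uniform limit of combinations of the
   indicators of its superlevel sets. *)
Lemma Ex_mul_comp_eq0 d' (U : measurableType d') (W : T -> R) (X : T -> U) (h : U -> R) :
  bounded_measurable W -> measurable_fun setT X -> measurable_fun setT h ->
  (exists M, forall x, `|h x| <= M) ->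
  (forall A : set U, measurable A -> Ex (fun w => W w * \1_A (X w)) = 0) ->
  Ex (fun w => W w * h (X w)) = 0.
Proof.
move=> bW mX mh [M hM] W0.
have bi A : measurable A -> bounded_measurable (fun w => \1_A (X w) : R).
  move=> mA; split; last by exists 1 => w; rewrite indicE; case: (_ \in _); rewrite ?normr1 ?normr0.
  by apply: measurableT_comp => //; exact: measurable_indic.
have bh : bounded_measurable (h \o X) by split; [exact: measurableT_comp | exists M => w /=].
have [M1 M1_0 WM] : exists2 M1, 0 <= M1 & forall w, `|W w| <= M1.
  by have [_ [N WN]] := bW; exists N => //; exact: le_trans (normr_ge0 _) (WN point).
(* The superlevel sets describe [h + M] rather than [h]; the case [A = setT] disposes of the
   constant [M]. *)
have W1 : Ex W = 0.
  have := W0 setT measurableT; under eq_fun do rewrite indicT mulr1.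
  by [].
have key n : `|Ex (fun w => W w * h (X w))| <= M1 / n.+1%:R.
  pose K := (Num.truncn ((M + M) * n.+1%:R)).+1.
  pose A (k : nat) := [set x | k.+1%:R / n.+1%:R <= h x + M].
  have mA k : measurable (A k).
    rewrite /A -[X in measurable X]setTI.
    have -> : [set x | k.+1%:R / n.+1%:R <= h x + M] =
      (fun x => h x + M) @^-1` `[k.+1%:R / n.+1%:R, +oo[%classic.
      by apply/seteqP; split => x /=; rewrite in_itv /= andbT.
    by apply: (measurable_funD mh (measurable_cst _)) => //; exact: measurable_itv.
  (* [s + M] is [h + M] rounded down to a multiple of [1 / (n + 1)]; [K] levels are enough because
     [h + M <= 2 M]. *)
  pose s x : R := \sum_(k < K) n.+1%:R^-1 * \1_(A k) x - M.
  have hs x : `|h x - s x| <= n.+1%:R^-1.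
    rewrite /s opprB addrA; set y := h x + M.
    have y0 : 0 <= y by rewrite /y -lerBlDr sub0r; have := hM x; rewrite ler_norml => /andP[].
    have yK : y * n.+1%:R < K%:R.
      apply: le_lt_trans (truncnS_gt _); rewrite ler_wpM2r // /y lerD2r.
      exact: le_trans (ler_norm _) (hM x).
    pose m := Num.truncn (y * n.+1%:R).
    have yn0 : 0 <= y * n.+1%:R by rewrite mulr_ge0.
    have my : m%:R <= y * n.+1%:R by rewrite truncn_le.
    have ym : y * n.+1%:R < m.+1%:R by exact: truncnS_gt.
    have mK : (m <= K)%N by rewrite -(ler_nat R) (le_trans my) // ltW.
    have -> : \sum_(k < K) n.+1%:R^-1 * \1_(A k) x = m%:R / n.+1%:R :> R.
      rewrite -mulr_sumr mulrC; congr (_ * _).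
      rewrite (eq_bigr (fun k : 'I_K => ((k < m)%N : nat)%:R)); last first.
        move=> k _; rewrite indicE; congr ((nat_of_bool _)%:R).
        apply/idP/idP; rewrite inE /A /= ler_pdivrMr ?ltr0n // -/y => h1.
          by have := le_lt_trans h1 ym; rewrite ltr_nat ltnS.
        by apply: le_trans my; rewrite ler_nat.
      rewrite -natr_sum; congr (_ %:R).
      rewrite -[RHS]card_ord -sum1_card (big_ord_widen K (fun=> 1%N)) // [RHS]big_mkcond.
      by apply: eq_bigr => k _; case: (k < m)%N.
    have -> : y - m%:R / n.+1%:R = (y * n.+1%:R - m%:R) / n.+1%:R.
      by rewrite mulrBl mulfK ?pnatr_eq0.
    rewrite normrM normfV [`|n.+1%:R|]ger0_norm // -[leRHS]mul1r ler_wpM2r ?invr_ge0 //.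
    by rewrite ger0_norm ?subr_ge0 // lerBlDr nat1r ltW.
  have bs : bounded_measurable (fun w => s (X w)).
    apply: bounded_measurableB; last exact: bounded_measurable_cst.
    by apply: bounded_measurable_sum => k; apply: bounded_measurableZ; exact: bi.
  have Ws0 : Ex (fun w => W w * s (X w)) = 0.
    have -> : (fun w => W w * s (X w)) =
        (fun w => \sum_(k < K) n.+1%:R^-1 * (W w * \1_(A k) (X w)) - M * W w).
      apply/funext => w; rewrite /s mulrBr mulr_sumr [_ * M]mulrC; congr (_ - _).
      by apply: eq_bigr => k _; rewrite mulrCA.
    rewrite ExB.
    - rewrite ExZ // W1 mulr0 subr0 Ex_sum => [|k].
        apply: big1 => k _; rewrite ExZ ?W0 ?mulr0 //.
        by apply: bounded_measurableM => //; exact: bi.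
      by apply: bounded_measurableZ; apply: bounded_measurableM => //; exact: bi.
    - apply: bounded_measurable_sum => k.
      by apply: bounded_measurableZ; apply: bounded_measurableM => //; exact: bi.
    - exact: bounded_measurableZ.
  rewrite -[X in `|X|]subr0 -Ws0.
  apply: (le_trans (le_norm_Ex_sub _ _ (bounded_measurable_cst (M1 / n.+1%:R)) _)).
  - exact: bounded_measurableM.
  - exact: bounded_measurableM.
  - by move=> w /=; rewrite -mulrBr normrM ler_pM.
  - by rewrite Ex_cst.
apply/eqP; rewrite -normr_le0; apply/ler_addgt0Pr => e e0; rewrite add0r.
have [n] := ltr_add_invr (divr_gt0 e0 (ltr_pwDr ltr01 M1_0)).
rewrite add0r => ne; apply: (le_trans (key n)).
have M1p : 0 < M1 + 1 by rewrite ltr_pwDr.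
move/ltW: ne; rewrite ler_pdivlMr // => ne; apply: le_trans ne.
by rewrite mulrC ler_wpM2l ?invr_ge0 // lerDl.
Qed.

End Expectation.

(** * From independent events to orthogonality of functions *)

Section Independence.
Context (d : measure_display) (T : measurableType d) (R : realType).
Variable P : probability T R.
Context (I : choiceType) (D : set I) (X : I -> T -> R[i]).
Hypothesis mX : forall i, D i -> measurable_fun setT (fun w => complex_pair (X i w)).
Hypothesis indX : mutually_independent P D X.

Let event (s : seq I) (A : I -> set (R * R)) :=
  [set w | forall i, i \in s -> A i (complex_pair (X i w))].

Let event_cons i s A :
  event (i :: s) A = [set w | A i (complex_pair (X i w))] `&` event s A.
Proof.
apply/seteqP; split => w /=.
  by move=> h; split=> [|j js]; apply: h; rewrite inE ?eqxx ?js ?orbT.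
by move=> [h1 h2] j; rewrite inE => /orP[/eqP ->|/h2].
Qed.

Let measurable_preX i A : D i -> measurable A ->
  measurable [set w | A (complex_pair (X i w))].
Proof. by move=> Di mA; rewrite -[X in measurable X]setTI; exact: mX. Qed.

Let measurable_event s A : (forall i, i \in s -> D i) ->
  (forall i, i \in s -> measurable (A i)) -> measurable (event s A).
Proof.
elim: s => [|i s IH] Ds mA.
  rewrite (_ : event _ _ = setT) //; by apply/seteqP; split.
rewrite event_cons; apply: measurableI.
  by apply: measurable_preX; [apply: Ds|apply: mA]; rewrite mem_head.
by apply: IH => j js; [apply: Ds|apply: mA]; rewrite inE js orbT.
Qed.

Let event_indep p s A : uniq (p :: s) -> (forall i, i \in p :: s -> D i) ->
  (forall i, i \in p :: s -> measurable (A i)) ->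
  P (event (p :: s) A) = (P [set w | A p (complex_pair (X p w))] * P (event s A))%E.
Proof.
move=> us Ds mA; rewrite /event indX // big_cons indX //.
- by case/andP: us.
- by move=> i si; apply: Ds; rewrite inE si orbT.
- by move=> i si; apply: mA; rewrite inE si orbT.
Qed.

(** Independence is given for events, so the functions are turned into indicators one factor at a
    time: [Ex_mul_comp_eq0] reduces each factor to the indicators of its values. *)
Lemma independent_orthogonal (p : I) (s : seq I) (g : R * R -> R) (h : I -> R * R -> R) :
  uniq (p :: s) -> (forall i, i \in p :: s -> D i) ->
  bounded_measurable g -> (forall i, bounded_measurable (h i)) ->
  Ex P (fun w => g (complex_pair (X p w))) = 0 ->
  Ex P (fun w => g (complex_pair (X p w)) *
    \prod_(i <- s) h i (complex_pair (X i w))) = 0.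
Proof.
move=> us Ds [mg [Mg gM]] bh g0.
have bcomp i (k : R * R -> R) : D i -> bounded_measurable k ->
    bounded_measurable (fun w => k (complex_pair (X i w))).
  by move=> Di [mk [M kM]]; split; [apply: measurableT_comp (mX Di)|exists M].
have Dp : D p by apply: Ds; rewrite mem_head.
(* The list [s2] carries the factors already replaced by indicators. *)
suff H s2 A : uniq (p :: s ++ s2) -> (forall i, i \in p :: s ++ s2 -> D i) ->
    (forall i, i \in s2 -> measurable (A i)) ->
    Ex P (fun w => g (complex_pair (X p w)) *
      (\prod_(i <- s) h i (complex_pair (X i w)) * \1_(event s2 A) w)) = 0.
  rewrite -[RHS](H [::] (fun=> setT)) ?cats0 //; congr Ex; apply/funext => w.
  by rewrite indicE mem_set ?mulr1.
elim: s s2 A {us Ds} => [|i s IH] s2 A us Ds mA.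
  have mE : measurable (event s2 A).
    by apply: measurable_event => // i si; apply: Ds; rewrite inE si orbT.
  have bE := bounded_measurable_indic R mE.
  have bg : bounded_measurable (fun w => g (complex_pair (X p w))).
    by apply: bcomp => //; split => //; exists Mg.
  pose c := fine (P (event s2 A)).
  (* Here the function expanded into indicators is [g], and the centred indicator of the event is
     the fixed factor. *)
  have : Ex P (fun w => (\1_(event s2 A) w - c) * g (complex_pair (X p w))) = 0.
    apply: Ex_mul_comp_eq0 => //.
    - by apply: bounded_measurableB => //; exact: bounded_measurable_cst.
    - exact: mX.
    - by exists Mg.
    move=> B mB; have mpB := measurable_preX Dp mB.
    have bB := bounded_measurable_indic R mpB.
    rewrite (_ : (fun w => _) = (fun w => \1_([set w | B (complex_pair (X p w))] `&` event s2 A) w -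
         c * \1_[set w | B (complex_pair (X p w))] w)); last first.
      apply/funext => w; rewrite mulrBl indicI /= mulrC; congr (_ - _).
    rewrite ExB ?ExZ //; last 2 first.
    - by apply: bounded_measurable_indic; exact: measurableI.
    - exact: bounded_measurableZ.
    rewrite !Ex_indic //; last exact: measurableI.
    pose A' j := if j == p then B else A j.
    have ps2 : p \notin s2 by case/andP: us.
    have A's2 : event s2 A' = event s2 A.
      apply/seteqP; split => w /= Hw i si; have := Hw i si; rewrite /A';
        by case: eqP => // ip; rewrite -ip si in ps2.
    have := @event_indep p s2 A' us Ds; rewrite event_cons A's2 /A' eqxx => -> //.
      rewrite fineM ?fin_num_measure // mulrC subrr //.
    move=> j; rewrite inE; case: eqP => //= _; exact: mA.
  under eq_fun do rewrite mulrBl.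
  rewrite ExB ?ExZ //; [|exact: bounded_measurableM|exact: bounded_measurableZ].
  rewrite g0 mulr0 subr0 => <-; congr Ex; apply/funext => w.
  by rewrite big_nil mul1r mulrC.
have [isn2 ps] : i \notin s ++ s2 /\ uniq (p :: s ++ s2).
  by move: us; rewrite /= inE negb_or => /andP[/andP[_ ->] /andP[-> ->]].
have Di : D i by apply: Ds; rewrite !inE eqxx orbT.
have Ds' j : j \in p :: s ++ s2 -> D j.
  by rewrite inE => /orP[|] js; apply: Ds; rewrite !inE js ?orbT.
have bprod (r : seq I) : (forall j, j \in r -> D j) ->
    bounded_measurable (fun w => \prod_(j <- r) h j (complex_pair (X j w))).
  elim: r => [|j r IHr] Dr; first by under eq_fun do rewrite big_nil; exact: bounded_measurable_cst.
  under eq_fun do rewrite big_cons; apply: bounded_measurableM.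
    by apply: bcomp => //; apply: Dr; rewrite mem_head.
  by apply: IHr => k kr; apply: Dr; rewrite inE kr orbT.
have : Ex P (fun w => (g (complex_pair (X p w)) *
      (\prod_(i <- s) h i (complex_pair (X i w)) * \1_(event s2 A) w)) *
      h i (complex_pair (X i w))) = 0.
  have [mhi hiM] := bh i.
  apply: Ex_mul_comp_eq0 => //.
  - apply: bounded_measurableM; first by apply: bcomp => //; split => //; exists Mg.
    apply: bounded_measurableM.
      by apply: bprod => j js; apply: Ds'; rewrite inE mem_cat js orbT.
    apply: bounded_measurable_indic; apply: measurable_event => // j js.
    by apply: Ds'; rewrite inE mem_cat js !orbT.
  - exact: mX.
  move=> B mB; pose A' j := if j == i then B else A j.
  have -> : (fun w => g (complex_pair (X p w)) * (\prod_(i0 <- s) h i0 (complex_pair (X i0 w)) *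
      \1_(event s2 A) w) * \1_B (complex_pair (X i w))) =
     (fun w => g (complex_pair (X p w)) * (\prod_(i0 <- s) h i0 (complex_pair (X i0 w)) *
      \1_(event (i :: s2) A') w)).
    apply/funext => w; rewrite -!mulrA; congr (_ * (_ * _)).
    rewrite event_cons /A' eqxx indicI /= mulrC; congr (_ * _).
    congr (\1_ _ w); apply/seteqP; split => v /= Hv j sj; have := Hv j sj.
      by case: eqP => // ji; rewrite -ji mem_cat sj orbT in isn2.
    by case: eqP => // ji; rewrite -ji mem_cat sj orbT in isn2.
  apply: IH.
  - rewrite -(perm_uniq (s1 := p :: (i :: s) ++ s2)) ?perm_cons //.
    exact: permEl (perm_catCA [:: i] s s2).
  - move=> j; rewrite -(perm_mem (s1 := p :: (i :: s) ++ s2)); first exact: Ds.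
    rewrite perm_cons; exact: permEl (perm_catCA [:: i] s s2).
  - move=> j; rewrite inE /A'; case: eqP => //= _; exact: mA.
move=> <-; congr Ex; apply/funext => w; rewrite big_cons -!mulrA.
by congr (_ * _); rewrite mulrC -!mulrA.
Qed.

End Independence.


Lemma Ex_transfer (R : realType) (d1 d2 d3 : measure_display) (T1 : measurableType d1)
    (T2 : measurableType d2) (U : measurableType d3) (P1 : probability T1 R) (P2 : probability T2 R)
    (X1 : T1 -> U) (X2 : T2 -> U) (g : U -> R) :
  measurable_fun setT X1 -> measurable_fun setT X2 -> bounded_measurable g ->
  (forall A, measurable A -> P1 (X1 @^-1` A) = P2 (X2 @^-1` A)) ->
  Ex P1 (g \o X1) = Ex P2 (g \o X2).
Proof.
move=> m1 m2 [mg [M gM]] P12.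
have b1 : bounded_measurable (g \o X1) by split; [exact: measurableT_comp|exists M => w /=].
have b2 : bounded_measurable (g \o X2) by split; [exact: measurableT_comp|exists M => w /=].
apply: EFin_inj; rewrite -!Ex_EFin //.
have i1 := @integral_pushforward _ _ _ _ _ X1 m1 P1 setT (EFin \o g).
have i2 := @integral_pushforward _ _ _ _ _ X2 m2 P2 setT (EFin \o g).
rewrite !preimage_setT in i1 i2.
have mg' : measurable_fun setT (EFin \o g) by exact/measurable_EFinP.
rewrite -i1 // -?i2 //.
- by apply: eq_measure_integral => A mA _; exact: P12.
- exact: bounded_measurable_integrable b2.
- exact: bounded_measurable_integrable b1.
Qed.

(** * Bounded complex random variables *)

Section ComplexBounded.
Context (d : measure_display) (T : measurableType d) (R : realType).
Implicit Types Z W : T -> R[i].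

Definition cbounded Z := bounded_measurable (fun w => complex.Re (Z w)) /\
  bounded_measurable (fun w => complex.Im (Z w)).

Lemma complex_ReM (z w : R[i]) : complex.Re (z * w) =
  complex.Re z * complex.Re w - complex.Im z * complex.Im w.
Proof. by case: z w => a b [c e]. Qed.

Lemma complex_ImM (z w : R[i]) : complex.Im (z * w) =
  complex.Re z * complex.Im w + complex.Im z * complex.Re w.
Proof. by case: z w => a b [c e]. Qed.

Lemma complex_ReD (z w : R[i]) : complex.Re (z + w) = complex.Re z + complex.Re w.
Proof. by case: z w => a b [c e]. Qed.

Lemma complex_Re_conj (z : R[i]) : complex.Re (z^*)%C = complex.Re z.
Proof. by case: z. Qed.

Lemma complex_Im_conj (z : R[i]) : complex.Im (z^*)%C = - complex.Im z.
Proof. by case: z. Qed.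

Lemma cbounded_cst z : cbounded (cst z).
Proof. by split; exact: bounded_measurable_cst. Qed.

Lemma cboundedM Z W : cbounded Z -> cbounded W -> cbounded (fun w => Z w * W w).
Proof.
move=> [a b] [c e]; split.
  under eq_fun do rewrite complex_ReM.
  by apply: bounded_measurableB; exact: bounded_measurableM.
under eq_fun do rewrite complex_ImM.
by apply: bounded_measurableD; exact: bounded_measurableM.
Qed.

Lemma cboundedZ k Z : cbounded Z -> cbounded (fun w => k * Z w).
Proof. by move=> bZ; apply: cboundedM => //; exact: cbounded_cst. Qed.

Lemma cboundedX Z n : cbounded Z -> cbounded (fun w => Z w ^+ n).
Proof.
move=> bZ; elim: n => [|n IH]; first exact: cbounded_cst.
by under eq_fun do rewrite exprS; exact: cboundedM.
Qed.

Lemma cbounded_conj Z : cbounded Z -> cbounded (fun w => (Z w)^*%C).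
Proof.
move=> [a b]; split; first by under eq_fun do rewrite complex_Re_conj.
by under eq_fun do rewrite complex_Im_conj; exact: bounded_measurableN.
Qed.

Lemma cbounded_prod (I : Type) (s : seq I) (Z : I -> T -> R[i]) :
  (forall i, cbounded (Z i)) -> cbounded (fun w => \prod_(i <- s) Z i w).
Proof.
move=> bZ; elim: s => [|i s IH].
  by under eq_fun do rewrite big_nil; exact: cbounded_cst.
by under eq_fun do rewrite big_cons; exact: cboundedM.
Qed.

End ComplexBounded.

(** * Moments of the uniform law on the circle *)

Section Circle.
Variable R : realType.

Definition cis (x : R) : R[i] := Complex (cos x) (sin x).

Lemma cisM x y : cis x * cis y = cis (x + y).
Proof.
by apply/eqP; rewrite eq_complex complex_ReM complex_ImM /= cosD sinD; apply/andP; split; apply/eqP; ring.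
Qed.

Lemma cis0 : cis 0 = 1.
Proof. by rewrite /cis cos0 sin0. Qed.

Lemma cisX x n : cis x ^+ n = cis (n%:R * x).
Proof.
elim: n => [|n IH]; first by rewrite mul0r cis0.
by rewrite exprS IH cisM -[n.+1%:R]natr1 mulrDl mul1r addrC.
Qed.

Lemma cis_conj x : (cis x)^*%C = cis (- x).
Proof. by rewrite /cis cosN sinN. Qed.

(* The value 1 off the circle is a convention: it is used on a null event. *)
Definition unit_part (z : R[i]) : R[i] :=
  if complex.Re z ^+ 2 + complex.Im z ^+ 2 == 1 then z else 1.

Lemma unit_partE z : unit_part z * (unit_part z)^*%C = 1.
Proof.
rewrite /unit_part; case: eqP => [h|_]; last by rewrite mul1r /=; apply/eqP; rewrite eq_complex /= oppr0 !eqxx.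
apply/eqP; rewrite eq_complex complex_ReM complex_ImM complex_Re_conj complex_Im_conj /=.
by rewrite mulrN opprK -!expr2 h eqxx /= mulrN mulrC addNr.
Qed.

Lemma unit_part_cis x : unit_part (cis x) = cis x.
Proof. by rewrite /unit_part /= cos2Dsin2 eqxx. Qed.

Lemma cbounded_unit_part :
  cbounded (fun x : R * R => unit_part (Complex x.1 x.2)).
Proof.
have mb : measurable_fun setT (fun x : R * R => x.1 ^+ 2 + x.2 ^+ 2 == 1).
  apply: measurable_fun_eqr => //; apply: measurable_funD; apply: measurable_funX;
  [exact: measurable_fst|exact: measurable_snd].
rewrite /cbounded /unit_part /=; split.
  rewrite (_ : (fun _ => _) = (fun x : R * R => if x.1 ^+ 2 + x.2 ^+ 2 == 1 then x.1 else 1)).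
    split; first by apply: measurable_fun_ifT => //; exact: measurable_fst.
    exists 1 => x; case: eqP => [h|_]; last by rewrite normr1.
    by rewrite -(ler_pXn2r (n := 2)) ?nnegrE // real_normK ?num_real // expr1n; have := sqr_ge0 x.2; lra.
  by apply/funext => x; case: ifP.
rewrite (_ : (fun _ => _) = (fun x : R * R => if x.1 ^+ 2 + x.2 ^+ 2 == 1 then x.2 else 0)).
  split; first by apply: measurable_fun_ifT => //; exact: measurable_snd.
  exists 1 => x; case: eqP => [h|_]; last by rewrite normr0.
  by rewrite -(ler_pXn2r (n := 2)) ?nnegrE // real_normK ?num_real // expr1n; have := sqr_ge0 x.1; lra.
by apply/funext => x; case: ifP.
Qed.

Lemma is_derive_FTC (f F : R -> R) (a b : R) : a < b -> continuous f ->
  (forall x : R, is_derive x 1 F (f x)) ->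
  (\int[lebesgue_measure]_(x in `[a, b]) (f x)%:E)%E = (F b - F a)%:E.
Proof.
move=> ab cf dF; have cF x : {for x, continuous F}.
  by apply: differentiable_continuous; apply/derivable1_diffP; apply: ex_derive.
rewrite (continuous_FTC2 (F := F) ab) ?EFinB //.
- exact: continuous_subspaceT.
- split.
  + by move=> x _; exact: ex_derive.
  + by apply: cvg_at_right_filter; exact: cF.
  + by apply: cvg_at_left_filter; exact: cF.
- by move=> x _; rewrite derive1E; exact: derive_val.
Qed.

(** The frequency [a] is a nonzero integer multiple of [2 pi], so a trigonometric antiderivative
    takes the same value at [0] and at [1]. *)
Lemma circle_moment (k : R[i]) (b c : nat) : b != c ->
  Ex (uniform_prob (@ltr01 R)) (fun u => complex.Re (k *
    (cis (2 * pi * u) ^+ b * (cis (2 * pi * u))^*%C ^+ c))) = 0.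
Proof.
move=> bc; pose a : R := 2 * pi * (b%:R - c%:R).
have a0 : a != 0 by rewrite !mulf_neq0 ?pnatr_eq0 ?subr_eq0 ?eqr_nat // gt_eqF // pi_gt0.
pose A := complex.Re k; pose B := complex.Im k; pose M := `|A| + `|B|.
(* Adding [M] makes the integrand nonnegative, which is what [integral_uniform] asks for. *)
pose f u := A * cos (a * u) - B * sin (a * u) + M.
have -> : (fun u : R => complex.Re (k *
    (cis (2 * pi * u) ^+ b * (cis (2 * pi * u))^*%C ^+ c))) = (fun u => f u - M).
  apply/funext => u; rewrite cis_conj !cisX cisM complex_ReM /f addrK /=.
  by congr (_ * cos _ - _ * sin _); rewrite /a; ring.
have cau : continuous (fun u : R => a * u).
  by move=> x; apply: cvgM; [exact: cvg_cst|exact: cvg_id].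
have ccos : continuous (fun u : R => cos (a * u)).
  by move=> x; apply: continuous_comp; [exact: cau|exact: continuous_cos].
have csin : continuous (fun u : R => sin (a * u)).
  by move=> x; apply: continuous_comp; [exact: cau|exact: continuous_sin].
have cf : continuous f.
  move=> x; apply: cvgD; last exact: cvg_cst.
  by apply: cvgB; (apply: cvgM; first exact: cvg_cst); [exact: ccos|exact: csin].
have fM u : `|A * cos (a * u) - B * sin (a * u)| <= M.
  rewrite (le_trans (ler_normB _ _)) // lerD // normrM ler_piMr ?normr_ge0 // ler_norml.
    by rewrite cos_geN1 cos_le1.
  by rewrite sin_geN1 sin_le1.
have bf : @bounded_measurable _ (measurableTypeR R) R f.
  split; first exact: continuous_measurable_fun.
  exists (M + M) => u; rewrite (le_trans (ler_normD _ _)) // lerD // ger0_norm //.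
  by rewrite addr_ge0.
have bM : @bounded_measurable _ (measurableTypeR R) R (cst M) by exact: bounded_measurable_cst.
rewrite (ExB _ bf bM) Ex_cst; apply/eqP; rewrite subr_eq0; apply/eqP.
apply: EFin_inj; rewrite -Ex_EFin // integral_uniform //; last 2 first.
- by apply/measurable_EFinP; case: bf.
- by move=> u; rewrite lee_fin -lerBlDr sub0r; have := fM u; rewrite ler_norml => /andP[].
pose F u := a^-1 * (A * sin (a * u) + B * cos (a * u)) + M * u.
have dF (x : R) : is_derive x 1 F (f x).
  by apply: is_derive_eq; rewrite /f /GRing.scale /= !mulr1; field.
rewrite (is_derive_FTC ltr01 cf dF) subr0 invr1 mul1e /F mulr0 mulr1 mulr0 sin0 cos0.
have cis2pi n : cis (n%:R * (2 * pi)) = 1 :> R[i].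
  by rewrite -cisX mulr_natl /cis cos2pi sin2pi expr1n.
have : cis a = 1.
  have -> : a = b%:R * (2 * pi) + - (c%:R * (2 * pi)) by rewrite /a; ring.
  rewrite -cisM -cis_conj !cis2pi mul1r.
  by apply/eqP; rewrite eq_complex /= oppr0 !eqxx.
by case=> -> ->; congr (_%:E); ring.
Qed.

End Circle.

(** * Orthogonality of monomials in independent circle variables *)

Section UnitParts.
Context (d : measure_display) (T : measurableType d) (R : realType).
Variable P : probability T R.
Context (I : choiceType) (D : set I) (X : I -> T -> R[i]).
Hypothesis mX : forall i, D i -> measurable_fun setT (fun w => complex_pair (X i w)).
Hypothesis unifX : forall i, D i -> uniform_on_circle P (X i).
Hypothesis indX : mutually_independent P D X.

Let zpart (b c : nat) (x : R * R) : R[i] :=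
  unit_part (Complex x.1 x.2) ^+ b * (unit_part (Complex x.1 x.2))^*%C ^+ c.

Let cbounded_zpart b c : cbounded (zpart b c).
Proof.
apply: cboundedM; apply: cboundedX; first exact: cbounded_unit_part.
by apply: cbounded_conj; exact: cbounded_unit_part.
Qed.

Let measurable_circle : measurable_fun setT
  (fun u : measurableTypeR R => (cos (2 * pi * u), sin (2 * pi * u))).
Proof.
have cau : continuous (fun u : R => 2 * pi * u).
  by move=> x; apply: cvgM; [exact: cvg_cst|exact: cvg_id].
apply: measurable_fun_pair; apply: continuous_measurable_fun => x;
  by apply: continuous_comp; [exact: cau|solve [exact: continuous_cos|exact: continuous_sin]].
Qed.

Lemma Ex_uniform_on_circle i (g : R * R -> R) : D i -> bounded_measurable g ->
  Ex P (fun w => g (complex_pair (X i w))) =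
  Ex (uniform_prob (@ltr01 R)) (fun u => g (cos (2 * pi * u), sin (2 * pi * u))).
Proof.
move=> Di bg; apply: (Ex_transfer (X1 := fun w => complex_pair (X i w))) => //.
  exact: mX.
by move=> A mA; exact: (unifX Di mA).
Qed.

Lemma unit_part_ae i : D i ->
  P [set w | complex.Re (X i w) ^+ 2 + complex.Im (X i w) ^+ 2 != 1] = 0%E.
Proof.
move=> Di; pose A := [set x : R * R | x.1 ^+ 2 + x.2 ^+ 2 != 1].
have mA : measurable A.
  rewrite /A -[X in measurable X]setTI.
  have mb : measurable_fun setT (fun x : R * R => x.1 ^+ 2 + x.2 ^+ 2 == 1).
    apply: measurable_fun_eqr => //; apply: measurable_funD; apply: measurable_funX;
    [exact: measurable_fst|exact: measurable_snd].
  rewrite (_ : [set x | _] = (fun x : R * R => x.1 ^+ 2 + x.2 ^+ 2 == 1) @^-1` [set false]).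
    exact: mb.
  by apply/seteqP; split => x /=; [move/negbTE|move=> ->].
have := unifX Di mA; rewrite /A /= => ->.
rewrite (_ : [set u | _] = set0) ?measure0 //.
by apply/seteqP; split => u //=; rewrite cos2Dsin2 eqxx.
Qed.

Let Ex_zpart_eq0 p (k : R[i]) (b c : nat) : D p -> b != c ->
  Ex P (fun w => complex.Re (k * zpart b c (complex_pair (X p w)))) = 0.
Proof.
move=> Dp bc.
have bg : bounded_measurable (fun x => complex.Re (k * zpart b c x)).
  by have [] := cboundedZ k (cbounded_zpart b c).
rewrite (Ex_uniform_on_circle Dp bg) -[RHS](circle_moment k bc).
by congr Ex; apply/funext => u; rewrite /zpart /= unit_part_cis.
Qed.

Let bounded_compX j (f : R * R -> R) : D j -> bounded_measurable f ->
  bounded_measurable (fun w => f (complex_pair (X j w))).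
Proof.
by move=> Dj [mf [M fM]]; split; [apply: measurableT_comp (mX Dj)|exists M].
Qed.

Let bounded_prodX (s : seq I) (h : I -> R * R -> R) :
  (forall i, i \in s -> D i) -> (forall i, bounded_measurable (h i)) ->
  bounded_measurable (fun w => \prod_(j <- s) h j (complex_pair (X j w))).
Proof.
move=> + bh; elim: s => [|j s IH] Ds.
  by under eq_fun do rewrite big_nil; exact: bounded_measurable_cst.
under eq_fun do rewrite big_cons; apply: bounded_measurableM.
  by apply: bounded_compX => //; apply: Ds; rewrite mem_head.
by apply: IH => l ls; apply: Ds; rewrite inE ls orbT.
Qed.

Let cbounded_prodX (s : seq I) (z : I -> R * R -> R[i]) :
  (forall i, i \in s -> D i) -> (forall i, cbounded (z i)) ->
  cbounded (fun w => \prod_(j <- s) z j (complex_pair (X j w))).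
Proof.
move=> + bz; elim: s => [|j s IH] Ds.
  by under eq_fun do rewrite big_nil; exact: cbounded_cst.
under eq_fun do rewrite big_cons; apply: cboundedM.
  have Dj : D j by apply: Ds; rewrite mem_head.
  by split; [exact: bounded_compX Dj (bz j).1|exact: bounded_compX Dj (bz j).2].
by apply: IH => l ls; apply: Ds; rewrite inE ls orbT.
Qed.

Let bounded_mixed (p : I) (s1 s2 : seq I) (g : R * R -> R) (z : I -> R * R -> R[i])
    (h : I -> R * R -> R) (k : R[i]) :
  (forall i, i \in p :: s1 ++ s2 -> D i) ->
  bounded_measurable g -> (forall i, cbounded (z i)) -> (forall i, bounded_measurable (h i)) ->
  bounded_measurable (fun w => g (complex_pair (X p w)) *
    (complex.Re (k * \prod_(i <- s1) z i (complex_pair (X i w))) *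
    \prod_(i <- s2) h i (complex_pair (X i w)))).
Proof.
move=> Ds bg bz bh; apply: bounded_measurableM.
  by apply: bounded_compX => //; apply: Ds; rewrite mem_head.
apply: bounded_measurableM.
  have Ds1 j : j \in s1 -> D j by move=> js; apply: Ds; rewrite inE mem_cat js orbT.
  by have [] := cboundedZ k (cbounded_prodX Ds1 bz).
by apply: bounded_prodX => // j js; apply: Ds; rewrite inE mem_cat js !orbT.
Qed.

(** [independent_orthogonal] handles products of real functions. The complex factors are therefore
    moved one by one from [s1] to [s2], each splitting into its real and its imaginary part; the
    constant [k] absorbs the powers of [i] that arise. *)
Let Ex_complex_prod_eq0 (p : I) (s1 s2 : seq I) (g : R * R -> R) (z : I -> R * R -> R[i])
    (h : I -> R * R -> R) (k : R[i]) :
  uniq (p :: s1 ++ s2) -> (forall i, i \in p :: s1 ++ s2 -> D i) ->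
  bounded_measurable g -> (forall i, cbounded (z i)) -> (forall i, bounded_measurable (h i)) ->
  Ex P (fun w => g (complex_pair (X p w))) = 0 ->
  Ex P (fun w => g (complex_pair (X p w)) *
    (complex.Re (k * \prod_(i <- s1) z i (complex_pair (X i w))) *
    \prod_(i <- s2) h i (complex_pair (X i w)))) = 0.
Proof.
move=> + + bg bz + g0; elim: s1 s2 h k => [|i s1 IH] s2 h k us Ds bh.
  under eq_fun do rewrite big_nil mulr1 mulrCA.
  rewrite ExZ ?(independent_orthogonal mX indX us) ?mulr0 //.
  apply: bounded_measurableM; first by apply: bounded_compX => //; apply: Ds; rewrite mem_head.
  by apply: bounded_prodX => // j js; apply: Ds; rewrite inE js orbT.
have perm : perm_eq (p :: (i :: s1) ++ s2) (p :: s1 ++ i :: s2).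
  by rewrite perm_cons; exact: permEl (perm_catCA [:: i] s1 s2).
have isn : i \notin s2.
  by move: us => /= /and3P[_ + _]; rewrite mem_cat negb_or => /andP[].
have us' : uniq (p :: s1 ++ i :: s2) by rewrite -(perm_uniq perm).
have Ds' j : j \in p :: s1 ++ i :: s2 -> D j by rewrite -(perm_mem perm); exact: Ds.
pose h1 f j := if j == i then f else h j.
have bh1 f : bounded_measurable f -> forall j, bounded_measurable (h1 f j).
  by move=> bf j; rewrite /h1; case: eqP.
have prod_h1 f w : \prod_(j <- i :: s2) h1 f j (complex_pair (X j w)) =
    f (complex_pair (X i w)) * \prod_(j <- s2) h j (complex_pair (X j w)).
  rewrite big_cons /h1 eqxx; congr (_ * _); apply: eq_big_seq => j js.
  by case: eqP => // ji; rewrite -ji js in isn.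
have e1 := IH (i :: s2) (h1 (fun x => complex.Re (z i x))) k us' Ds' (bh1 _ (bz i).1).
(* [Re (z k Z) = Re z * Re (k Z) + Im z * Re (i k Z)], since [Re (i x) = - Im x]. *)
have e2 := IH (i :: s2) (h1 (fun x => complex.Im (z i x))) (Complex 0 1 * k) us' Ds' (bh1 _ (bz i).2).
have bb f k' (bf : bounded_measurable f) := bounded_mixed k' Ds' bg bz (bh1 f bf).
rewrite -[RHS]addr0 -[X in _ = X + _]e1 -[X in _ = _ + X]e2 -ExD; [|exact: bb (bz i).1|exact: bb (bz i).2].
congr Ex; apply/funext => w; rewrite !prod_h1 big_cons.
set Z := \prod_(j <- s1) _; set h2 := \prod_(j <- s2) _; set g' := g _; set zi := z i _.
rewrite !complex_ReM !complex_ImM /=; ring.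
Qed.

(** With [z] the factor at [p] and [Z] the product of the others, [Re (k z Z)] is
    [Re (k z) * Re Z - Im (k z) * Im Z]. Both [Re (k z)] and [Im (k z) = Re (- i k z)] have mean
    zero because [b p != c p]. *)
Lemma unit_part_orthogonal (s : seq I) (b c : I -> nat) (p : I) (k : R[i]) :
  uniq s -> (forall i, i \in s -> D i) -> p \in s -> b p != c p ->
  Ex P (fun w => complex.Re (k *
    \prod_(i <- s) (unit_part (X i w) ^+ b i * (unit_part (X i w))^*%C ^+ c i))) = 0.
Proof.
move=> us Ds ps bcp; pose z i := zpart (b i) (c i).
have zE i w : unit_part (X i w) ^+ b i * (unit_part (X i w))^*%C ^+ c i = z i (complex_pair (X i w)).
  by rewrite /z /zpart /=; case: (X i w).
under eq_fun do under eq_bigr do rewrite zE.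
have perm := perm_to_rem ps.
have us' : uniq (p :: rem p s ++ [::]) by rewrite cats0 -(perm_uniq perm).
have Ds' j : j \in p :: rem p s ++ [::] -> D j by rewrite cats0 -(perm_mem perm); exact: Ds.
have Dp := Ds _ ps.
have bz i : cbounded (z i) by exact: cbounded_zpart.
have bk k' := cboundedZ k' (bz p).
have h0 k' := Ex_zpart_eq0 k' Dp bcp.
have bh (i : I) : @bounded_measurable _ _ R (cst 0 : R * R -> R) by exact: bounded_measurable_cst.
have e1 := Ex_complex_prod_eq0 1 us' Ds' (bk k).1 bz bh (h0 k).
have e2 := Ex_complex_prod_eq0 (Complex 0 1) us' Ds' (bk (Complex 0 (-1) * k)).1 bz bh (h0 _).
rewrite -[RHS]addr0 -[X in _ = X + _]e1 -[X in _ = _ + X]e2 -ExD.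
- congr Ex; apply/funext => w; rewrite (perm_big _ perm) /= big_cons !big_nil !mulr1.
  set Z := \prod_(j <- rem _ _) _; set zi := z p _.
  by move: Z zi => Z zi; rewrite mul1r !complex_ReM !complex_ImM /=; ring.
- exact: (bounded_mixed _ Ds' (bk k).1 bz bh).
- exact: (bounded_mixed _ Ds' (bk (Complex 0 (-1) * k)).1 bz bh).
Qed.
End UnitParts.


(** * Bernstein polynomials *)

Section Bernstein.
Variable R : realType.
Implicit Types (g h : nat -> R) (u : R).

(* [bern n g u] is the mean of [g] under the binomial law with parameters
   [n] and [u]; conditioning on the first trial gives the recursion. *)
Fixpoint bern n g u : R :=
  if n is m.+1 then u * bern m (fun k => g k.+1) u + (1 - u) * bern m g u
  else g 0%N.

Lemma bern_cst n c u : bern n (fun=> c) u = c.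
Proof. by elim: n => //= n ->; ring. Qed.

Lemma bernD n g h u : bern n (fun k => g k + h k) u = bern n g u + bern n h u.
Proof. by elim: n g h => //= n IH g h; rewrite !IH; ring. Qed.

Lemma bernZ n c g u : bern n (fun k => c * g k) u = c * bern n g u.
Proof. by elim: n g => //= n IH g; rewrite !IH; ring. Qed.

Lemma eq_bern n g h u : (forall k, g k = h k) -> bern n g u = bern n h u.
Proof.
by elim: n g h => //= n IH g h gh; congr (_ * _ + _ * _); apply: IH => k; exact: gh.
Qed.

Lemma bern_sq n a u :
  bern n (fun k => (k%:R - a) ^+ 2) u = n%:R * u * (1 - u) + (n%:R * u - a) ^+ 2.
Proof.
elim: n a => [|n IH] a /=; first by ring.
(* A success in the first trial moves the centre from [a] to [a - 1]. *)
rewrite (@eq_bern _ _ (fun k => (k%:R - (a - 1)) ^+ 2)) => [|k]; last first.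
  by rewrite -natr1; ring.
by rewrite !IH -natr1; ring.
Qed.

Lemma le_bern n g h u : 0 <= u <= 1 -> (forall k, (k <= n)%N -> g k <= h k) ->
  bern n g u <= bern n h u.
Proof.
move=> /andP[u0 u1]; elim: n g h => [|n IH] g h gh /=; first exact: gh.
apply: lerD; apply: ler_wpM2l; rewrite ?subr_ge0 //; apply: IH => k kn; apply: gh => //.
exact: leqW.
Qed.

(** Bernstein's argument: the variance of [k / n] is at most [1 / n], so a quadratic error term
    costs [C / n]. The hypothesis is stated in this quadratic form so that a Lipschitz bound, or a
    modulus of continuity with a global bound, can be fed in. *)
Lemma bern_approx n g u y e C : 0 <= u <= 1 -> (0 < n)%N -> 0 <= C ->
  (forall k, (k <= n)%N -> `|g k - y| <= e + C * (k%:R / n%:R - u) ^+ 2) ->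
  `|bern n g u - y| <= e + C / n%:R.
Proof.
move=> u01 n0 C0 H; have n0' : n%:R != 0 :> R by rewrite pnatr_eq0 -lt0n.
pose B k := e + C / n%:R ^+ 2 * (k%:R - n%:R * u) ^+ 2.
have HB k : (k <= n)%N -> `|g k - y| <= B k.
  move=> kn; apply: le_trans (H k kn) _; rewrite /B lerD2l.
  by rewrite le_eqVlt; apply/orP; left; apply/eqP; field.
have EB : bern n B u <= e + C / n%:R.
  rewrite /B bernD bern_cst bernZ bern_sq subrr expr0n /= addr0 lerD2l.
  have -> : C / n%:R ^+ 2 * (n%:R * u * (1 - u)) = C / n%:R * (u * (1 - u)) by field.
  rewrite ler_piMr ?divr_ge0 ?ler0n //; case/andP: u01 => *; nra.
rewrite -[y](bern_cst n y u) -mulN1r -bernZ -bernD ler_norml; apply/andP; split.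
  apply: le_trans (le_bern u01 (g := fun k => -1 * B k) _).
    by rewrite bernZ mulN1r lerN2.
  by move=> k kn; have := HB k kn; rewrite !mulN1r ler_norml => /andP[].
apply: le_trans EB; apply: le_bern => // k kn.
by have := HB k kn; rewrite mulN1r ler_norml => /andP[].
Qed.

End Bernstein.

(** * Taylor bounds and a differential inequality *)

Section RealTools.
Variable R : realType.
Implicit Types (x y h t : R).

Lemma sin_lip x y : `|sin x - sin y| <= `|x - y|.
Proof.
wlog xy : x y / y < x => [H|].
  have [/H//|/H|->] := ltgtP y x; last by rewrite !subrr.
  by rewrite distrC [leRHS]distrC.
have cs : {within `[y, x], continuous (@sin R)}.
  by apply: continuous_subspaceT; exact: continuous_sin.
have [c _ ->] := MVT xy (fun z _ => is_derive_sin z) cs.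
by rewrite normrM ler_piMl // ler_norml cos_geN1 cos_le1.
Qed.

Lemma sin_le_norm x : `|sin x| <= `|x|.
Proof. by have := sin_lip x 0; rewrite sin0 !subr0. Qed.

Let sin_half_le x : `|sin (x / 2)| <= `|x| / 2.
Proof. by rewrite (le_trans (sin_le_norm _)) // normrM normfV (@ger0_norm _ 2). Qed.

Lemma one_sub_cos x : 1 - cos x = 2 * sin (x / 2) ^+ 2.
Proof.
have -> : cos x = cos (x / 2 *+ 2) by congr cos; rewrite -mulr_natr divfK.
by rewrite cos_mulr2n -mulr_natr; have := cos2Dsin2 (x / 2); lra.
Qed.

Lemma norm_one_sub_cos x : `|1 - cos x| <= `|x|.
Proof.
rewrite one_sub_cos normrM normrX expr2 mulrA ger0_norm //.
have h1 : `|sin (x / 2)| <= 1 by rewrite ler_norml sin_geN1 sin_le1.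
have h2 := sin_half_le x.
by rewrite (@le_trans _ _ (2 * `|sin (x / 2)|)) //; [rewrite ler_piMr ?mulr_ge0|lra].
Qed.

Lemma one_sub_cos_sqr x : `|1 - cos x| <= x ^+ 2.
Proof.
rewrite one_sub_cos normrM normrX ger0_norm //.
have h2 := sin_half_le x; have h0 := normr_ge0 (sin (x / 2)).
rewrite -[leRHS](real_normK (num_real x)) (@le_trans _ _ (2 * (`|x| / 2) ^+ 2)) //.
  by rewrite ler_pM2l // ler_pXn2r ?nnegrE // divr_ge0.
by have := normr_ge0 x; nra.
Qed.

Lemma sub_sin_sqr x : `|x - sin x| <= x ^+ 2.
Proof.
wlog x0 : x / 0 < x => [H|].
  have [/H//|xn|<-] := ltgtP 0 x; last by rewrite sin0 subrr normr0 sqr_ge0.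
  by have := H (- x); rewrite oppr_gt0 sinN sqrrN -opprD normrN; exact.
have cs : {within `[0, x], continuous (@sin R)}.
  by apply: continuous_subspaceT; exact: continuous_sin.
have [c /andP[c0 cx]] := MVT x0 (fun z _ => is_derive_sin z) cs.
rewrite sin0 !subr0 => ->; rewrite -[X in X - _]mul1r -mulrBl normrM.
rewrite expr2 [`|x|]gtr0_norm // ler_wpM2r ?(ltW x0) //.
rewrite !bnd_simp in c0 cx.
by apply: le_trans (norm_one_sub_cos c) _; rewrite gtr0_norm // ltW.
Qed.

Lemma sin_taylor2 x h : `|sin x - sin (x - h) - h * cos x| <= 2 * h ^+ 2.
Proof.
have -> : sin x - sin (x - h) - h * cos x =
    sin x * (1 - cos h) - cos x * (h - sin h) by rewrite sinB; ring.
rewrite (le_trans (ler_normB _ _)) // mulr_natl mulr2n lerD // normrM.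
  apply: le_trans (one_sub_cos_sqr h); rewrite ler_piMl // ler_norml.
  by rewrite sin_geN1 sin_le1.
apply: le_trans (sub_sin_sqr h); rewrite ler_piMl // ler_norml.
by rewrite cos_geN1 cos_le1.
Qed.

Lemma cos_taylor2 x h : `|cos (x + h) - cos x + h * sin x| <= 2 * h ^+ 2.
Proof.
have := sin_taylor2 (x + pi / 2) (- h).
rewrite opprK addrAC !sinDpihalf cosDpihalf mulrNN sqrrN.
rewrite [x + _ + h]addrAC sinDpihalf -normrN; congr (`|_| <= _); ring.
Qed.

(** A pointwise second-order Taylor bound survives integration, so this lets an expectation be
    differentiated in a parameter without a theorem on differentiation under the integral sign. *)
Lemma is_derive_quadratic (f : R -> R) x a C :
  (forall h, `|f (x + h) - f x - h * a| <= C * h ^+ 2) -> is_derive x 1 f a.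
Proof.
move=> H; have C0 : 0 <= C.
  by have := le_trans (normr_ge0 _) (H 1); rewrite expr1n mulr1.
have lim : h^-1 *: ((f \o shift x) (h *: 1) - f x) @[h --> 0^'] --> a.
  apply/cvgrPdist_le => e e0; near=> h.
  have h0 : h != 0 by near: h; exact: nbhs_dnbhs_neq.
  rewrite /= [h%:A]mulr1 [h + x]addrC.
  have -> : a - h^-1 *: (f (x + h) - f x) = - (h^-1 * (f (x + h) - f x - h * a)).
    by rewrite /GRing.scale /=; by field.
  rewrite normrN normrM normfV ler_pdivrMl ?normr_gt0 //.
  apply: le_trans (H h) _; rewrite -(real_normK (num_real h)) expr2 mulrCA.
  rewrite ler_wpM2l //.
  have hC : `|h| <= e / (C + 1).
    by near: h; apply: dnbhs0_le; rewrite divr_gt0 // ltr_wpDl.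
  rewrite (le_trans (ler_wpM2l C0 hC)) // mulrA ler_pdivrMr ?ltr_wpDl //.
  by rewrite mulrC ler_wpM2l ?ltW // ltrDl.
have df : derivable f x 1 by apply/cvg_ex; exists a; exact: lim.
by apply: DeriveDef => //; exact: (cvg_lim (@Rhausdorff R) lim).
Unshelve. all: by end_near. Qed.

(* Gronwall for [f' = - t v f + O(e)], whose unperturbed solution is a multiple of
   [exp (- v t^2 / 2)]. *)
Lemma gaussian_ode (f g : R -> R) (v e : R) : 0 <= v ->
  (forall t, is_derive t 1 f (- g t)) ->
  (forall t, 0 <= t <= 1 -> `|g t - t * v * f t| <= e) ->
  `|f 1 - f 0 * expR (- (v / 2))| <= e.
Proof.
move=> v0 df H; pose G t := f t * expR (v / 2 * t ^+ 2).
pose G' t := - (g t - t * v * f t) * expR (v / 2 * t ^+ 2).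
have dG t : is_derive t 1 G (G' t).
  have := df t => ?; apply: is_derive_eq; rewrite /G' /GRing.scale /=; by field.
have cG : {within `[0, 1], continuous G}.
  apply: continuous_subspaceT => x; apply: differentiable_continuous.
  by apply/derivable1_diffP; apply: ex_derive.
have [s] := MVT ltr01 (fun z _ => dG z) cG.
rewrite in_itv /= => /andP[s0 s1]; rewrite subr0 mulr1.
rewrite /G expr1n mulr1 expr0n /= mulr0 expR0 mulr1 => E.
have -> : f 1 - f 0 * expR (- (v / 2)) = (f 1 * expR (v / 2) - f 0) * expR (- (v / 2)).
  by rewrite mulrBl -mulrA -expRD subrr expR0 mulr1.
have en x : `|expR x| = expR x by rewrite gtr0_norm ?expR_gt0.
rewrite E /G' !normrM !en normrN -mulrA -expRD.
have He : 0 <= e by apply: le_trans (normr_ge0 _) (H 0 _); rewrite lexx ler01.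
rewrite -[leRHS]mulr1 ler_pM ?expR_ge0 //; first by apply: H; rewrite !ltW.
rewrite -[leRHS]expR0 ler_expR subr_le0 -[leRHS]mulr1 ler_wpM2l ?divr_ge0 //.
by rewrite expr_le1 // ltW.
Qed.

End RealTools.


(** * Stein's method *)

Lemma measurable_affine (d : measure_display) (T : measurableType d) (R : realType)
    (X : T -> R) (t c : R) : measurable_fun setT X ->
  measurable_fun setT (fun w => t * X w + c).
Proof.
move=> mX; apply: measurable_funD; last exact: measurable_cst.
by apply: measurable_funM => //; exact: measurable_cst.
Qed.

Section Stein.
Context (d : measure_display) (T : measurableType d) (R : realType).
Variable P : probability T R.
Context (I : finType) (Y : I -> T -> R[i]).
Hypothesis bY : forall i, cbounded (Y i).
Hypothesis normY : forall i w, Y i w * (Y i w)^*%C = 1.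

Definition mono (b c : I -> nat) (w : T) : R[i] :=
  \prod_i (Y i w ^+ b i * (Y i w)^*%C ^+ c i).

Hypothesis orthY : forall (k : R[i]) (b c : I -> nat) p, b p != c p ->
  Ex P (fun w => complex.Re (k * mono b c w)) = 0.

Let madd (b c : I -> nat) i := (b i + c i)%N.

Let mono_mul b c b' c' w :
  mono b c w * mono b' c' w = mono (madd b b') (madd c c') w.
Proof. by rewrite /mono -big_split; apply: eq_bigr => i _; rewrite !exprD mulrACA. Qed.

Let mono_conj b c w : (mono b c w)^*%C = mono c b w.
Proof.
rewrite /mono rmorph_prod; apply: eq_bigr => i _.
by rewrite /= rmorphM !rmorphXn /= conjcK mulrC.
Qed.

Let cbounded_mono b c : cbounded (mono b c).
Proof.
apply: cbounded_prod => i; apply: cboundedM; apply: cboundedX => //.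
exact: cbounded_conj.
Qed.

Lemma Ex_mono k (b c : I -> nat) : Ex P (fun w => complex.Re (k * mono b c w)) =
  complex.Re k * ([forall i, b i == c i] : nat)%:R.
Proof.
case: forallP => [bc|/forallP]; last first.
  by rewrite negb_forall => /existsP[p bcp]; rewrite (orthY _ bcp) mulr0.
rewrite mulr1 -[RHS](Ex_cst P); congr Ex; apply/funext => w /=.
rewrite /mono big1 ?mulr1 // => i _.
by rewrite (eqP (bc i)) -exprMn normY expr1n.
Qed.

Context (J : finType) (a : J -> I -> nat).
Variables (A S : {set J}) (sel : J -> I) (wt : I -> nat) (N : nat) (xi : R[i]).
Hypothesis a_inj : forall j k, j \in A -> k \in A -> [forall i, a j i == a k i] = (j == k).
Hypothesis N0 : (0 < N)%N.
Hypothesis wtA : forall j, j \in A -> (\sum_i wt i * a j i = N)%N.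
Hypothesis SA : S \subset A.
Hypothesis A0 : (0 < #|A|)%N.
Hypothesis selP : forall j, j \in S -> (0 < a j (sel j))%N.

Let nil : I -> nat := fun=> 0%N.

Definition uval j w : R := complex.Re (xi * mono (a j) nil w).

(** The common second moment of the [uval j] for [j] in [A]. *)
Let v : R := (complex.Re xi ^+ 2 + complex.Im xi ^+ 2) / 2.

Let v0 : 0 <= v.
Proof. by rewrite divr_ge0 // addr_ge0 // sqr_ge0. Qed.

Let bu j : bounded_measurable (uval j).
Proof. by have [] := cboundedZ xi (cbounded_mono (a j) nil). Qed.

Let conjM (x y : R[i]) : (x * y)^*%C = x^*%C * y^*%C.
Proof. exact: rmorphM. Qed.

Let conjK (x : R[i]) : (x^*%C)^*%C = x.
Proof. by case: x => x y; rewrite /= opprK. Qed.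

Let xixi : xi * xi^*%C = ((2 * v)%:C)%C.
Proof.
apply/eqP; rewrite eq_complex complex_ReM complex_ImM complex_Re_conj complex_Im_conj /=.
by rewrite /v; apply/andP; split; apply/eqP; [field|ring].
Qed.

Let uv2 (j k : R[i]) : 2 * (complex.Re j * complex.Re k) = complex.Re (j * k) + complex.Re (j * k^*%C).
Proof. by rewrite !complex_ReM complex_Re_conj complex_Im_conj; lra. Qed.

Let eqA j k : j \in A -> k \in A -> [forall i, madd (a j) (a k) i == nil i] = false.
Proof.
move=> jA _; apply/negbTE/negP => /forallP h.
have : (\sum_i wt i * a j i = 0)%N.
  apply: big1 => i _; have := h i; rewrite /madd /nil addn_eq0 => /andP[/eqP -> _].
  by rewrite muln0.
by rewrite wtA //; apply/eqP; rewrite -lt0n.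
Qed.

Lemma Ex_uval2 j k : j \in A -> k \in A ->
  Ex P (fun w => uval j w * uval k w) = v * ((j == k) : nat)%:R.
Proof.
move=> jA kA; have -> : (fun w => uval j w * uval k w) =
   (fun w => 2^-1 * (complex.Re (xi * xi * mono (madd (a j) (a k)) (madd nil nil) w) +
      complex.Re (xi * xi^*%C * mono (madd (a j) nil) (madd nil (a k)) w))).
  apply/funext => w; rewrite /uval.
  have <- := mono_mul (a j) nil nil (a k) w; have <- := mono_mul (a j) nil (a k) nil w.
  rewrite -(mono_conj (a k) nil) [xi * xi * _]mulrACA [xi * xi^*%C * _]mulrACA -rmorphM -uv2 mulKf //.
have b k' b' c' : bounded_measurable (fun w => complex.Re (k' * mono b' c' w)).
  by have [] := cboundedZ k' (cbounded_mono b' c').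
rewrite ExZ; last exact: bounded_measurableD.
rewrite ExD // !Ex_mono.
have -> : [forall i, madd (a j) (a k) i == madd nil nil i] = false by exact: eqA.
rewrite mulr0 add0r xixi /=.
have -> : [forall i, madd (a j) nil i == madd nil (a k) i] = (j == k).
  by rewrite -a_inj //; apply: eq_forallb => i; rewrite /madd /nil addn0.
by field.
Qed.

Let bal j k l m := [forall i, madd (a j) (a k) i == madd (a l) (a m) i].

(** Each [uval] is half the sum of a monomial and its conjugate. All monomials have the same weight
    [N > 0], so a product of four has nonzero mean only if two factors are conjugated and two are
    not; the three ways of choosing the partner of [j] give the three terms. *)
Lemma Ex_uval4 j k l m : j \in A -> k \in A -> l \in A -> m \in A ->
  Ex P (fun w => uval j w * uval k w * (uval l w * uval m w)) =
  v ^+ 2 / 2 * ((bal j k l m : nat)%:R + (bal j l k m : nat)%:R + (bal j m k l : nat)%:R).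
Proof.
move=> jA kA lA mA.
pose z j w := xi * mono (a j) nil w.
have -> : (fun w => uval j w * uval k w * (uval l w * uval m w)) =
  (fun w => 8^-1 * (
     (complex.Re (z j w * z k w * (z l w * z m w)) +
      complex.Re (z j w * z k w * (z l w * z m w)^*%C)) +
     (complex.Re (z j w * z k w * (z l w * (z m w)^*%C)) +
      complex.Re (z j w * z k w * ((z l w)^*%C * z m w))) +
     ((complex.Re (z j w * (z k w)^*%C * (z l w * z m w)) +
      complex.Re (z j w * (z k w)^*%C * (z l w * z m w)^*%C)) +
     (complex.Re (z j w * (z k w)^*%C * (z l w * (z m w)^*%C)) +
      complex.Re (z j w * (z k w)^*%C * ((z l w)^*%C * z m w)))))).
  apply/funext => w; rewrite /uval -!/(z _ w).
  have e1 : (z l w)^*%C * z m w = (z l w * (z m w)^*%C)^*%C by rewrite conjM conjK.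
  rewrite !e1 -!(uv2 (_ * _) (_ * _)).
  transitivity (8^-1 * (2 * (complex.Re (z j w * z k w) + complex.Re (z j w * (z k w)^*%C)) *
    (complex.Re (z l w * z m w) + complex.Re (z l w * (z m w)^*%C)))); last by field.
  by rewrite -!uv2; field.
have zc n w : (z n w)^*%C = xi^*%C * mono nil (a n) w by rewrite /z conjM mono_conj.
have E k1 k2 k3 k4 b1 c1 b2 c2 b3 c3 b4 c4 :
   bounded_measurable (fun w => complex.Re (k1 * mono b1 c1 w * (k2 * mono b2 c2 w) *
      (k3 * mono b3 c3 w * (k4 * mono b4 c4 w)))) /\
   Ex P (fun w => complex.Re (k1 * mono b1 c1 w * (k2 * mono b2 c2 w) *
      (k3 * mono b3 c3 w * (k4 * mono b4 c4 w)))) =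
   complex.Re (k1 * k2 * (k3 * k4)) * ([forall i, madd (madd b1 b2) (madd b3 b4) i ==
      madd (madd c1 c2) (madd c3 c4) i] : nat)%:R.
  rewrite -Ex_mono; have -> : (fun w => complex.Re (k1 * mono b1 c1 w * (k2 * mono b2 c2 w) *
      (k3 * mono b3 c3 w * (k4 * mono b4 c4 w)))) =
    (fun w => complex.Re (k1 * k2 * (k3 * k4) *
       mono (madd (madd b1 b2) (madd b3 b4)) (madd (madd c1 c2) (madd c3 c4)) w)).
    by apply/funext => w; rewrite -!mono_mul; congr complex.Re; ring.
  by split=> //; have [] := cboundedZ (k1 * k2 * (k3 * k4))
     (cbounded_mono (madd (madd b1 b2) (madd b3 b4)) (madd (madd c1 c2) (madd c3 c4))).
(* A balanced pair of exponents has equal total weights; comparing weights kills the other sign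
   patterns. *)
pose W (b : I -> nat) := (\sum_i wt i * b i)%N.
have WD b c : W (madd b c) = (W b + W c)%N.
  by rewrite /W -big_split; apply: eq_bigr => i _; rewrite /madd mulnDr.
have W0 : W nil = 0%N by rewrite /W big1 // => i _; rewrite /nil muln0.
have WA n : n \in A -> W (a n) = N by exact: wtA.
have WE b c : W b <> W c -> [forall i, b i == c i] = false.
  move=> Wbc; apply/negbTE/negP => /forallP bc; apply: Wbc.
  by apply: eq_bigr => i _; rewrite (eqP (bc i)).
have e1 n p q r w : (z n w * z p w * (z q w * z r w)^*%C) =
  z n w * z p w * ((z q w)^*%C * (z r w)^*%C) by rewrite conjM.
have e2 n p q r w : (z n w * (z p w)^*%C * (z q w * z r w)^*%C) =
  z n w * (z p w)^*%C * ((z q w)^*%C * (z r w)^*%C) by rewrite conjM.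
under eq_fun do rewrite e1 e2 !zc /z.
have xi4 : complex.Re (xi * xi^*%C * (xi * xi^*%C)) = 4 * v ^+ 2.
  by rewrite xixi /=; ring.
rewrite ExZ; last by repeat (apply: bounded_measurableD); apply: (E _ _ _ _ _ _ _ _ _ _ _ _).1.
rewrite !ExD; try (repeat (apply: bounded_measurableD); apply: (E _ _ _ _ _ _ _ _ _ _ _ _).1).
rewrite !(E _ _ _ _ _ _ _ _ _ _ _ _).2.
have F b c : W b <> W c -> ([forall i, b i == c i] : nat)%:R = 0 :> R.
  by move=> /WE ->.
rewrite (F (madd (madd (a j) (a k)) (madd (a l) (a m)))); last by rewrite !WD !WA // W0; move: N0; clear; lia.
rewrite (F (madd (madd (a j) (a k)) (madd (a l) nil))); last by rewrite !WD !WA // W0; move: N0; clear; lia.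
rewrite (F (madd (madd (a j) (a k)) (madd nil (a m)))); last by rewrite !WD !WA // W0; move: N0; clear; lia.
rewrite (F (madd (madd (a j) nil) (madd (a l) (a m)))); last by rewrite !WD !WA // W0; move: N0; clear; lia.
rewrite (F (madd (madd (a j) nil) (madd nil nil))); last by rewrite !WD !WA // W0; move: N0; clear; lia.
have B (b c b' c' : I -> nat) : b =1 b' -> c =1 c' ->
   ([forall i, b i == c i] : nat)%:R = ([forall i, b' i == c' i] : nat)%:R :> R.
  by move=> bb cc; congr ((nat_of_bool _)%:R); apply: eq_forallb => i; rewrite bb cc.
rewrite (B (madd (madd (a j) (a k)) (madd nil nil)) (madd (madd nil nil) (madd (a l) (a m))) (madd (a j) (a k)) (madd (a l) (a m))); [|by move=> i; rewrite /madd /nil; lia..].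
rewrite (B (madd (madd (a j) nil) (madd (a l) nil)) (madd (madd nil (a k)) (madd nil (a m))) (madd (a j) (a l)) (madd (a k) (a m))); [|by move=> i; rewrite /madd /nil; lia..].
rewrite (B (madd (madd (a j) nil) (madd nil (a m))) (madd (madd nil (a k)) (madd (a l) nil)) (madd (a j) (a m)) (madd (a k) (a l))); [|by move=> i; rewrite /madd /nil; lia..].
have -> : xi * xi * (xi^*%C * xi^*%C) = xi * xi^*%C * (xi * xi^*%C) by ring.
have -> : xi * xi^*%C * (xi^*%C * xi) = xi * xi^*%C * (xi * xi^*%C) by ring.
by rewrite !mulr0 !xi4 /bal; field.
Qed.

(* Functions of the variables other than [p]: those orthogonal to every monomial of
   nonzero degree in [Y p].  The class is closed under products with [uval j], hence,
   by Bernstein approximation, contains [sin] of linear forms. *)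
Let orth p (Phi : T -> R) := bounded_measurable Phi /\
  forall (k : R[i]) (b c : I -> nat), b p != c p ->
    Ex P (fun w => complex.Re (k * mono b c w) * Phi w) = 0.

Let bmono k b c : bounded_measurable (fun w => complex.Re (k * mono b c w)).
Proof. by have [] := cboundedZ k (cbounded_mono b c). Qed.

Let orth_cst p x : orth p (cst x).
Proof.
split; first exact: bounded_measurable_cst.
move=> k b c bc; under eq_fun do rewrite mulrC.
by rewrite ExZ // (orthY _ bc) mulr0.
Qed.

Let orthD p f g : orth p f -> orth p g -> orth p (fun w => f w + g w).
Proof.
move=> [bf of_] [bg og]; split; first exact: bounded_measurableD.
move=> k b c bc; under eq_fun do rewrite mulrDr.
by rewrite ExD ?of_ ?og ?addr0 //; exact: bounded_measurableM.
Qed.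

Let orthZ p x f : orth p f -> orth p (fun w => x * f w).
Proof.
move=> [bf of_]; split; first exact: bounded_measurableZ.
move=> k b c bc; under eq_fun do rewrite mulrCA.
by rewrite ExZ ?of_ ?mulr0 //; exact: bounded_measurableM.
Qed.

Let orth_sum p (r : seq J) (Q : pred J) (f : J -> T -> R) :
  (forall j, j \in r -> Q j -> orth p (f j)) -> orth p (fun w => \sum_(j <- r | Q j) f j w).
Proof.
elim: r => [|j r IH] H.
  by under eq_fun do rewrite big_nil; exact: orth_cst.
under eq_fun do rewrite big_cons.
have {}IH := IH (fun i ir => H i (@mem_behead _ (j :: r) i ir)).
case Qj: (Q j) => //; apply: orthD => //; apply: H => //; exact: mem_head.
Qed.

Let orth_uval p j f : a j p = 0%N -> orth p f -> orth p (fun w => uval j w * f w).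
Proof.
move=> ajp [bf of_]; split; first exact: bounded_measurableM.
move=> k b c bc.
have -> : (fun w => complex.Re (k * mono b c w) * (uval j w * f w)) =
   (fun w => 2^-1 * (complex.Re (k * xi * mono (madd b (a j)) (madd c nil) w) * f w +
      complex.Re (k * xi^*%C * mono (madd b nil) (madd c (a j)) w) * f w)).
  apply/funext => w; rewrite /uval -!mono_mul -(mono_conj (a j) nil).
  have -> : k * xi * (mono b c w * mono (a j) nil w) =
    k * mono b c w * (xi * mono (a j) nil w) by ring.
  have -> : k * xi^*%C * (mono b c w * (mono (a j) nil w)^*%C) =
    k * mono b c w * (xi * mono (a j) nil w)^*%C by rewrite conjM; ring.
  by rewrite -mulrDl -uv2; field.
rewrite ExZ; last by apply: bounded_measurableD; exact: bounded_measurableM.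
rewrite ExD; [|exact: bounded_measurableM..].
by rewrite !of_ ?addr0 ?mulr0 // /madd /nil ajp !addn0.
Qed.

Let orth_bern p (f : T -> R) n (g : nat -> R) :
  (forall h, orth p h -> orth p (fun w => f w * h w)) ->
  orth p (fun w => bern n g (f w)).
Proof.
move=> H; elim: n g => [|n IH] g /=; first exact: orth_cst.
apply: orthD; first by apply: H; exact: IH.
have -> : (fun w => (1 - f w) * bern n g (f w)) =
    (fun w => bern n g (f w) + (-1) * (f w * bern n g (f w))).
  by apply/funext => w; ring.
by apply: orthD => //; apply: orthZ; apply: H.
Qed.

Lemma Ex_uval_sin_eq0 (p : I) (j : J) (al t c : R) : (0 < a j p)%N ->
  Ex P (fun w => uval j w *
    sin (t * (al * \sum_(k in S | a k p == 0%N) uval k w) + c)) = 0.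
Proof.
move=> ajp; pose U w := al * \sum_(k in S | a k p == 0%N) uval k w.
change (Ex P (fun w => uval j w * sin (t * U w + c)) = 0).
have bU : bounded_measurable U.
  by apply: bounded_measurableZ; apply: bounded_measurable_sum.
have mUs : bounded_measurable (fun w => sin (t * U w + c)).
  by apply: bounded_measurable_sin; apply: measurable_affine; case: bU.
have [M M0 UM] : exists2 M, 0 < M & forall w, `|U w| <= M.
  have [_ [M UM]] := bU; exists (`|M| + 1) => [|w]; first by rewrite ltr_wpDl.
  by rewrite (le_trans (UM w)) // (le_trans (ler_norm _)) // lerDl.
have [B B0 uB] : exists2 B, 0 < B & forall w, `|uval j w| <= B.
  have [_ [M' UM']] := bu j; exists (`|M'| + 1) => [|w]; first by rewrite ltr_wpDl.
  by rewrite (le_trans (UM' w)) // (le_trans (ler_norm _)) // lerDl.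
(* The linear form [U] is rescaled to [[0, 1]], where Bernstein polynomials live. *)
pose f w := (U w + M) / (2 * M).
have f01 w : 0 <= f w <= 1.
  have := UM w; rewrite ler_norml => /andP[h1 h2].
  by rewrite /f divr_ge0 ?ler_pdivrMr ?mulr_ge0 ?mulr_gt0 //=; lra.
have orthf h : orth p h -> orth p (fun w => f w * h w).
  move=> oh; have -> : (fun w => f w * h w) =
    (fun w => (2 * M)^-1 * (al * (\sum_(k in S | a k p == 0%N) uval k w * h w)) + 2^-1 * h w).
    apply/funext => w; rewrite -mulr_suml /f /U; field.
    by rewrite gt_eqF.
  apply: orthD; last exact: orthZ.
  apply: orthZ; apply: orthZ; apply: orth_sum => k _ /andP[_ /eqP akp].
  exact: orth_uval.
pose L := `|t| * (2 * M).
have L0 : 0 <= L by rewrite mulr_ge0 ?mulr_ge0 // ltW.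
pose g n k : R := sin (t * (2 * M * (k%:R / n%:R) - M) + c).
have approx e n : 0 < e -> (0 < n)%N -> forall w,
    `|bern n (g n) (f w) - sin (t * U w + c)| <= L * e + (L / e) / n%:R.
  move=> e0 n0 w; apply: bern_approx => //; first by rewrite divr_ge0 // ltW.
  move=> k kn; apply: le_trans (sin_lip _ _) _.
  have -> : t * (2 * M * (k%:R / n%:R) - M) + c - (t * U w + c) =
     t * (2 * M) * (k%:R / n%:R - f w).
    by rewrite /f; field; rewrite gt_eqF //= pnatr_eq0 -lt0n n0.
  rewrite normrM normrM [`|2 * M|]gtr0_norm ?mulr_gt0 // -/L.
  set y := _ - _; rewrite (_ : L * e + L / e * y ^+ 2 = L * (e + e^-1 * y ^+ 2)); last by ring.
  (* [|y| <= e + y^2 / e] turns the Lipschitz bound into the quadratic form expected by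
     [bern_approx]. *)
  rewrite ler_wpM2l //; have h : `|y| * e <= e ^+ 2 + y ^+ 2.
    by rewrite -(real_normK (num_real y)); have := sqr_ge0 (`|y| - e); have := sqr_ge0 (`|y| + e); nra.
  have -> : e + e^-1 * y ^+ 2 = (e ^+ 2 + y ^+ 2) / e by field; rewrite gt_eqF.
  by rewrite ler_pdivlMr.
apply/eqP; rewrite -normr_le0; apply/ler_addgt0Pr => eps eps0; rewrite add0r.
(* With this choice the final error [B * (L * e + e)] equals [eps / 2]. *)
pose e := eps / (2 * B * (L + 1)).
have e0 : 0 < e by rewrite divr_gt0 // !mulr_gt0 // ltr_wpDl.
have [n n0 hn] : exists2 n, (0 < n)%N & (L / e) / n%:R <= e.
  have Le0 : 0 < L / e + 1 by rewrite ltr_wpDl // divr_ge0 // ltW.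
  have x0 : 0 < e / (L / e + 1) by rewrite divr_gt0.
  have [n hn] := ltr_add_invr x0; exists n.+1 => //.
  move: hn; rewrite add0r ltr_pdivlMr // => /ltW hn.
  by apply: le_trans hn; rewrite mulrC ler_wpM2l ?invr_ge0 // lerDl.
have [bbern obern] := orth_bern n (g n) orthf.
have E0 : Ex P (fun w => uval j w * bern n (g n) (f w)) = 0.
  rewrite -[RHS](obern xi (a j) nil) //; by rewrite /nil -lt0n.
rewrite -[X in `|X|]subr0 -E0.
apply: (le_trans (@le_norm_Ex_sub _ _ _ P _ _ (cst (B * (L * e + e))) _ _ _ _)).
- exact: bounded_measurableM.
- exact: bounded_measurableM.
- exact: bounded_measurable_cst.
- move=> w /=; rewrite -mulrBr normrM ler_pM // distrC.
  by apply: le_trans (approx e n e0 n0 w) _; rewrite lerD2l.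
rewrite Ex_cst /e.
have -> : B * (L * (eps / (2 * B * (L + 1))) + eps / (2 * B * (L + 1))) = eps / 2.
  have L1 : L + 1 != 0 by rewrite gt_eqF // ltr_wpDl.
  have B1 : B != 0 by rewrite gt_eqF.
  by field; rewrite L1 B1.
by rewrite ler_pdivrMr // ler_peMr ?(ltW eps0) // ler1n.
Qed.

Definition sel_pairs : {set J * J} :=
  [set x | [&& x.1 \in S, x.2 \in S & (0 < a x.2 (sel x.1))%N]].

Definition offdiag_quads : {set (J * J) * (J * J)} :=
  [set z | [&& [&& z.1.1 \in S, z.1.2 \in S, z.2.1 \in S & z.2.2 \in S],
     z.1.1 != z.2.1, z.1.1 != z.2.2 &
     [forall i, (a z.1.1 i + a z.1.2 i == a z.2.1 i + a z.2.2 i)%N]]].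

(** Up to the factor [v / #|A|], the sum over the selected irreducibles [p] of the second moment of
    the part of the sum deleted for [p]. *)
Definition sel_weight := (\sum_(p in sel @: S) #|[set g in S | (0 < a g p)%N]|)%N.

Let nd (j k l m : J) : bool := ((j, k), (l, m)) \in offdiag_quads.

Let balC j k l m : bal j k l m = bal j k m l.
Proof. by apply: eq_forallb => i; rewrite /madd [(a m i + _)%N]addnC. Qed.

Let balK j k m : k \in S -> m \in S -> bal j k j m -> k = m.
Proof.
move=> kS mS /forallP h; apply/eqP; rewrite -a_inj ?(fintype.subsetP SA) //; apply/forallP => i.
by have := h i; rewrite /madd eqn_add2l.
Qed.

Let bal_cases j k l m : j \in S -> k \in S -> l \in S -> m \in S ->
  (bal j k l m <= ((j == l) && (k == m)) + ((j == m) && (k == l)) + nd j k l m)%N.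
Proof.
move=> jS kS lS mS; case B : (bal j k l m) => //.
have [jl|jl] := eqVneq j l; first by subst l; rewrite (balK _ _ B) ?eqxx //.
have [jm|jm] := eqVneq j m; first by subst m; rewrite balC in B; rewrite (balK _ _ B) ?eqxx //.
rewrite /= /nd inE /= jS kS lS mS jl jm /=.
by have -> : [forall i, (a j i + a k i == a l i + a m i)%N] by exact: B.
Qed.

(** Each of the three pairings in a fourth moment is either diagonal or an element of
    [offdiag_quads]. The diagonal ones force [y = x], or [y] the reversal of [x], at most
    [#|sel_pairs|] times each, or else both [x] and [y] are diagonal; the number of the latter
    depends on [c] and is bounded by [D]. *)
Let pairs_count (c : rel (J * J)) (D : nat) :
  (\sum_(x in sel_pairs) \sum_(y in sel_pairs | c x y)
     ((x.1 == x.2) && (y.1 == y.2)) <= D)%N ->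
  (\sum_(x in sel_pairs) \sum_(y in sel_pairs | c x y)
    (bal x.1 x.2 y.1 y.2 + bal x.1 y.1 x.2 y.2 + bal x.1 y.2 x.2 y.1)
   <= 2 * D + 4 * #|sel_pairs| + 3 * #|offdiag_quads|)%N.
Proof.
move=> HD.
pose E (phi : (J * J) -> (J * J) -> (J * J) * (J * J)) :=
  (\sum_(x in sel_pairs) \sum_(y in sel_pairs | c x y) (phi x y \in offdiag_quads))%N.
(* Each pairing regroups [(x, y)] by an involution, so every quadruple is counted at most once. *)
have EE phi (psi : (J * J) * (J * J) -> (J * J) * (J * J)) :
    (forall z, psi z = phi z.1 z.2) -> involutive psi -> (E phi <= #|offdiag_quads|)%N.
  move=> pp ip; rewrite -sum1_card [leqRHS]big_mkcond /=.
  rewrite (reindex_inj (inv_inj ip)) /=.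
  rewrite /E big_mkcond /=.
  rewrite (eq_bigr (fun z => (phi z.1 z.2 \in offdiag_quads : nat))); last first.
    by move=> z _; rewrite pp; case: ifP.
  rewrite -(pair_bigA _ (fun x y => (phi x y \in offdiag_quads : nat))) /=.
  apply: leq_sum => x _; case: ifP => _ //.
  rewrite big_mkcond /=; apply: leq_sum => y _; by case: ifP.
have P1 (g : J * J -> J * J) :
    (\sum_(x in sel_pairs) \sum_(y in sel_pairs | c x y) (y == g x) <= #|sel_pairs|)%N.
  rewrite -sum1_card; apply: leq_sum => x _.
  rewrite big_mkcond (bigD1 (g x)) //= big1 ?addn0 => [|y /negbTE ->]; last by case: ifP.
  by case: ifP => // _; case: eqP.
apply: (@leq_trans (\sum_(x in sel_pairs) \sum_(y in sel_pairs | c x y)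
   (((y == x) + (y == (x.2, x.1)) + (((x.1, x.2), (y.1, y.2)) \in offdiag_quads)) +
    (((x.1 == x.2) && (y.1 == y.2)) + (y == (x.2, x.1)) + (((x.1, y.1), (x.2, y.2)) \in offdiag_quads)) +
    (((x.1 == x.2) && (y.1 == y.2)) + (y == x) + (((x.1, y.2), (y.1, x.2)) \in offdiag_quads))))%N).
  apply: leq_sum => x; rewrite inE => /and3P[x1 x2 _].
  apply: leq_sum => y /andP[]; rewrite inE => /and3P[y1 y2 _] _.
  case: x x1 x2 => x1 x2 /= h1 h2; case: y y1 y2 => y1 y2 /= h3 h4.
  rewrite !xpair_eqE; apply: leq_add; first apply: leq_add.
  - apply: leq_trans (bal_cases h1 h2 h3 h4) _.
    by rewrite [y1 == x1]eq_sym [y2 == x2]eq_sym [y1 == x2]eq_sym [y2 == x1]eq_sym [(x2 == y1) && _]andbC.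
  - apply: leq_trans (bal_cases h1 h3 h2 h4) _.
    by rewrite [y2 == x1]eq_sym [(y1 == x2) && _]andbC.
  - rewrite balC; apply: leq_trans (bal_cases h1 h4 h3 h2) _.
    by rewrite [y1 == x1]eq_sym [y1 == y2]eq_sym leq_add2r addnC.
have := EE (fun x y => ((x.1, x.2), (y.1, y.2))) id; have := EE (fun x y => ((x.1, y.1), (x.2, y.2))) (fun z => ((z.1.1, z.2.1), (z.1.2, z.2.2))).
have := EE (fun x y => ((x.1, y.2), (y.1, x.2))) (fun z => ((z.1.1, z.2.2), (z.2.1, z.1.2))).
have i1 : forall z : (J * J) * (J * J), id z = (z.1.1, z.1.2, (z.2.1, z.2.2)) by move=> [[? ?] [? ?]].
have i2 : involutive (fun z : (J * J) * (J * J) => ((z.1.1, z.2.1), (z.1.2, z.2.2))) by move=> [[? ?] [? ?]].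
have i3 : involutive (fun z : (J * J) * (J * J) => ((z.1.1, z.2.2), (z.2.1, z.1.2))) by move=> [[? ?] [? ?]].
move=> /(_ (fun=> erefl) i3) e3 /(_ (fun=> erefl) i2) e2 /(_ i1 (fun=> erefl)) e1.
have p1 := P1 id; have p2 := P1 (fun x => (x.2, x.1)).
under eq_bigr do rewrite !big_split /=.
rewrite !big_split /=; rewrite /E in e1 e2 e3.
set np := #|sel_pairs|; set nq := #|offdiag_quads|.
have -> : (2 * D + 4 * np + 3 * nq = np + np + nq + (D + np + nq) + (D + np + nq))%N by lia.
by do ![apply: leq_add].
Qed.

Let sum_diag (j : J) : (\sum_k (j == k) = 1)%N.
Proof.
rewrite (bigD1 j) //= eqxx big1 ?addn0 // => k kj.
by rewrite eq_sym (negbTE kj).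
Qed.

Let diag_count1 : (\sum_(x in sel_pairs) \sum_(y in sel_pairs | true)
  ((x.1 == x.2) && (y.1 == y.2)) <= #|S| ^ 2)%N.
Proof.
have H : (\sum_(x in sel_pairs) (x.1 == x.2) <= #|S|)%N.
  apply: (@leq_trans (\sum_(x : J * J) (x.1 \in S) * (x.1 == x.2))%N).
    rewrite big_mkcond; apply: leq_sum => x _; rewrite inE.
    by case: (x.1 \in S) => //=; rewrite mul1n; case: ifP.
  rewrite -(pair_bigA _ (fun j k => ((j \in S) * (j == k))%N)) /= -sum1_card [leqRHS]big_mkcond.
  by apply: leq_sum => j _; rewrite -big_distrr /= sum_diag muln1; case: (j \in S).
rewrite (eq_bigr (fun x => (x.1 == x.2) * \sum_(y in sel_pairs) (y.1 == y.2))%N); last first.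
  move=> x _; rewrite big_distrr /=; apply: eq_big => y; first by rewrite andbT.
  by rewrite mulnb.
by rewrite -big_distrl /= -mulnn leq_mul.
Qed.

(** Two diagonal pairs amount to their entries [x.1] and [y.1]. When these have the same selected
    irreducible, it divides both, so [(x.1, y.1)] is itself in [sel_pairs]. *)
Let diag_count2 : (\sum_(x in sel_pairs) \sum_(y in sel_pairs | sel y.1 == sel x.1)
  ((x.1 == x.2) && (y.1 == y.2)) <= #|sel_pairs|)%N.
Proof.
apply: (@leq_trans (\sum_(x : J * J) \sum_(y : J * J)
   (((x.1, y.1) \in sel_pairs) * (x.1 == x.2) * (y.1 == y.2)))%N).
  rewrite big_mkcond; apply: leq_sum => x _; case: ifP => // xp.
  rewrite big_mkcond; apply: leq_sum => y _; case: ifP => // /andP[yp /eqP sxy].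
  case: eqP => //= xx; case: eqP => //= yy; rewrite !muln1.
  move: xp yp; rewrite !inE /= => /and3P[-> _ _] /and3P[yS _ ap].
  by rewrite -yy sxy in ap; rewrite yS ap.
rewrite -(pair_bigA _ (fun x1 x2 => \sum_(y : J * J)
   (((x1, y.1) \in sel_pairs) * (x1 == x2) * (y.1 == y.2)))%N) /=.
rewrite -sum1_card [leqRHS]big_mkcond /=.
rewrite [leqRHS](eq_bigr (fun x => if (x.1, x.2) \in sel_pairs then 1 else 0)%N); last by case.
rewrite -(pair_bigA _ (fun x1 y1 => if (x1, y1) \in sel_pairs then 1 else 0)%N) /=.
apply: leq_sum => x1 _; rewrite exchange_big /=.
rewrite -(pair_bigA _ (fun y1 y2 => \sum_x2
   (((x1, y1) \in sel_pairs) * (x1 == x2) * (y1 == y2)))%N) /=.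
apply: leq_sum => y1 _.
under eq_bigr do rewrite -big_distrl /= -big_distrr /= sum_diag muln1.
by rewrite -big_distrr /= sum_diag muln1; case: (_ \in _).
Qed.

Variable al : R.
Hypothesis al2 : al ^+ 2 * #|A|%:R = 1.

(** [y p] gathers the terms whose selected irreducible is [p], and [rho p] all terms of [S]
    divisible by [p]; [Qp p] is their product. The sum [Q] of these products is the random variance
    of Stein's method, which has to be close to [v]. *)
Let Q w := \sum_(x in sel_pairs) al ^+ 2 * (uval x.1 w * uval x.2 w).
Let Qp p w := \sum_(x in sel_pairs | sel x.1 == p) al ^+ 2 * (uval x.1 w * uval x.2 w).
Let y p w := \sum_(j in S | sel j == p) al * uval j w.
Let rho p w := al * \sum_(g in S | (0 < a g p)%N) uval g w.
Let Ys w := al * \sum_(j in S) uval j w.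

Let theta : R := #|S|%:R / #|A|%:R.
Let pe : R := (#|sel_pairs| + #|offdiag_quads|)%:R / #|A|%:R ^+ 2.
Let W : R := sel_weight%:R / #|A|%:R.

Let nA0 : #|A|%:R != 0 :> R.
Proof. by rewrite pnatr_eq0 -lt0n. Qed.

Let al2E : al ^+ 2 = #|A|%:R^-1.
Proof. by apply: (mulIf nA0); rewrite al2 mulVf. Qed.

Let inSA (j : J) : j \in S -> j \in A.
Proof. by move=> jS; apply: (fintype.subsetP SA). Qed.

Let bQp p : bounded_measurable (Qp p).
Proof.
by apply: bounded_measurable_sum => x; apply: bounded_measurableZ; exact: bounded_measurableM.
Qed.
Let bQ : bounded_measurable Q.
Proof.
by apply: bounded_measurable_sum => x; apply: bounded_measurableZ; exact: bounded_measurableM.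
Qed.
Let by_ p : bounded_measurable (y p).
Proof. by apply: bounded_measurable_sum => x; exact: bounded_measurableZ. Qed.
Let brho p : bounded_measurable (rho p).
Proof. by apply: bounded_measurableZ; exact: bounded_measurable_sum. Qed.
Let bYs : bounded_measurable Ys.
Proof. by apply: bounded_measurableZ; exact: bounded_measurable_sum. Qed.

Let y_rho p w : y p w * rho p w = Qp p w.
Proof.
rewrite /y /rho /Qp mulrA mulr_suml mulr_suml.
under eq_bigr do rewrite mulr_sumr.
rewrite pair_big_dep /=; apply: eq_big => x; last by move=> _; ring.
rewrite inE; case: (x.1 \in S) => //=.
by case: eqP => [<-|_]; rewrite ?andbT ?andbF.
Qed.

Let sum_sel (f : I -> T -> R) w : \sum_(j in S) al * uval j w * f (sel j) w =
  \sum_(p in sel @: S) y p w * f p w.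
Proof.
rewrite (partition_big sel (mem (sel @: S))) /=; last by move=> j jS; exact: imset_f.
apply: eq_bigr => p _; rewrite /y mulr_suml; apply: eq_bigr => j /andP[_ /eqP <-].
by [].
Qed.

Let sum_y_rho w : \sum_(j in S) al * uval j w * rho (sel j) w = Q w.
Proof.
rewrite sum_sel; under eq_bigr do rewrite y_rho.
rewrite /Q (partition_big (fun x => sel x.1) (mem (sel @: S))) //=.
by move=> x; rewrite inE => /and3P[xS _ _]; exact: imset_f.
Qed.

Let Ex_uval4_pairs (c : rel (J * J)) :
  Ex P (fun w => \sum_(x in sel_pairs) \sum_(z in sel_pairs | c x z)
     (al ^+ 2 * (uval x.1 w * uval x.2 w)) * (al ^+ 2 * (uval z.1 w * uval z.2 w))) =
  v ^+ 2 / 2 / #|A|%:R ^+ 2 * (\sum_(x in sel_pairs) \sum_(z in sel_pairs | c x z)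
    (bal x.1 x.2 z.1 z.2 + bal x.1 z.1 x.2 z.2 + bal x.1 z.2 x.2 z.1))%:R.
Proof.
have b4 x z : bounded_measurable (fun w =>
   (al ^+ 2 * (uval x.1 w * uval x.2 w)) * (al ^+ 2 * (uval z.1 w * uval z.2 w))).
  by apply: bounded_measurableM; apply: bounded_measurableZ; exact: bounded_measurableM.
rewrite Ex_sum; last by move=> x; apply: bounded_measurable_sum => z.
rewrite natr_sum mulr_sumr; apply: eq_bigr => x xp; rewrite Ex_sum //.
rewrite natr_sum mulr_sumr; apply: eq_bigr => z /andP[zp _].
move: xp zp; rewrite !inE => /and3P[x1 x2 _] /and3P[z1 z2 _].
have -> : (fun w => (al ^+ 2 * (uval x.1 w * uval x.2 w)) * (al ^+ 2 * (uval z.1 w * uval z.2 w))) =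
  (fun w => (#|A|%:R ^+ 2)^-1 * (uval x.1 w * uval x.2 w * (uval z.1 w * uval z.2 w))).
  by apply/funext => w; rewrite al2E mulrACA -expr2 exprVn.
rewrite ExZ; last by do 2! [apply: bounded_measurableM => //]; exact: bounded_measurableM.
rewrite Ex_uval4 ?inSA // !natrD; ring.
Qed.

Let Ex_Q : Ex P Q = theta * v.
Proof.
rewrite Ex_sum => [|x]; last by apply: bounded_measurableZ; exact: bounded_measurableM.
rewrite (eq_bigr (fun x => v / #|A|%:R * ((x.1 == x.2) : nat)%:R)); last first.
  move=> x; rewrite inE => /and3P[x1 x2 _].
  rewrite ExZ ?Ex_uval2 ?inSA //; last exact: bounded_measurableM.
  by rewrite al2E; ring.
rewrite -mulr_sumr -natr_sum.
suff -> : (\sum_(x in sel_pairs) (x.1 == x.2) = #|S|)%N by rewrite /theta; ring.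
rewrite big_mkcond /= (eq_bigr (fun x => (x.1 \in S) * (x.1 == x.2))%N); last first.
  move=> [x1 x2] _; rewrite inE /=; case: eqP => [<-|_]; last by rewrite muln0; case: ifP.
  by rewrite muln1; case xS: (x1 \in S) => //=; rewrite selP.
rewrite -(pair_bigA _ (fun j k => ((j \in S) * (j == k))%N)) /= -sum1_card [RHS]big_mkcond.
by apply: eq_bigr => j _; rewrite -big_distrr /= sum_diag muln1; case: (j \in S).
Qed.

Let theta_le1 : theta <= 1.
Proof. by rewrite /theta ler_pdivrMr ?ltr0n // mul1r ler_nat subset_leq_card. Qed.

(** The doubly diagonal terms contribute at most [(theta v)^2], the square of the mean of [Q]. What
    remains is the bias [(1 - theta) v] and the counts in [pe]. *)
Let variance_Q : Ex P (fun w => (Q w - v) ^+ 2) <= v ^+ 2 * ((1 - theta) ^+ 2 + 2 * pe).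
Proof.
have bQQ : bounded_measurable (fun w => Q w * Q w) by exact: bounded_measurableM.
have -> : (fun w => (Q w - v) ^+ 2) = (fun w => Q w * Q w + (- 2 * v * Q w + cst (v ^+ 2) w)).
  by apply/funext => w /=; ring.
have bvQ : bounded_measurable (fun w => - 2 * v * Q w) by exact: bounded_measurableZ.
rewrite ExD //; last by apply: bounded_measurableD => //; exact: bounded_measurable_cst.
rewrite ExD //; last exact: bounded_measurable_cst.
rewrite Ex_cst ExZ // Ex_Q.
have -> : (fun w => Q w * Q w) = (fun w => \sum_(x in sel_pairs) \sum_(z in sel_pairs | true)
   (al ^+ 2 * (uval x.1 w * uval x.2 w)) * (al ^+ 2 * (uval z.1 w * uval z.2 w))).
  apply/funext => w; rewrite /Q mulr_suml; apply: eq_bigr => x _; rewrite mulr_sumr.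
  by apply: eq_bigl => z; rewrite andbT.
rewrite (Ex_uval4_pairs (fun _ _ => true)).
have := pairs_count diag_count1; rewrite -(ler_nat R) => H.
have k0 : 0 <= v ^+ 2 / 2 / #|A|%:R ^+ 2 by rewrite !divr_ge0 ?sqr_ge0 ?exprn_ge0.
apply: (@le_trans _ _ (v ^+ 2 / 2 / #|A|%:R ^+ 2 * (2 * #|S| ^ 2 + 4 * #|sel_pairs| + 3 * #|offdiag_quads|)%N%:R
  + (- 2 * v * (theta * v) + v ^+ 2))); first by rewrite lerD2r ler_wpM2l.
rewrite (_ : (2 * #|S| ^ 2 + _ + _)%N%:R = 2 * #|S|%:R ^+ 2 + 4 * #|sel_pairs|%:R +
  3 * #|offdiag_quads|%:R :> R); last by rewrite -mulnn !natrD !natrM; ring.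
rewrite /theta /pe natrD.
set s := #|S|%:R; set n := #|A|%:R; set p := #|sel_pairs|%:R; set e := #|offdiag_quads|%:R.
have e0 : 0 <= e / n ^+ 2 by rewrite divr_ge0 // exprn_ge0.
have -> : v ^+ 2 / 2 / n ^+ 2 * (2 * s ^+ 2 + 4 * p + 3 * e) + (- 2 * v * (s / n * v) + v ^+ 2) =
  v ^+ 2 * ((1 - s / n) ^+ 2 + 2 * (p / n ^+ 2) + 3 / 2 * (e / n ^+ 2)) by field.
rewrite ler_wpM2l ?sqr_ge0 // mulrDl; lra.
Qed.

(** Only pairs with the same selected irreducible meet, so the doubly diagonal terms number at most
    [#|sel_pairs|] rather than [#|S|^2], and no main term is left. *)
Let sum_Qp_sqr : Ex P (fun w => \sum_(p in sel @: S) Qp p w ^+ 2) <= 3 * v ^+ 2 * pe.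
Proof.
have -> : (fun w => \sum_(p in sel @: S) Qp p w ^+ 2) =
  (fun w => \sum_(x in sel_pairs) \sum_(z in sel_pairs | sel z.1 == sel x.1)
   (al ^+ 2 * (uval x.1 w * uval x.2 w)) * (al ^+ 2 * (uval z.1 w * uval z.2 w))).
  apply/funext => w.
  rewrite [RHS](partition_big (fun x => sel x.1) (mem (sel @: S))) /=; last first.
    by move=> x; rewrite inE => /and3P[xS _ _]; exact: imset_f.
  apply: eq_bigr => p _; rewrite expr2 {1}/Qp mulr_suml.
  by apply: eq_bigr => x /andP[_ /eqP ->]; rewrite /Qp mulr_sumr.
rewrite (Ex_uval4_pairs (fun x z => sel z.1 == sel x.1)).
have := pairs_count diag_count2; rewrite -(ler_nat R) => H.
have k0 : 0 <= v ^+ 2 / 2 / #|A|%:R ^+ 2 by rewrite !divr_ge0 ?sqr_ge0 ?exprn_ge0.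
apply: (le_trans (ler_wpM2l k0 H)).
rewrite (_ : (2 * #|sel_pairs| + _ + _)%N%:R = 6 * #|sel_pairs|%:R +
  3 * #|offdiag_quads|%:R :> R); last by rewrite !natrD; ring.
rewrite /pe natrD.
set n := #|A|%:R; set p := #|sel_pairs|%:R; set e := #|offdiag_quads|%:R.
have e0 : 0 <= e / n ^+ 2 by rewrite divr_ge0 // exprn_ge0.
have -> : v ^+ 2 / 2 / n ^+ 2 * (6 * p + 3 * e) =
  3 * v ^+ 2 * (p / n ^+ 2 + e / n ^+ 2 / 2) by field.
rewrite [(p + e) / _]mulrDl; apply: ler_wpM2l; first by rewrite mulr_ge0 ?sqr_ge0.
lra.
Qed.

Lemma Ex_sum_uval_sqr (B : {set J}) : B \subset A ->
  Ex P (fun w => (al * \sum_(g in B) uval g w) ^+ 2) = v * #|B|%:R / #|A|%:R.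
Proof.
move=> BA; have b2 x z : bounded_measurable (fun w => uval x w * uval z w).
  exact: bounded_measurableM.
have -> : (fun w => (al * \sum_(g in B) uval g w) ^+ 2) =
   (fun w => al ^+ 2 * \sum_(g in B) \sum_(k in B) uval g w * uval k w).
  apply/funext => w; rewrite exprMn [(\sum_(g in B) _) ^+ 2]expr2 mulr_suml.
  by congr (_ * _); apply: eq_bigr => g _; rewrite mulr_sumr.
rewrite ExZ; last by apply: bounded_measurable_sum => g; exact: bounded_measurable_sum.
rewrite Ex_sum; last by move=> g; exact: bounded_measurable_sum.
rewrite (eq_bigr (fun=> v)) => [|g gB].
  by rewrite sumr_const al2E -mulr_natr; ring.
rewrite Ex_sum // (bigD1 g) //= big1 => [|k /andP[kB kg]].
  by rewrite Ex_uval2 ?(fintype.subsetP BA) // eqxx mulr1 addr0.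
by rewrite Ex_uval2 ?(fintype.subsetP BA) // eq_sym (negbTE kg) mulr0.
Qed.

Let sum_rho_sqr : Ex P (fun w => \sum_(p in sel @: S) rho p w ^+ 2) = v * W.
Proof.
rewrite Ex_sum; last by move=> p; exact: bounded_measurableX.
rewrite /W /sel_weight natr_sum mulrA mulr_sumr mulr_suml; apply: eq_bigr => p _.
rewrite -Ex_sum_uval_sqr; last first.
  by apply: fintype.subset_trans SA; apply/fintype.subsetP => g; rewrite inE => /andP[].
congr Ex; apply/funext => w; rewrite /rho; congr ((_ * _) ^+ 2).
by apply: eq_bigl => g; rewrite inE.
Qed.

Let Ex_stein_eq0 t c : Ex P (fun w => \sum_(j in S)
  al * uval j w * sin (t * (Ys w - rho (sel j) w) + c)) = 0.
Proof.
have bs j : bounded_measurable (fun w => sin (t * (Ys w - rho (sel j) w) + c)).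
  apply: bounded_measurable_sin; apply: measurable_affine.
  by case: (bounded_measurableB bYs (brho (sel j))).
rewrite Ex_sum; last by move=> j; apply: bounded_measurableM => //; exact: bounded_measurableZ.
apply: big1 => j jS; under eq_fun do rewrite -mulrA.
rewrite ExZ; last exact: bounded_measurableM.
rewrite -[RHS](mulr0 al); congr (_ * _).
rewrite -[RHS](@Ex_uval_sin_eq0 (sel j) j al t c (selP jS)).
congr Ex; apply/funext => w; congr (_ * sin (t * _ + c)).
rewrite /Ys /rho -mulrBr; congr (_ * _).
rewrite (bigID (fun g => a g (sel j) == 0%N)) /= addrC.
by under eq_bigl do rewrite -lt0n; rewrite addrAC subrr add0r.
Qed.

(** The Taylor remainder at [p] is at most [2 |y rho| |rho|], and the arithmetic-geometric mean
    inequality with parameter [lam] splits it into [lam Qp^2 + rho^2 / lam], whose expectations are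
    known. Balancing the two by [lam] is what produces the product [pe * W]. *)
Let stein_error lam t c : 0 < lam -> 0 <= t <= 1 ->
  `|Ex P (fun w => Ys w * sin (t * Ys w + c)) - t * Ex P (fun w => Q w * cos (t * Ys w + c))|
  <= lam * (3 * v ^+ 2 * pe) + v * W / lam.
Proof.
move=> lam0 /andP[t0 t1].
have bsin : bounded_measurable (fun w => sin (t * Ys w + c)).
  by apply: bounded_measurable_sin; apply: measurable_affine; case: bYs.
have bcos : bounded_measurable (fun w => cos (t * Ys w + c)).
  by apply: bounded_measurable_cos; apply: measurable_affine; case: bYs.
have bs j : bounded_measurable (fun w => sin (t * (Ys w - rho (sel j) w) + c)).
  apply: bounded_measurable_sin; apply: measurable_affine.
  by case: (bounded_measurableB bYs (brho (sel j))).
have bQ2 : bounded_measurable (fun w => \sum_(p in sel @: S) Qp p w ^+ 2).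
  by apply: bounded_measurable_sum => p; exact: bounded_measurableX.
have brho2 : bounded_measurable (fun w => \sum_(p in sel @: S) rho p w ^+ 2).
  by apply: bounded_measurable_sum => p; exact: bounded_measurableX.
have bsum : bounded_measurable (fun w => \sum_(j in S)
    al * uval j w * sin (t * (Ys w - rho (sel j) w) + c)).
  by apply: bounded_measurable_sum => j; apply: bounded_measurableM => //; exact: bounded_measurableZ.
rewrite -[X in X - _]subr0 -(Ex_stein_eq0 t c) -ExZ; last exact: bounded_measurableM.
rewrite -ExB //; last exact: bounded_measurableM.
pose Z w := lam * \sum_(p in sel @: S) Qp p w ^+ 2 + lam^-1 * \sum_(p in sel @: S) rho p w ^+ 2.
have EZ : Ex P Z <= lam * (3 * v ^+ 2 * pe) + v * W / lam.
  rewrite ExD ?ExZ //; [|exact: bounded_measurableZ..].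
  by rewrite sum_rho_sqr [lam^-1 * _]mulrC lerD2r ler_wpM2l // ltW.
apply: le_trans EZ; apply: le_norm_Ex_sub.
- by apply: bounded_measurableB => //; exact: bounded_measurableM.
- by apply: bounded_measurableZ; exact: bounded_measurableM.
- by apply: bounded_measurableD; exact: bounded_measurableZ.
move=> w; set X := t * Ys w + c.
have -> : Ys w * sin X - \sum_(j in S) al * uval j w * sin (t * (Ys w - rho (sel j) w) + c)
     - t * (Q w * cos X) =
   \sum_(p in sel @: S) y p w * (sin X - sin (X - t * rho p w) - t * rho p w * cos X).
  rewrite -(sum_sel (fun p w => sin X - sin (X - t * rho p w) - t * rho p w * cos X)).
  have e1 : Ys w * sin X = \sum_(j in S) al * uval j w * sin X.
    by rewrite {1}/Ys mulr_sumr mulr_suml.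
  have e2 : t * (Q w * cos X) = \sum_(j in S) t * (al * uval j w * rho (sel j) w * cos X).
    by rewrite -sum_y_rho mulr_suml mulr_sumr.
  rewrite e1 e2 -!sumrB.
  apply: eq_bigr => j jS; have -> : X - t * rho (sel j) w = t * (Ys w - rho (sel j) w) + c.
    by rewrite /X; ring.
  by ring.
rewrite /Z !mulr_sumr -big_split /=.
apply: le_trans (ler_norm_sum _ _ _) _; apply: ler_sum => p _.
rewrite normrM (@le_trans _ _ (`|y p w| * (2 * (t * rho p w) ^+ 2))) //.
  by rewrite ler_wpM2l // sin_taylor2.
rewrite -y_rho; set Y0 := y p w; set r := rho p w.
have tr : (t * r) ^+ 2 <= r ^+ 2.
  by rewrite exprMn ler_piMl ?sqr_ge0 // exprn_ile1.
apply: (@le_trans _ _ (2 * (`|Y0 * r| * `|r|))).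
  rewrite normrM -mulrA -[`|r| * `|r|]expr2 real_normK ?num_real //.
  by have := normr_ge0 Y0; nra.
rewrite -[(Y0 * r) ^+ 2]real_normK ?num_real // -[r ^+ 2]real_normK ?num_real //.
set A1 := `|Y0 * r|; set B1 := `|r|.
have -> : lam * A1 ^+ 2 + lam^-1 * B1 ^+ 2 = (lam * A1 - B1) ^+ 2 / lam + 2 * (A1 * B1).
  by field; rewrite gt_eqF.
by rewrite lerDr divr_ge0 ?sqr_ge0 // ltW.
Qed.

Let pe0 : 0 <= pe. Proof. by rewrite divr_ge0 // exprn_ge0. Qed.
Let W0 : 0 <= W. Proof. by rewrite divr_ge0. Qed.

(** Three errors of order [delta] add up: the remainder of Stein's expansion, the mean of [|Q - v|],
    and the passage from [S] to [A], which are at [L^2] distance [sqrt (v (1 - theta))].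
    [gaussian_ode] integrates the first two. *)
Lemma char_bound delta c : 0 < delta <= 1 ->
  1 - theta <= delta ^+ 2 -> pe <= delta ^+ 2 -> pe * W <= delta ^+ 2 ->
  `|Ex P (fun w => cos (al * \sum_(j in A) uval j w + c)) - cos c * expR (- (v / 2))| <=
  (9 * v ^+ 2 + 2 * v + 2) * delta.
Proof.
move=> /andP[d0 d1] hth hpe hW.
have bcos t : bounded_measurable (fun w => cos (t * Ys w + c)).
  by apply: bounded_measurable_cos; apply: measurable_affine; case: bYs.
have bsin t : bounded_measurable (fun w => sin (t * Ys w + c)).
  by apply: bounded_measurable_sin; apply: measurable_affine; case: bYs.
pose f t := Ex P (fun w => cos (t * Ys w + c)).
pose g t := Ex P (fun w => Ys w * sin (t * Ys w + c)).
have f0 : f 0 = cos c.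
  by rewrite -[RHS](Ex_cst P); congr Ex; apply/funext => w; rewrite mul0r add0r.
have df (t : R) : is_derive t 1 f (- g t).
  apply: (@is_derive_quadratic R _ _ _ (2 * Ex P (fun w => Ys w ^+ 2))) => h.
  have b1 : bounded_measurable (fun w => Ys w * sin (t * Ys w + c)) by exact: bounded_measurableM.
  have b2 : bounded_measurable (fun w => cos (t * Ys w + c) - h * (Ys w * sin (t * Ys w + c))).
    by apply: bounded_measurableB => //; exact: bounded_measurableZ.
  have -> : f (t + h) - f t - h * - g t =
      f (t + h) - Ex P (fun w => cos (t * Ys w + c) - h * (Ys w * sin (t * Ys w + c))).
    by rewrite ExB ?ExZ //; [rewrite /f /g; ring|exact: bounded_measurableZ].
  rewrite [leRHS]mulrAC -mulrA mulrA -ExZ; last exact: bounded_measurableX.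
  apply: le_norm_Ex_sub => //.
    by apply: bounded_measurableZ; exact: bounded_measurableX.
  move=> w; have := cos_taylor2 (t * Ys w + c) (h * Ys w).
  have -> : t * Ys w + c + h * Ys w = (t + h) * Ys w + c by ring.
  by rewrite exprMn mulrA; congr (`|_| <= _); ring.
(* The first absolute moment comes from the variance through [x <= x^2 / (2 delta) + delta / 2]. *)
have V : Ex P (fun w => `|Q w - v|) <= (v ^+ 2 * 3 + 1) / 2 * delta.
  have bQv : bounded_measurable (fun w => Q w - v).
    by apply: bounded_measurableB => //; exact: bounded_measurable_cst.
  apply: (@le_trans _ _ (Ex P (fun w => (2 * delta)^-1 * (Q w - v) ^+ 2 + cst (delta / 2) w))).
    apply: le_Ex; first exact: bounded_measurable_norm.
      apply: bounded_measurableD; last exact: bounded_measurable_cst.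
      by apply: bounded_measurableZ; exact: bounded_measurableX.
    move=> w /=; rewrite -[(Q w - v) ^+ 2]real_normK ?num_real //; set x := `|Q w - v|.
    have -> : (2 * delta)^-1 * x ^+ 2 + delta / 2 = (x - delta) ^+ 2 / (2 * delta) + x.
      by field; rewrite gt_eqF.
    by rewrite lerDr divr_ge0 ?sqr_ge0 // mulr_ge0 // ltW.
  rewrite ExD; last exact: bounded_measurable_cst; last first.
    by apply: bounded_measurableZ; exact: bounded_measurableX.
  rewrite Ex_cst ExZ; last exact: bounded_measurableX.
  have th0 : 0 <= 1 - theta by rewrite subr_ge0.
  have h1 : (1 - theta) ^+ 2 + 2 * pe <= 3 * delta ^+ 2.
    have : (1 - theta) ^+ 2 <= delta ^+ 2 * delta ^+ 2 by rewrite expr2 ler_pM.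
    by have := sqr_ge0 delta; have : delta ^+ 2 <= 1 by [rewrite expr_le1 // ltW]; nra.
  have h2 : Ex P (fun w => (Q w - v) ^+ 2) <= v ^+ 2 * (3 * delta ^+ 2).
    by apply: le_trans variance_Q _; rewrite ler_wpM2l ?sqr_ge0.
  have : (2 * delta)^-1 * Ex P (fun w => (Q w - v) ^+ 2) <= (2 * delta)^-1 * (v ^+ 2 * (3 * delta ^+ 2)).
    by rewrite ler_wpM2l // invr_ge0 mulr_ge0 // ltW.
  have -> : (2 * delta)^-1 * (v ^+ 2 * (3 * delta ^+ 2)) = v ^+ 2 * 3 / 2 * delta by field; rewrite gt_eqF.
  by rewrite mulrDl mulrDl; lra.
have main : `|f 1 - f 0 * expR (- (v / 2))| <= (8 * v ^+ 2 + v + 1) * delta.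
  apply: (gaussian_ode v0 df) => t t01; have /andP[t0 t1] := t01.
  (* This makes [lam * pe = (pe W + pe) / delta <= 2 delta] and [W / lam <= delta]; the [1] covers
     the case [W = 0]. *)
  pose lam := (W + 1) / delta.
  have W1 : 0 < W + 1 by rewrite ltr_wpDl.
  have lam0 : 0 < lam by rewrite divr_gt0.
  have e1 := stein_error c lam0 t01.
  have e2 : lam * (3 * v ^+ 2 * pe) <= 6 * v ^+ 2 * delta.
    have -> : lam * (3 * v ^+ 2 * pe) = 3 * v ^+ 2 * ((pe * W + pe) / delta) by rewrite /lam; ring.
    have -> : 6 * v ^+ 2 * delta = 3 * v ^+ 2 * (2 * delta) by ring.
    apply: ler_wpM2l; first by rewrite mulr_ge0 ?sqr_ge0.
    by rewrite ler_pdivrMr //; move: hpe hW; rewrite !expr2; lra.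
  have e3 : v * W / lam <= v * delta.
    have -> : v * W / lam = v * delta * (W / (W + 1)) by rewrite /lam; field; rewrite !gt_eqF.
    apply: ler_piMr; first by rewrite mulr_ge0 ?(ltW d0).
    by rewrite ler_pdivrMr // mul1r lerDl.
  have bQc : bounded_measurable (fun w => Q w * cos (t * Ys w + c)) by exact: bounded_measurableM.
  have e4 : `|t * Ex P (fun w => Q w * cos (t * Ys w + c)) - t * v * f t| <=
      (v ^+ 2 * 3 + 1) / 2 * delta.
    rewrite -mulrA -mulrBr normrM ger0_norm // -[leRHS]mul1r ler_pM //.
    rewrite -ExZ //; apply: le_trans V; apply: le_norm_Ex_sub => //.
    - exact: bounded_measurableZ.
    - apply: bounded_measurable_norm; apply: bounded_measurableB => //.
      exact: bounded_measurable_cst.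
    by move=> w; rewrite -mulrBl normrM ler_piMr // ler_norml cos_geN1 cos_le1.
  apply: (@le_trans _ _ ((lam * (3 * v ^+ 2 * pe) + v * W / lam) + (v ^+ 2 * 3 + 1) / 2 * delta)).
    apply: le_trans (lerD e1 e4); rewrite /g.
    by apply: le_trans (ler_normD _ _); rewrite addrA subrK.
  have : 0 <= v ^+ 2 * delta by rewrite mulr_ge0 ?sqr_ge0 // ltW.
  have : 0 <= v * delta by rewrite mulr_ge0 // ltW.
  by move: e2 e3; rewrite !mulrDl; lra.
pose YA w := al * \sum_(j in A) uval j w.
have bYA : bounded_measurable YA.
  by apply: bounded_measurableZ; exact: bounded_measurable_sum.
have bcA : bounded_measurable (fun w => cos (YA w + c)).
  apply: bounded_measurable_cos; have := measurable_affine 1 c bYA.1.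
  by under eq_fun do rewrite mul1r.
have dAS : `|Ex P (fun w => cos (YA w + c)) - f 1| <= (v + 1) / 2 * delta.
  (* The discarded terms are orthogonal, so the second moment of [D] is [v (1 - theta)]. *)
  pose D w := al * \sum_(j in A :\: S) uval j w.
  have bD : bounded_measurable D by apply: bounded_measurableZ; exact: bounded_measurable_sum.
  have YD w : YA w = Ys w + D w.
    rewrite /YA /Ys /D -mulrDr; congr (_ * _); rewrite (big_setID S) /=.
    by rewrite (finset.setIidPr SA).
  apply: (@le_trans _ _ (Ex P (fun w => (2 * delta)^-1 * D w ^+ 2 + cst (delta / 2) w))).
    apply: le_norm_Ex_sub => //.
      apply: bounded_measurableD; last exact: bounded_measurable_cst.
      by apply: bounded_measurableZ; exact: bounded_measurableX.
    move=> w /=; rewrite mul1r; apply: (@le_trans _ _ `|D w|).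
      have := sin_lip (YA w + c + pi / 2) (Ys w + c + pi / 2); rewrite !sinDpihalf YD.
      by move/le_trans; apply; rewrite le_eqVlt; apply/orP; left; apply/eqP; congr (`|_|); ring.
    rewrite -[D w ^+ 2]real_normK ?num_real //; set x := `|D w|.
    have -> : (2 * delta)^-1 * x ^+ 2 + delta / 2 = (x - delta) ^+ 2 / (2 * delta) + x.
      by field; rewrite gt_eqF.
    by rewrite lerDr divr_ge0 ?sqr_ge0 // mulr_ge0 // ltW.
  rewrite ExD; last exact: bounded_measurable_cst; last first.
    by apply: bounded_measurableZ; exact: bounded_measurableX.
  rewrite Ex_cst ExZ; last exact: bounded_measurableX.
  rewrite Ex_sum_uval_sqr; last exact: finset.subsetDl.
  have -> : v * #|A :\: S|%:R / #|A|%:R = v * (1 - theta).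
    rewrite cardsD (finset.setIidPr SA) natrB ?subset_leq_card // /theta; field.
    exact: nA0.
  have : (2 * delta)^-1 * (v * (1 - theta)) <= (2 * delta)^-1 * (v * delta ^+ 2).
    by rewrite ler_wpM2l ?invr_ge0 ?mulr_ge0 ?(ltW d0) // ler_wpM2l.
  have -> : (2 * delta)^-1 * (v * delta ^+ 2) = v / 2 * delta by field; rewrite gt_eqF.
  by rewrite !mulrDl; lra.
rewrite -f0.
have -> : Ex P (fun w => cos (al * \sum_(j in A) uval j w + c)) - f 0 * expR (- (v / 2)) =
  (Ex P (fun w => cos (YA w + c)) - f 1) + (f 1 - f 0 * expR (- (v / 2))) by rewrite addrA subrK.
apply: le_trans (ler_normD _ _) _; apply: le_trans (lerD dAS main) _.
have : 0 <= v ^+ 2 * delta by rewrite mulr_ge0 ?sqr_ge0 // ltW.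
have : 0 <= v * delta by rewrite mulr_ge0 // ltW.
by rewrite !mulrDl; lra.
Qed.

End Stein.


(** * Weak convergence to the complex normal law *)

Section GaussianCharacteristic.
Variables (R : realType) (s : R).
Hypothesis s0 : s != 0.

Notation mu := (@lebesgue_measure R).
Let p := normal_pdf 0 s.

Let p_ge0 x : 0 <= p x. Proof. exact: normal_pdf_ge0. Qed.

Let mp : measurable_fun setT p. Proof. exact: measurable_normal_pdf. Qed.

Lemma integral_normal_prob (h : R -> R) :
  @bounded_measurable _ (measurableTypeR R) R h ->
  (\int[normal_prob 0 s]_x (h x)%:E = \int[mu]_x (h x * p x)%:E)%E.
Proof.
move=> bh; have dom := @normal_prob_dominates R 0 s.
have ih : (normal_prob 0 s).-integrable setT (EFin \o h).
  exact: (@bounded_measurable_integrable _ _ _ (normal_prob 0 s)).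
rewrite -(Radon_Nikodym_change_of_variables dom) //=.
under [RHS]eq_integral do rewrite EFinM.
have mh : measurable_fun setT (EFin \o h) by case: bh => ? _; exact/measurable_EFinP.
apply: ae_eq_integral => //.
- exact: emeasurable_funM.
- by apply: emeasurable_funM => //=; exact/measurable_EFinP.
- apply: ae_eqe_mul2l => /=.
  rewrite Radon_NikodymE //=; case: cid => /= k [h1 h2 h3].
  apply: integral_ae_eq => //=; first by exact/measurable_EFinP.
  by move=> E _ mE; rewrite -h3.
Qed.

(** The ratio of the two densities is a multiple of [exp (- 3 x^2 / (8 s^2))], which absorbs [x^2].
    This gives both the integrability of functions of quadratic growth and the decay of boundary
    terms. *)
Let sqr_mul_pdf : exists2 K, 0 <= K & forall x, x ^+ 2 * p x <= K * normal_pdf 0 (2 * s) x.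
Proof.
have s20 : 2 * s != 0 by rewrite mulf_neq0 // pnatr_eq0.
pose K := 8 * s ^+ 2 / 3 * (normal_peak s / normal_peak (2 * s)).
have pk : 0 < normal_peak (2 * s) by exact: normal_peak_gt0.
have ss : 0 < s ^+ 2 by rewrite exprn_even_gt0.
exists K.
  apply: mulr_ge0; last by apply: divr_ge0; exact: normal_peak_ge0.
  by apply: divr_ge0 => //; apply: mulr_ge0 => //; exact: sqr_ge0.
move=> x; rewrite /p !normal_pdfE // /normal_fun !subr0.
have eK (a b e : R) : b != 0 -> 8 * s ^+ 2 / 3 * (a / b) * (b * e) = a * (8 * s ^+ 2 / 3 * e).
  by move=> b0; field.
rewrite eK ?gt_eqF // mulrCA; apply: ler_wpM2l; first exact: normal_peak_ge0.
have -> : - x ^+ 2 / (s ^+ 2 *+ 2) = - x ^+ 2 / ((2 * s) ^+ 2 *+ 2) - 3 * x ^+ 2 / (8 * s ^+ 2).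
  have e2 (y t : R) : t != 0 -> - y / (t * 2) = - y / (2 ^+ 2 * t * 2) - 3 * y / (8 * t).
    by move=> t0; field.
  rewrite -[s ^+ 2 *+ 2]mulr_natr -[(2 * s) ^+ 2 *+ 2]mulr_natr exprMn.
  by apply: e2; rewrite expf_neq0.
rewrite expRD mulrCA mulrC; apply: ler_wpM2r; first exact: expR_ge0.
rewrite expRN ler_pdivrMr ?expR_gt0 //.
apply: (@le_trans _ _ (8 * s ^+ 2 / 3 * (1 + 3 * x ^+ 2 / (8 * s ^+ 2)))); last first.
  apply: ler_wpM2l; last exact: expR_ge1Dx.
  by apply: divr_ge0 => //; apply: mulr_ge0 => //; exact: sqr_ge0.
have -> : 8 * s ^+ 2 / 3 * (1 + 3 * x ^+ 2 / (8 * s ^+ 2)) = 8 * s ^+ 2 / 3 + x ^+ 2 by field.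
by rewrite lerDr; apply: divr_ge0 => //; apply: mulr_ge0 => //; exact: sqr_ge0.
Qed.

Let ip (h : R -> R) := mu.-integrable setT (EFin \o (fun x => h x * p x)).

Let ip_le (h : R -> R) A B : measurable_fun setT h -> 0 <= A -> 0 <= B ->
  (forall x, `|h x| <= A + B * x ^+ 2) -> ip h.
Proof.
move=> mh A0 B0 hAB; have [K K0 HK] := sqr_mul_pdf.
have i1 := @integrable_normal_pdf R 0 s; have i2 := @integrable_normal_pdf R 0 (2 * s).
apply: (@le_integrable _ _ _ mu setT measurableT _
   (fun x => A%:E * (normal_pdf 0 s x)%:E + (B * K)%:E * (normal_pdf 0 (2 * s) x)%:E)%E).
- by apply/measurable_EFinP; exact: measurable_funM.
- move=> x _ /=; rewrite lee_fin.
  rewrite normrM (ger0_norm (p_ge0 x)); apply: le_trans (ler_norm _).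
  apply: (le_trans (ler_wpM2r (p_ge0 x) (hAB x))).
  by rewrite mulrDl -!(mulrA B) /p lerD2l; apply: ler_wpM2l => //; exact: HK.
- by apply: integrableD => //; exact: integrableZl.
Qed.

Let L h : R := Rintegral mu setT (fun x => h x * p x).

Let LD f g : ip f -> ip g -> L (fun x => f x + g x) = L f + L g.
Proof.
by move=> i1 i2; rewrite /L -RintegralD //; congr fine; apply: eq_integral => x _; rewrite mulrDl.
Qed.

Let LZ k f : ip f -> L (fun x => k * f x) = k * L f.
Proof.
by move=> i1; rewrite /L -RintegralZl //; congr fine; apply: eq_integral => x _; rewrite mulrA.
Qed.

Let measurable_trig (t c : R) : measurable_fun setT (fun x : R => sin (t * x + c)) /\
  measurable_fun setT (fun x : R => cos (t * x + c)).
Proof.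
have m1 : measurable_fun setT (fun x : R => t * x + c).
  by apply: (@measurable_affine _ (measurableTypeR R)).
have [ms _] := bounded_measurable_sin m1; have [mc _] := bounded_measurable_cos m1.
by [].
Qed.

Let ip_sin t c : ip (fun x => sin (t * x + c)).
Proof.
apply: (@ip_le _ 1 0) => //; first by have [] := measurable_trig t c.
by move=> x; rewrite mul0r addr0 ler_norml sin_geN1 sin_le1.
Qed.

Let ip_cos t c : ip (fun x => cos (t * x + c)).
Proof.
apply: (@ip_le _ 1 0) => //; first by have [] := measurable_trig t c.
by move=> x; rewrite mul0r addr0 ler_norml cos_geN1 cos_le1.
Qed.

Let norm_xsin (t c x : R) : `|x * sin (t * x + c)| <= 1 + x ^+ 2.
Proof.
rewrite normrM; have h : `|sin (t * x + c)| <= 1 by rewrite ler_norml sin_geN1 sin_le1.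
rewrite (le_trans (ler_piMr (normr_ge0 x) h)) // -(real_normK (num_real x)).
by have := sqr_ge0 (`|x| - 1); have := normr_ge0 x; nra.
Qed.

Let norm_Zxsin (k t c x : R) : `|- k * (x * sin (t * x + c))| <= `|k| + `|k| * x ^+ 2.
Proof.
have -> : `|k| + `|k| * x ^+ 2 = `|k| * (1 + x ^+ 2) by ring.
by rewrite normrM normrN; apply: ler_wpM2l.
Qed.

Let ip_xsin t c : ip (fun x => x * sin (t * x + c)).
Proof.
apply: (@ip_le _ 1 1) => //.
  by apply: measurable_funM => //; have [] := measurable_trig t c.
by move=> x; rewrite mul1r.
Qed.

Let ip_sqr : ip (fun x => x ^+ 2).
Proof.
apply: (@ip_le _ 0 1) => //.
by move=> x; rewrite add0r mul1r ger0_norm // sqr_ge0.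
Qed.

(* Integration by parts, from [p' x = - x p x / s ^ 2]. *)
Let gaussian_stein t c :
  L (fun x => x * sin (t * x + c)) = s ^+ 2 * t * L (fun x => cos (t * x + c)).
Proof.
pose G x := sin (t * x + c) * p x.
pose G' x := (t * cos (t * x + c) + (- s ^- 2) * (x * sin (t * x + c))) * p x.
have iG' : ip (fun x => t * cos (t * x + c) + (- s ^- 2) * (x * sin (t * x + c))).
  apply: (@ip_le _ (`|t| + `|s ^- 2|) `|s ^- 2|) => //.
    by have [m1 m2] := measurable_trig t c; apply: measurable_funD; apply: measurable_funM => //;
      apply: measurable_funM.
  move=> x; rewrite (le_trans (ler_normD _ _)) // -addrA; apply: lerD => //.
  by rewrite normrM ler_piMr // ler_norml cos_geN1 cos_le1.
suff LG' : L (fun x => t * cos (t * x + c) + (- s ^- 2) * (x * sin (t * x + c))) = 0.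
  move: LG'; rewrite LD ?LZ //; last 2 first.
  - apply: (@ip_le _ `|t| 0) => //; first by apply: measurable_funM => //; have [] := measurable_trig t c.
    by move=> x; rewrite mul0r addr0 normrM ler_piMr // ler_norml cos_geN1 cos_le1.
  - apply: (@ip_le _ `|s ^- 2| `|s ^- 2|) => //.
      by apply: measurable_funM => //; apply: measurable_funM => //; have [] := measurable_trig t c.
  set a := L _; set b := L _ => E.
  transitivity (s ^+ 2 * t * a - s ^+ 2 * (t * a + - s ^- 2 * b)); last by rewrite E mulr0 subr0.
  by clearbody a b; field.
have pE x : p x = normal_peak s * expR (- x ^+ 2 / (s ^+ 2 *+ 2)).
  by rewrite /p normal_pdfE // /normal_fun subr0.
have dp (x : R) : is_derive x 1 p (- x / s ^+ 2 * p x).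
  have -> : p = (fun x => normal_peak s * expR (- x ^+ 2 / (s ^+ 2 *+ 2))) by exact/funext.
  apply: is_derive_eq; rewrite /GRing.scale /=; set e := expR _; set k := normal_peak s.
  by rewrite -[s ^+ 2 *+ 2]mulr_natr; clearbody e k; field.
have dG (x : R) : is_derive x 1 G (G' x).
  have := dp x => dpx; apply: is_derive_eq; rewrite /G' /GRing.scale /=.
  by move: (p x) (sin _) (cos _) => a b e; field.
have cp : continuous p by exact: continuous_normal_pdf.
have cG' : continuous G'.
  have cl : continuous (fun x : R => t * x + c).
    by move=> x; apply: cvgD; [apply: cvgM; [exact: cvg_cst|exact: cvg_id]|exact: cvg_cst].
  move=> x; apply: cvgM; last exact: cp.
  apply: cvgD; (apply: cvgM; first exact: cvg_cst).
    by apply: continuous_comp; [exact: cl|exact: continuous_cos].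
  by apply: cvgM; [exact: cvg_id|apply: continuous_comp; [exact: cl|exact: continuous_sin]].
(* [G'] is integrated over [[- (n + 1), n + 1]]; the boundary terms tend to [0], and dominated
   convergence gives the integral over the line. *)
pose u (n : nat) := G n.+1%:R - G (- n.+1%:R).
pose f_ (n : nat) (x : R) := ((G' x)%:E * (\1_(`[- n.+1%:R, n.+1%:R]) x)%:E)%E.
have intf n : (\int[mu]_x f_ n x = (u n)%:E)%E.
  have nn : - n.+1%:R < n.+1%:R :> R by rewrite (@lt_trans _ _ 0) // ?oppr_lt0 ltr0n.
  rewrite -(is_derive_FTC nn cG' dG) [RHS]integral_mkcond; apply: eq_integral => x _.
  by rewrite /f_ patchE indicE; case: ifP; rewrite ?mule1 ?mule0.
have [K K0 HK] := sqr_mul_pdf.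
have u0 : u @ \oo --> 0.
  pose C := K * normal_peak (2 * s).
  have C0 : 0 <= C by apply: mulr_ge0 => //; exact: normal_peak_ge0.
  have s20 : 2 * s != 0 by rewrite mulf_neq0 // pnatr_eq0.
  have GC (n : nat) x : x ^+ 2 = n.+1%:R ^+ 2 -> `|G x| <= C * harmonic n.
    move=> xn; rewrite /G normrM (ger0_norm (p_ge0 x)).
    apply: (@le_trans _ _ (p x)); first by rewrite ler_piMl // ler_norml sin_geN1 sin_le1.
    rewrite /harmonic /= ler_pdivlMr // mulrC; apply: (@le_trans _ _ (x ^+ 2 * p x)).
      by apply: ler_wpM2r => //; rewrite xn expr2 ler_peMl // ler1n.
    by apply: le_trans (HK x) _; apply: ler_wpM2l => //; exact: normal_pdf_ub.
  have uC n : `|u n| <= (C + C) * harmonic n.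
    by rewrite mulrDl (le_trans (ler_normB _ _)) //; apply: lerD; apply: GC; rewrite ?sqrrN.
  have hc k : (fun n => k * harmonic n) @ \oo --> (0 : R).
    by rewrite -(mulr0 k); apply: cvgM; [exact: cvg_cst|exact: cvg_harmonic].
  apply: (squeeze_cvgr _ (hc (- (C + C))) (hc (C + C))).
  by near=> n; rewrite mulNr -ler_norml; exact: uC.
have aefg : {ae mu, forall x n, [set: R] x -> (`|f_ n x| <= (abse \o (EFin \o G')) x)%E}.
  apply: aeW => x n _; rewrite /f_ abseM /= -[leRHS]mule1; apply: lee_wpmul2l => //.
  by rewrite indicE; case: (_ \in _); rewrite /= ?normr1 ?normr0 lee_fin.
have aef : {ae mu, forall x, [set: R] x -> f_ ^~ x @ \oo --> (EFin \o G') x}.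
  apply: aeW => x _; apply: cvg_near_cst.
  exists (Num.truncn `|x|) => // n /= xn; rewrite /f_ indicE mem_set ?mule1 //=.
  rewrite in_itv /= -ler_norml; apply: ltW; apply: lt_le_trans (truncnS_gt _) _.
  by rewrite ler_nat.
have mG' : measurable_fun [set: R] (EFin \o G').
  by apply/measurable_EFinP; exact: continuous_measurable_fun.
have mf_ n : measurable_fun [set: R] (f_ n).
  by apply: emeasurable_funM => //; apply/measurable_EFinP; exact: measurable_indic.
have [_ _] := @dominated_convergence _ _ _ mu setT measurableT f_ (EFin \o G') (abse \o (EFin \o G'))
   mf_ mG' aef (integrable_abse iG') aefg.
rewrite (_ : [sequence _]_n = EFin \o u); last by apply/funext => n /=; rewrite intf.
move=> c1; have c2 : (EFin \o u) @ \oo --> 0%:E.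
  by apply: cvg_EFin => //; near=> n.
exact: (congr1 fine (cvg_unique _ c1 c2)).
Unshelve. all: by end_near. Qed.

Let L_le f g : ip f -> ip g -> (forall x, `|f x| <= g x) -> `|L f| <= L g.
Proof.
move=> i1 i2 fg; apply: (le_trans (le_normr_Rintegral _ i1)) => //.
apply: le_Rintegral => //; first exact: (integrable_abse i1).
by move=> x _; rewrite normrM (ger0_norm (p_ge0 x)); apply: ler_wpM2r.
Qed.

Let ipD f g : ip f -> ip g -> ip (fun x => f x + g x).
Proof.
move=> i1 i2; have := integrableD measurableT i1 i2; rewrite /ip.
by congr (mu.-integrable _ _); apply/funext => x /=; rewrite -EFinD mulrDl.
Qed.

(** For the normal law the identity [gaussian_stein] is exact, so [gaussian_ode] applies with error
    [0] along the path [cos (u t x + c)], [0 <= u <= 1]. *)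
Lemma normal_cos (t c : R) : Ex (normal_prob 0 s) (fun x => cos (t * x + c)) =
  cos c * expR (- (s ^+ 2 * t ^+ 2 / 2)).
Proof.
have EL h : @bounded_measurable _ (measurableTypeR R) R h -> Ex (normal_prob 0 s) h = L h.
  by move=> bh; rewrite /Ex /L /Rintegral integral_normal_prob.
rewrite EL; last first.
  by apply: bounded_measurable_cos; apply: (@measurable_affine _ (measurableTypeR R)).
pose f (u : R) := L (fun x => cos (u * t * x + c)).
pose g (u : R) := t * L (fun x => x * sin (u * t * x + c)).
have f0 : f 0 = cos c.
  rewrite /f; have -> : (fun x => cos (0 * t * x + c)) = cst (cos c).
    by apply/funext => x; rewrite !mul0r add0r.
  rewrite -EL; last exact: bounded_measurable_cst.
  exact: Ex_cst.
have ipxs u : ip (fun x => - (u * t) * (x * sin (u * t * x + c))).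
  apply: (@ip_le _ `|u * t| `|u * t|) => //.
  by apply: measurable_funM => //; apply: measurable_funM => //; have [] := measurable_trig (u * t) c.
have df (u : R) : is_derive u 1 f (- g u).
  apply: (@is_derive_quadratic R _ _ _ (2 * (t ^+ 2 * L (fun x => x ^+ 2)))) => h.
  have i2 : ip (fun x => 2 * (h * t) ^+ 2 * x ^+ 2).
    apply: (@ip_le _ 0 (2 * (h * t) ^+ 2)) => //.
    - exact: measurable_funM.
    - by rewrite mulr_ge0 ?sqr_ge0.
    move=> x; rewrite add0r ger0_norm //.
    by apply: mulr_ge0; [apply: mulr_ge0 => //|]; exact: sqr_ge0.
  have i3 : ip (fun x => -1 * cos (u * t * x + c)).
    apply: (@ip_le _ 1 0) => //.
      by apply: measurable_funM => //; have [] := measurable_trig (u * t) c.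
    by move=> x; rewrite mul0r addr0 normrM normrN1 mul1r ler_norml cos_geN1 cos_le1.
  have i4 : ip (fun x => h * t * (x * sin (u * t * x + c))).
    apply: (@ip_le _ `|h * t| `|h * t|) => //.
      by apply: measurable_funM => //; apply: measurable_funM => //; have [] := measurable_trig (u * t) c.
    by move=> x; rewrite -[h * t]opprK normrN.
  have i5 : ip (fun x => -1 * cos (u * t * x + c) + h * t * (x * sin (u * t * x + c))).
    exact: ipD.
  have i6 : ip (fun x => cos ((u + h) * t * x + c) +
      (-1 * cos (u * t * x + c) + h * t * (x * sin (u * t * x + c)))).
    by apply: ipD => //; exact: ip_cos.
  have -> : f (u + h) - f u - h * - g u = L (fun x => cos ((u + h) * t * x + c) +
      (-1 * cos (u * t * x + c) + h * t * (x * sin (u * t * x + c)))).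
    by rewrite LD // LD // !LZ // /f /g; move: (L _) (L _) (L _) => x1 x2 x3; ring.
  have -> : 2 * (t ^+ 2 * L (fun x => x ^+ 2)) * h ^+ 2 = L (fun x => 2 * (h * t) ^+ 2 * x ^+ 2).
    by rewrite LZ //; move: (L _) => l; ring.
  apply: L_le => // x; have := cos_taylor2 (u * t * x + c) (h * t * x).
  have -> : u * t * x + c + h * t * x = (u + h) * t * x + c by ring.
  by rewrite exprMn mulrA; congr (`|_| <= _); ring.
have := @gaussian_ode R f g (t ^+ 2 * s ^+ 2) 0 _ df _.
rewrite f0 normr_le0 subr_eq0 /f mul1r => H.
rewrite (eqP (H _ _)).
- by congr (_ * expR (- _)); ring.
- by rewrite mulr_ge0 ?sqr_ge0.
- by move=> u _; rewrite /g gaussian_stein normr_le0 subr_eq0; apply/eqP; move: (L _) => l; ring.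
Qed.

End GaussianCharacteristic.

Lemma complex_normal_cos (R : realType) (a b c : R) :
  Ex (complex_normal R) (fun z => cos (a * z.1 + b * z.2 + c)) =
  cos c * expR (- ((a ^+ 2 + b ^+ 2) / 4)).
Proof.
pose s : R := (Num.sqrt 2)^-1.
have s0 : s != 0 by rewrite invr_eq0 gt_eqF // sqrtr_gt0.
have s2 : s ^+ 2 = 2^-1 by rewrite exprVn sqr_sqrtr.
have bF : @bounded_measurable _ (plane R) R (fun z => cos (a * z.1 + b * z.2 + c)).
  apply: bounded_measurable_cos; apply: measurable_funD => //; apply: measurable_funD.
    by apply: measurable_funM => //; exact: measurable_fst.
  by apply: measurable_funM => //; exact: measurable_snd.
have iF := @bounded_measurable_integrable _ _ _ (complex_normal R) _ bF.
apply: EFin_inj; rewrite -Ex_EFin // /complex_normal.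
rewrite -(integral12_prod_meas1 iF) /fubini_F /=.
have -> : (fun x : R => \int[normal_prob 0 (Num.sqrt 2)^-1]_y (cos (a * x + b * y + c))%:E)%E =
  (fun x => (cos (a * x + c) * expR (- (b ^+ 2 / 4)))%:E).
  apply/funext => x; have e y : cos (a * x + b * y + c) = cos (b * y + (a * x + c)).
    by congr cos; ring.
  under eq_integral do rewrite e.
  rewrite (Ex_EFin (normal_prob 0 s)).
    by rewrite normal_cos // s2; congr ((_ * expR (- _))%:E); field.
  by apply: bounded_measurable_cos; apply: (@measurable_affine _ (measurableTypeR R)).
rewrite (Ex_EFin (normal_prob 0 s)); last first.
  apply: bounded_measurableM; last exact: bounded_measurable_cst.
  by apply: bounded_measurable_cos; apply: (@measurable_affine _ (measurableTypeR R)).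
have -> : (fun x : R => cos (a * x + c) * expR (- (b ^+ 2 / 4))) =
  (fun x => expR (- (b ^+ 2 / 4)) * cos (a * x + c)) by apply/funext => x; rewrite mulrC.
rewrite ExZ; last first.
  by apply: bounded_measurable_cos; apply: (@measurable_affine _ (measurableTypeR R)).
rewrite normal_cos // s2 mulrCA -expRD; congr ((_ * expR _)%:E); by field.
Qed.

(** * From characteristic functions to bounded continuous test functions *)

Section UniformContinuity.
Variable R : realType.

Lemma unit_square_unif_cont (f : R * R -> R) (e : R) : continuous f -> 0 < e ->
  exists2 r, 0 < r & forall p q : R * R, 0 <= p.1 <= 1 -> 0 <= p.2 <= 1 ->
    `|p.1 - q.1| < r -> `|p.2 - q.2| < r -> `|f p - f q| <= e.
Proof.
move=> cf e0.
have cK : compact (`[0 : R, 1]%classic `*` `[0 : R, 1]%classic).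
  by apply: compact_setX; exact: segment_compact.
pose P (r : R) (p : R * R) := forall q : R * R,
  `|p.1 - q.1| < r -> `|p.2 - q.2| < r -> `|f p - f q| <= e.
have near_cover := (compact_near_coveringP _).1 cK R (0^'+) P _.
have e20 : 0 < e / 2 by rewrite divr_gt0.
have H : \forall t \near (0 : R)^'+, `[0 : R, 1]%classic `*` `[0 : R, 1]%classic `<=` P t.
  apply: near_cover => p _.
  have /cvgrPdist_lt /(_ _ e20) := cf p.
  move=> /nbhs_ballP[r /= r0 Hr].
  have r20 : 0 < r / 2 by rewrite divr_gt0.
  exists (ball p (r / 2), [set t | t < r / 2]); first split => /=.
  - exact: nbhsx_ballx.
  - exact: nbhs_right_lt.
  move=> [p' t] /= [[b1 b2] tr] q h1 h2.
  have bp' : ball p r p'.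
    by split; [move: b1|move: b2]; rewrite /ball /= => /lt_trans; apply; rewrite ltr_pdivrMr // ltr_pMr // ltr1n.
  have bq : ball p r q.
    split; rewrite /ball /=.
      move: b1; rewrite /ball /= => b1; have := ltrD b1 (lt_trans h1 tr).
      by rewrite -splitr; apply: le_lt_trans; rewrite -{1}[p.1](subrK p'.1) -addrA ler_normD.
    move: b2; rewrite /ball /= => b2; have := ltrD b2 (lt_trans h2 tr).
    by rewrite -splitr; apply: le_lt_trans; rewrite -{1}[p.2](subrK p'.2) -addrA ler_normD.
  have := ltrD (Hr _ bp') (Hr _ bq); rewrite -splitr => /ltW; apply: le_trans.
  have -> : f p' - f q = (f p - f q) - (f p - f p') by ring.
  by rewrite (le_trans (ler_normB _ _)) // addrC.
have [r [r0 Hr]] : exists r, 0 < r /\ `[0 : R, 1]%classic `*` `[0 : R, 1]%classic `<=` P r.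
  near (0 : R)^'+ => r; exists r; split; first by near: r; exact: nbhs_right_gt.
  by near: r.
exists r => // p q p1 p2 h1 h2; apply: (Hr p _ q h1 h2).
by split => /=; rewrite in_itv.
Unshelve. all: by end_near. Qed.

End UniformContinuity.

Section WeakConvergence.
Variable R : realType.

(* Clamping at [1/2] keeps [asin] away from the endpoints, where it is not known to be
   continuous. *)
Let inv_sin (M u : R) : R := 2 * M * asin (Num.max (- 2^-1) (Num.min 2^-1 (2 * u - 1))).
(** A change of variable onto [[0, 1]] by a sine: polynomials in [wave] are trigonometric
    polynomials, the functions whose expectations are known to converge. *)
Let wave (M x : R) : R := (1 + sin ((2 * M)^-1 * x)) / 2.

Let wave01 M x : 0 <= wave M x <= 1.
Proof.
rewrite /wave; have := sin_geN1 ((2 * M)^-1 * x); have := sin_le1 ((2 * M)^-1 * x).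
by move=> h1 h2; apply/andP; split; lra.
Qed.

Let continuous_inv_sin M : continuous (inv_sin M).
Proof.
move=> u; apply: cvgM; first exact: cvg_cst.
pose k (x : R) := Num.max (- 2^-1) (Num.min 2^-1 (2 * x - 1)).
have ck : {for u, continuous k}.
  apply: (@continuous_max R R (fun=> - 2^-1) (fun x => Num.min 2^-1 (2 * x - 1))).
    exact: cvg_cst.
  apply: (@continuous_min R R (fun=> 2^-1) (fun x => 2 * x - 1)); first exact: cvg_cst.
  apply: cvgB; last exact: cvg_cst.
  by apply: cvgM; [exact: cvg_cst|exact: cvg_id].
apply: (continuous_comp ck); apply: continuous_asin.
by rewrite /k lt_max gt_max gt_min; apply/andP; split; [apply/orP; left|apply/andP; split; [|apply/orP; left]]; lra.
Qed.

Let inv_sinK M x : 0 < M -> `|x| <= M -> inv_sin M (wave M x) = x.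
Proof.
move=> M0 xM; rewrite /inv_sin /wave; set y := (2 * M)^-1 * x.
have y12 : `|y| <= 2^-1.
  rewrite /y normrM gtr0_norm ?invr_gt0 ?mulr_gt0 // invfM -mulrA.
  by rewrite ler_piMr // mulrC ler_pdivrMr // mul1r.
have /andP[s1 s2] : - 2^-1 <= sin y <= 2^-1.
  by rewrite -ler_norml (le_trans (sin_le_norm y)).
have -> : 2 * ((1 + sin y) / 2) - 1 = sin y by field.
rewrite (min_idPr s2) (max_idPr s1) sinK; last first.
  have pi2 := pi_ge2 R; move: y12; rewrite in_itv /= ler_norml => /andP[y1 y2].
  by apply/andP; split; lra.
by rewrite /y mulVKf // mulf_neq0 ?pnatr_eq0 // gt_eqF.
Qed.

Variable g : R * R -> R.
Hypothesis cg : continuous g.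
Variable B : R.
Hypothesis gB : forall z, `|g z| <= B.

(** A Bernstein polynomial of [g] in two variables, read through [wave]: a trigonometric polynomial
    bounded by [B] on the whole plane and close to [g] on the square of half-side [M]. *)
Let approx M n (z : R * R) := bern n (fun i => bern n (fun j =>
  g (inv_sin M (i%:R / n%:R), inv_sin M (j%:R / n%:R))) (wave M z.2)) (wave M z.1).

Let B0 : 0 <= B. Proof. exact: le_trans (normr_ge0 _) (gB (0, 0)). Qed.

Let approx_bound M n z : `|approx M n z| <= B.
Proof.
have bern_norm m h u : 0 <= u <= 1 -> (forall k, `|h k| <= B) -> `|bern m h u| <= B.
  move=> u01 hB; rewrite ler_norml; apply/andP; split.
    rewrite -[leLHS](bern_cst m _ u); apply: le_bern => // k _.
    by have := hB k; rewrite ler_norml => /andP[].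
  rewrite -[leRHS](bern_cst m _ u); apply: le_bern => // k _.
  by have := hB k; rewrite ler_norml => /andP[].
by apply: (bern_norm) => // i; apply: (bern_norm).
Qed.

(** Uniform continuity handles nearby points and the bound [2 B] the distant ones, where
    [C (p - q)^2 >= 2 B] in some coordinate. The sum is the quadratic estimate that [bern_approx]
    needs, once for each coordinate. *)
Let approx_close M e : 0 < M -> 0 < e -> exists n, forall z : R * R,
  `|z.1| <= M -> `|z.2| <= M -> `|approx M n z - g z| <= e.
Proof.
move=> M0 e0; pose f (p : R * R) := g (inv_sin M p.1, inv_sin M p.2).
have cf : continuous f.
  move=> p; have c1 : {for p, continuous (fun p : R * R => inv_sin M p.1)}.
    by apply: (@continuous_comp _ _ _ fst (inv_sin M)); [exact: cvg_fst|exact: continuous_inv_sin].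
  have c2 : {for p, continuous (fun p : R * R => inv_sin M p.2)}.
    by apply: (@continuous_comp _ _ _ snd (inv_sin M)); [exact: cvg_snd|exact: continuous_inv_sin].
  apply: (@continuous_comp _ _ _ (fun p : R * R => (inv_sin M p.1, inv_sin M p.2)) g).
    exact: (cvg_pair c1 c2).
  exact: cg.
have e20 : 0 < e / 2 by rewrite divr_gt0.
have [r r0 Hr] := unit_square_unif_cont cf e20.
pose C := 2 * B / r ^+ 2.
have C0 : 0 <= C by apply: divr_ge0; [exact: mulr_ge0|exact: sqr_ge0].
have quad (p q : R * R) : 0 <= p.1 <= 1 -> 0 <= p.2 <= 1 ->
    `|f p - f q| <= e / 2 + C * (p.1 - q.1) ^+ 2 + C * (p.2 - q.2) ^+ 2.
  move=> p1 p2.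
  have s1 : 0 <= C * (p.1 - q.1) ^+ 2 by rewrite mulr_ge0 ?sqr_ge0.
  have s2 : 0 <= C * (p.2 - q.2) ^+ 2 by rewrite mulr_ge0 ?sqr_ge0.
  have big x : r <= `|x| -> 2 * B <= C * x ^+ 2.
    move=> rx; rewrite /C mulrAC ler_pdivlMr ?exprn_gt0 //; apply: ler_wpM2l; first exact: mulr_ge0.
    by rewrite -[x ^+ 2]real_normK ?num_real // ler_pXn2r ?nnegrE // ltW.
  have f2B : `|f p - f q| <= 2 * B.
    by rewrite (le_trans (ler_normB _ _)) // mulr_natl mulr2n; apply: lerD; exact: gB.
  have [h1|h1] := ltP `|p.1 - q.1| r; last by have := big _ h1; lra.
  have [h2|h2] := ltP `|p.2 - q.2| r; last by have := big _ h2; lra.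
  by have := Hr p q p1 p2 h1 h2; lra.
have [n n0 hn] : exists2 n, (0 < n)%N & (C + C) / n%:R <= e / 2.
  have [n hn] := ltr_add_invr (divr_gt0 e20 (ltr_pwDr ltr01 (addr_ge0 C0 C0))).
  exists n.+1 => //; move: hn; rewrite add0r ltr_pdivlMr ?ltr_pwDr ?addr_ge0 // => /ltW.
  by apply: le_trans; rewrite mulrC ler_wpM2l ?invr_ge0 // lerDl.
exists n => z z1 z2.
have gz : g z = f (wave M z.1, wave M z.2).
  by rewrite /f /= !inv_sinK //; case: (z).
have in01 k : (k <= n)%N -> 0 <= (k%:R / n%:R : R) <= 1.
  by move=> kn; rewrite divr_ge0 //= ler_pdivrMr ?ltr0n // mul1r ler_nat.
rewrite gz; apply: (@le_trans _ _ (e / 2 + C / n%:R + C / n%:R)).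
  apply: bern_approx => // i ilen; rewrite addrAC.
  apply: bern_approx => // j jlen.
  exact: (quad (i%:R / n%:R, j%:R / n%:R) (wave M z.1, wave M z.2) (in01 _ ilen) (in01 _ jlen)).
by move: hn; rewrite mulrDl; lra.
Qed.

Let measurable_approx M n : measurable_fun setT (approx M n).
Proof.
have mw (p : R * R -> R) : measurable_fun setT p -> measurable_fun setT (fun z => wave M (p z)).
  move=> mp; apply: measurable_funM => //; apply: measurable_funD => //.
  have := measurable_affine (2 * M)^-1 0 mp; under eq_fun do rewrite addr0.
  by case/bounded_measurable_sin.
have mb (f : R * R -> R) m (h : nat -> R * R -> R) : measurable_fun setT f ->
    (forall k, measurable_fun setT (h k)) ->
    measurable_fun setT (fun z => bern m (fun k => h k z) (f z)).
  move=> mf; elim: m h => [|m IH] h mh /=; first exact: mh.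
  apply: measurable_funD; apply: measurable_funM => //.
  - exact: (IH (fun k => h k.+1)).
  - exact: measurable_funB.
  - exact: IH.
apply: (mb (fun z => wave M z.1)) => [|k]; first by apply: mw; exact: measurable_fst.
by apply: mb => //; apply: mw; exact: measurable_snd.
Qed.

(** Measurability refers to the product sigma-algebra. The function [g] is a pointwise limit of the
    [approx], which are built from the coordinates by measurable operations. *)
Lemma continuous_plane_measurable : measurable_fun setT g.
Proof.
have e0 (k : nat) : 0 < k.+1%:R^-1 :> R by rewrite invr_gt0.
have k0 (k : nat) : 0 < k.+1%:R :> R by [].
pose n k := projT1 (cid (approx_close (k0 k) (e0 k))).
have Hn k := projT2 (cid (approx_close (k0 k) (e0 k))).
apply: (@measurable_fun_cvg _ _ _ _ (fun k => approx k.+1%:R (n k))) => // z _.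
apply/cvgrPdist_le => e epos; near=> k; rewrite distrC.
have zk : `|z.1| + `|z.2| <= k.+1%:R.
  near: k; exists (Num.truncn (`|z.1| + `|z.2|)) => // m /= hm.
  by apply: ltW; apply: lt_le_trans (truncnS_gt _) _; rewrite ler_nat.
apply: (le_trans (Hn k z _ _)).
- by apply: le_trans zk; rewrite lerDl.
- by apply: le_trans zk; rewrite lerDr.
near: k; exists (Num.truncn e^-1) => // m /= hm.
rewrite -[leRHS]invrK lef_pV2 ?posrE ?invr_gt0 //.
by apply: ltW; apply: lt_le_trans (truncnS_gt _) _; rewrite ler_nat.
Unshelve. all: by end_near. Qed.

Let bg : bounded_measurable g.
Proof. by split; [exact: continuous_plane_measurable|exists B]. Qed.

Let bapprox M n : bounded_measurable (approx M n).
Proof. by split; [exact: measurable_approx|exists B => z; exact: approx_bound]. Qed.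

Context (d : nat -> measure_display) (T : forall n, measurableType (d n)).
Variables (P : forall n, probability (T n) R) (Z : forall n, T n -> R[i]).
Variable mu : probability (plane R) R.
Hypothesis bZ : forall n, cbounded (@Z n).
Hypothesis Z2 : forall n,
  Ex (P n) (fun w => complex.Re (Z w) ^+ 2 + complex.Im (Z w) ^+ 2) <= 1.
Hypothesis charZ : forall a b c : R,
  Ex (P n) (fun w => cos (a * complex.Re (@Z n w) + b * complex.Im (Z w) + c)) @[n --> \oo] -->
  Ex mu (fun z => cos (a * z.1 + b * z.2 + c)).

Let E n (f : R * R -> R) := Ex (P n) (fun w => f (complex_pair (@Z n w))).

Let mZ n : measurable_fun setT (fun w => complex_pair (@Z n w)).
Proof. by apply: measurable_fun_pair; case: (bZ n) => [[? _] [? _]]. Qed.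

Let bcompZ n (f : R * R -> R) : bounded_measurable f -> bounded_measurable (fun w => f (complex_pair (@Z n w))).
Proof.
by move=> [mf [M fM]]; split; [apply: measurableT_comp (@mZ n)|exists M].
Qed.

Let lin (a b c : R) (z : R * R) := a * z.1 + b * z.2 + c.

Let mlin a b c : measurable_fun setT (lin a b c).
Proof.
by apply: measurable_funD => //; apply: measurable_funD; apply: measurable_funM.
Qed.

(* The test functions for which convergence is known: an algebra generated by the
   trigonometric functions. *)
Let good (f : R * R -> R) := bounded_measurable f /\ forall a b c,
  E n (fun z => f z * cos (lin a b c z)) @[n --> \oo] -->
  Ex mu (fun z => f z * cos (lin a b c z)).

Let bcl a b c : bounded_measurable (fun z => cos (lin a b c z)).
Proof. by apply: bounded_measurable_cos; exact: mlin. Qed.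

Let good1 : good (cst 1).
Proof.
split=> [|a b c]; first exact: bounded_measurable_cst.
have -> : Ex mu (fun z => cst 1 z * cos (lin a b c z)) = Ex mu (fun z => cos (lin a b c z)).
  by congr Ex; apply/funext => z; rewrite mul1r.
rewrite (_ : (fun n => _) = (fun n => E n (fun z => cos (lin a b c z)))); first exact: charZ.
by apply/funext => n; congr Ex; apply/funext => w; rewrite mul1r.
Qed.

Let goodD f h : good f -> good h -> good (fun z => f z + h z).
Proof.
move=> [bf gf] [bh gh]; split=> [|a b c]; first exact: bounded_measurableD.
have bfc := bounded_measurableM bf (bcl a b c).
have bhc := bounded_measurableM bh (bcl a b c).
have -> : Ex mu (fun z => (f z + h z) * cos (lin a b c z)) =
    Ex mu (fun z => f z * cos (lin a b c z)) + Ex mu (fun z => h z * cos (lin a b c z)).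
  by rewrite -ExD //; congr Ex; apply/funext => z; rewrite mulrDl.
have -> : (fun n => E n (fun z => (f z + h z) * cos (lin a b c z))) =
   (fun n => E n (fun z => f z * cos (lin a b c z)) + E n (fun z => h z * cos (lin a b c z))).
  apply/funext => n; rewrite /E -ExD; [|exact: (bcompZ n bfc)|exact: (bcompZ n bhc)].
  by congr Ex; apply/funext => w; rewrite mulrDl.
exact: cvgD.
Qed.

Let goodZ k f : good f -> good (fun z => k * f z).
Proof.
move=> [bf gf]; split=> [|a b c]; first exact: bounded_measurableZ.
have bfc := bounded_measurableM bf (bcl a b c).
have -> : Ex mu (fun z => k * f z * cos (lin a b c z)) = k * Ex mu (fun z => f z * cos (lin a b c z)).
  by rewrite -ExZ //; congr Ex; apply/funext => z; rewrite mulrA.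
have -> : (fun n => E n (fun z => k * f z * cos (lin a b c z))) =
   (fun n => k * E n (fun z => f z * cos (lin a b c z))).
  apply/funext => n; rewrite /E -ExZ; last exact: (bcompZ n bfc).
  by congr Ex; apply/funext => w; rewrite mulrA.
by apply: cvgM => //; exact: cvg_cst.
Qed.

(** The product-to-sum formula: the free phase [c] in [good] allows the resulting sines to be
    written as cosines shifted by [pi / 2]. *)
Let good_sin a' b' f : good f -> good (fun z => sin (lin a' b' 0 z) * f z).
Proof.
move=> [bf gf]; split=> [|a b c].
  by apply: bounded_measurableM => //; apply: bounded_measurable_sin; exact: mlin.
have key z : sin (lin a' b' 0 z) * f z * cos (lin a b c z) =
    2^-1 * (f z * cos (lin (a + a') (b + b') (c - pi / 2) z)) +
    - 2^-1 * (f z * cos (lin (a - a') (b - b') (c - pi / 2) z)).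
  have -> : lin (a + a') (b + b') (c - pi / 2) z = lin a b c z + lin a' b' 0 z - pi / 2.
    by rewrite /lin; ring.
  have -> : lin (a - a') (b - b') (c - pi / 2) z = lin a b c z - lin a' b' 0 z - pi / 2.
    by rewrite /lin; ring.
  move: (lin a b c z) (lin a' b' 0 z) (f z) => x y t.
  by rewrite !cosBpihalf sinD sinB; field.
have b1 a0 b0 := bounded_measurableM bf (bcl a0 b0 (c - pi / 2)).
have b2 k a0 b0 := bounded_measurableZ k (b1 a0 b0).
have -> : Ex mu (fun z => sin (lin a' b' 0 z) * f z * cos (lin a b c z)) =
    2^-1 * Ex mu (fun z => f z * cos (lin (a + a') (b + b') (c - pi / 2) z)) +
     - 2^-1 * Ex mu (fun z => f z * cos (lin (a - a') (b - b') (c - pi / 2) z)).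
  transitivity (Ex mu (fun z => 2^-1 * (f z * cos (lin (a + a') (b + b') (c - pi / 2) z)) +
      - 2^-1 * (f z * cos (lin (a - a') (b - b') (c - pi / 2) z)))).
    by congr Ex; apply/funext => z; rewrite key.
  rewrite (ExD mu (b2 _ _ _) (b2 _ _ _)).
  by congr (_ + _); apply: (ExZ mu _ (b1 _ _)).
have -> : (fun n => E n (fun z => sin (lin a' b' 0 z) * f z * cos (lin a b c z))) =
   (fun n => 2^-1 * E n (fun z => f z * cos (lin (a + a') (b + b') (c - pi / 2) z)) +
     - 2^-1 * E n (fun z => f z * cos (lin (a - a') (b - b') (c - pi / 2) z))).
  apply/funext => n; rewrite /E -!ExZ; [|exact: (bcompZ n (b1 _ _))..].
  rewrite -ExD; [|exact: bounded_measurableZ (bcompZ n (b1 _ _))..].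
  by congr Ex; apply/funext => w; rewrite key.
by apply: cvgD; apply: cvgM => //; exact: cvg_cst.
Qed.

Let good_bern (f : R * R -> R) m (h : nat -> R * R -> R) :
  (forall k, good k -> good (fun z => f z * k z)) -> (forall i, good (h i)) ->
  good (fun z => bern m (fun i => h i z) (f z)).
Proof.
move=> gf; elim: m h => [|m IH] h gh /=; first exact: gh.
have -> : (fun z => f z * bern m (fun k => h k.+1 z) (f z) + (1 - f z) * bern m (h^~ z) (f z)) =
  (fun z => f z * bern m (fun k => h k.+1 z) (f z) +
     (bern m (fun k => h k z) (f z) + (-1) * (f z * bern m (fun k => h k z) (f z)))).
  by apply/funext => z; ring.
apply: goodD; first by apply: gf; exact: (IH (fun k => h k.+1)).
by apply: goodD; [exact: IH|apply: goodZ; apply: gf; exact: IH].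
Qed.

Let good_approx M n : good (approx M n).
Proof.
have gw a b f : good f -> good (fun z => (1 + sin (lin a b 0 z)) / 2 * f z).
  move=> gf; have -> : (fun z => (1 + sin (lin a b 0 z)) / 2 * f z) =
    (fun z => 2^-1 * f z + 2^-1 * (sin (lin a b 0 z) * f z)).
    by apply/funext => z; field.
  by apply: goodD; apply: goodZ => //; exact: good_sin.
apply: (good_bern (f := fun z => wave M z.1)) => [k gk|i].
  have := gw (2 * M)^-1 0 k gk; congr good; apply/funext => z.
  by rewrite /lin /wave mul0r !addr0.
apply: (good_bern (f := fun z => wave M z.2)) => [k gk|j].
  have := gw 0 (2 * M)^-1 k gk; congr good; apply/funext => z.
  by rewrite /lin /wave mul0r add0r addr0.
rewrite (_ : (fun _ => _) = (fun z => g (inv_sin M (i%:R / n%:R), inv_sin M (j%:R / n%:R)) * cst 1 z)).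
  exact: goodZ good1.
by apply/funext => z; rewrite /= mulr1.
Qed.

(** On a large square [g] is replaced by a trigonometric polynomial. Outside it the error is bounded
    by [2 B], and the mass is small: by Chebyshev's inequality and the second moment bound for [Z],
    and by continuity from above for [mu]. *)
Lemma weak_convergence : E n g @[n --> \oo] --> Ex mu g.
Proof.
apply/cvgrPdist_le => e0 epos.
(* Two replacements of [g], each costing [e + 2 B e], and one limit, costing [e]. *)
pose e := e0 / (4 + 4 * B).
have B40 : 0 < 4 + 4 * B by rewrite ltr_pwDl // mulr_ge0.
have e1 : 0 < e by rewrite divr_gt0.
pose A (k : nat) := [set z : plane R | k%:R < `|z.1| + `|z.2|].
have mA k : measurable (A k).
  rewrite /A -[X in measurable X]setTI.
  rewrite (_ : [set z | _] = (fun z : plane R => `|z.1| + `|z.2|) @^-1` `]k%:R, +oo[%classic).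
    by apply: measurable_funD => //; apply: measurableT_comp.
  by apply/seteqP; split => z /=; rewrite in_itv /= andbT.
have muA : mu (A k) @[k --> \oo] --> 0%E.
  have <- : mu (\bigcap_k A k) = 0%E.
    rewrite (_ : \bigcap_k A k = set0) ?measure0 //.
    apply/seteqP; split => z //= H.
    have := H (Num.truncn (`|z.1| + `|z.2|)).+1 I; rewrite /A /=.
    by move/(lt_trans (truncnS_gt _)); rewrite ltxx.
  apply: nonincreasing_cvg_mu => //.
  - by rewrite -ge0_fin_numE // fin_num_measure.
  - exact: bigcap_measurable.
  - move=> m n mn; apply/subsetPset => z; rewrite /A /=.
    by apply: le_lt_trans; rewrite ler_nat.
have [k k1 [k2 muk]] : exists2 k : nat, 0 < k%:R :> R & (k%:R ^+ 2)^-1 <= e /\ fine (mu (A k)) <= e.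
  move/fine_cvgP : muA => [_ /cvgrPdist_le /(_ _ e1) near1].
  near \oo => k; exists k; last split.
  - rewrite ltr0n; near: k; exact: nbhs_infty_gt.
  - have k0 : 0 < k%:R :> R by rewrite ltr0n; near: k; exact: nbhs_infty_gt.
    rewrite -[leRHS]invrK lef_pV2 ?posrE ?invr_gt0 ?exprn_gt0 //.
    have ke : e^-1 <= k%:R.
      near: k; exists (Num.truncn e^-1).+1 => // m /= hm.
      by apply: ltW; apply: lt_le_trans (truncnS_gt _) _; rewrite ler_nat.
    apply: le_trans ke _; rewrite expr2 ler_peMr ?(ltW k0) // ler1n.
    by near: k; exact: nbhs_infty_gt.
  - have : `|0 - fine (mu (A k))| <= e by near: k.
    by rewrite sub0r normrN; apply: le_trans; exact: ler_norm.

have [m Hm] := approx_close k1 e1.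
pose f := approx k%:R m.
have far z : `|f z - g z| <= 2 * B.
  rewrite (le_trans (ler_normB _ _)) // mulr_natl mulr2n.
  by apply: lerD; [exact: approx_bound|exact: gB].
have bf : bounded_measurable f by exact: bapprox.
have B20 : 0 <= 2 * B by rewrite mulr_ge0.
have box (z : R * R) : `|z.1| <= k%:R -> `|z.2| <= k%:R -> `|f z - g z| <= e by exact: Hm.
have h1 n : `|E n f - E n g| <= e + 2 * B * e.
  have b2 : bounded_measurable (fun w => complex.Re (@Z n w) ^+ 2 + complex.Im (@Z n w) ^+ 2).
    by apply: bounded_measurableD; apply: bounded_measurableX; case: (bZ n).
  have b3 := bounded_measurableZ (2 * B * (k%:R ^+ 2)^-1) b2.
  have bc : bounded_measurable (cst e : T n -> R) by exact: bounded_measurable_cst.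
  apply: (@le_trans _ _ (Ex (P n) (fun w => cst e w + 2 * B * (k%:R ^+ 2)^-1 *
     (complex.Re (@Z n w) ^+ 2 + complex.Im (@Z n w) ^+ 2)))).
    rewrite /E; apply: (le_norm_Ex_sub (P n) (bcompZ n bf) (bcompZ n bg) (bounded_measurableD bc b3)) => w /=.
    set x := complex.Re _; set y := complex.Im _.
    have far' (t : R) : k%:R < `|t| -> k%:R ^+ 2 <= t ^+ 2.
      move=> kt; rewrite -[t ^+ 2]real_normK ?num_real // ler_pXn2r ?nnegrE //; exact: ltW.
    have fin : k%:R ^+ 2 <= x ^+ 2 + y ^+ 2 ->
      `|f (x, y) - g (x, y)| <= e + 2 * B / k%:R ^+ 2 * (x ^+ 2 + y ^+ 2).
      move=> kxy; apply: le_trans (far _) _; rewrite -[leLHS]add0r; apply: lerD; first exact: ltW.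
      rewrite -mulrA -[leLHS]mulr1; apply: ler_wpM2l => //.
      by rewrite mulrC ler_pdivlMr ?exprn_gt0 // mul1r.
    have [hx|hx] := leP `|x| k%:R; last first.
      by apply: fin; apply: le_trans (far' _ hx) _; rewrite lerDl sqr_ge0.
    have [hy|hy] := leP `|y| k%:R; last first.
      by apply: fin; apply: le_trans (far' _ hy) _; rewrite lerDr sqr_ge0.
    apply: le_trans (box (x, y) hx hy) _; rewrite lerDl; apply: mulr_ge0.
      by apply: divr_ge0 => //; exact: sqr_ge0.
    by rewrite addr_ge0 ?sqr_ge0.
  rewrite ExD // Ex_cst ExZ // lerD2l -mulrA; apply: ler_wpM2l => //.
  apply: le_trans k2; rewrite -[leRHS]mulr1; exact: ler_wpM2l.
have h2 : `|Ex mu f - Ex mu g| <= e + 2 * B * e.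
  have b2 : bounded_measurable (\1_(A k) : plane R -> R) by exact: bounded_measurable_indic.
  have b3 := bounded_measurableZ (2 * B) b2.
  have bc : bounded_measurable (cst e : plane R -> R) by exact: bounded_measurable_cst.
  apply: (@le_trans _ _ (Ex mu (fun z => cst e z + 2 * B * \1_(A k) z))).
    apply: (le_norm_Ex_sub mu bf bg (bounded_measurableD bc b3)) => z /=.
    rewrite indicE; have [/set_mem zA|/negP zA] := boolP (z \in A k).
      by rewrite mulr1; apply: le_trans (far z) _; rewrite lerDr ltW.
    rewrite mulr0 addr0; apply: box; have zk : `|z.1| + `|z.2| <= k%:R.
    - by rewrite leNgt; apply/negP => h; apply: zA; exact: mem_set.
    - by apply: le_trans zk; rewrite lerDl.
    - by rewrite leNgt; apply/negP => h; apply: zA; exact: mem_set.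
    - by apply: le_trans zk; rewrite lerDr.
  rewrite ExD // Ex_cst ExZ // lerD2l; apply: ler_wpM2l => //.
  by rewrite Ex_indic.
have h3 : E n f @[n --> \oo] --> Ex mu f.
  have := (good_approx k%:R m).2 0 0 0; rewrite -/f.
  have -> : (fun z => f z * cos (lin 0 0 0 z)) = f.
    by apply/funext => z; rewrite /lin !mul0r !addr0 cos0 mulr1.
  by [].
near=> n.
have : `|Ex mu f - E n f| <= e.
  near: n; move/cvgrPdist_le : h3; exact.
have := h1 n; move: h2; set x := Ex mu f; set y := Ex mu g; set x' := E n f; set y' := E n g.
move=> a1 a2 a3; have -> : y - y' = (x - x') - (x - y) + (x' - y') by ring.
rewrite (le_trans (ler_normD _ _)) // (le_trans (lerD (ler_normB _ _) (lexx _))) //.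
apply: le_trans (lerD (lerD a3 a1) a2) _.
have -> : e0 = (4 + 4 * B) * e by rewrite /e mulrC divfK // gt_eqF.
have final (t b : R) : 0 < t -> 0 <= b ->
    t + (t + 2 * b * t) + (t + 2 * b * t) <= (4 + 4 * b) * t by nra.
exact: final.
Unshelve. all: by end_near. Qed.

End WeakConvergence.


(** * Polynomials in short intervals *)

Section PolynomialBalls.
Variables (F : finFieldType) (N : nat).
Local Notation P := {poly_N.+1 F}.
Implicit Types (G g : P) (K D : {poly F}) (H d : nat).

(** The condition [size <= H] means degree below [H]: the interval of radius [h] is the ball with
    [H = h + 1], and [H = 0] leaves at most [K] itself. *)
Definition ball_poly K H : {set P} :=
  [set G : P | (size ((G : {poly F}) - K)%R <= H)%N].

(** Euclidean division of [K] by [D]: the remainder has size at most [d <= H], so the multiples are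
    exactly the [D * (K %/ D + E)] with [E] of size at most [H - d]. *)
Lemma card_multiples_in_ball K D H d : D \is monic -> size D = d.+1 ->
  (d <= H)%N -> (size K <= N.+1)%N -> (H <= N.+1)%N ->
  #|[set G in ball_poly K H | (D %| (G : {poly F}))%R]| = (#|F| ^ (H - d))%N.
Proof.
move=> Dm sD dH sK HN; rewrite -(card_npoly F (H - d)) -[in RHS]cardsT.
have D0 : D != 0 by exact: monic_neq0.
have KE : K = D * (K %/ D) + K %% D by rewrite mulrC -divp_eq.
have sKD : (size (K %% D)%R <= d)%N by rewrite -ltnS -sD ltn_modpN0.
have sz (E : {poly_(H - d) F}) : (size (D * (K %/ D + E) - K)%R <= H)%N.
  rewrite {2}KE mulrDr opprD addrACA subrr add0r.
  apply: (leq_trans (size_polyD _ _)); rewrite geq_max size_polyN.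
  rewrite (leq_trans sKD dH) andbT.
  have [->|E0] := eqVneq (E : {poly F}) 0; first by rewrite mulr0 size_poly0.
  by rewrite size_proper_mul ?mulf_neq0 ?lead_coef_eq0 // sD addSn /=
    -leq_subRL // size_npoly.
have szN (E : {poly_(H - d) F}) : (size (D * (K %/ D + E))%R <= N.+1)%N.
  rewrite -(subrK K (D * _)).
  apply: (leq_trans (size_polyD _ _)); rewrite geq_max sK andbT.
  exact: leq_trans (sz E) HN.
pose phi (E : {poly_(H - d) F}) : P := npolyp N.+1 (D * (K %/ D + E)).
have phiE E : (phi E : {poly F}) = D * (K %/ D + E) by rewrite npolypK.
have phi_inj : injective phi.
  move=> E1 E2 /(congr1 (fun G : P => (G : {poly F}))); rewrite !phiE.
  by move=> /(mulfI D0)/addrI/val_inj.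
rewrite -(card_imset _ phi_inj); congr #|pred_of_set _|; apply/setP => G.
rewrite !inE; apply/idP/imsetP => [/andP[GK DG]|[E _ ->]]; last first.
  by rewrite phiE sz dvdp_mulr.
have GE : (G : {poly F}) = D * (G %/ D) by rewrite mulrC divpK.
have sE : (size (G %/ D - K %/ D)%R <= H - d)%N.
  have [->|E0] := eqVneq (G %/ D - K %/ D) 0; first by rewrite size_poly0.
  have : (size (D * (G %/ D - K %/ D))%R <= H)%N.
    have -> : D * (G %/ D - K %/ D) = (G : {poly F}) - K + K %% D.
      by rewrite mulrBr -GE [X in _ = _ - X + _]KE opprD addrA subrK.
    apply: (leq_trans (size_polyD _ _)); rewrite geq_max GK.
    exact: leq_trans sKD dH.
  by rewrite size_proper_mul ?mulf_neq0 ?lead_coef_eq0 // sD addSn /= -leq_subRL.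
exists (npolyp (H - d) (G %/ D - K %/ D)); rewrite ?inE //.
by apply: val_inj; rewrite /= phiE npolypK // addrC subrK.
Qed.

Lemma card_ball_poly K H : (size K <= N.+1)%N -> (H <= N.+1)%N ->
  #|ball_poly K H| = (#|F| ^ H)%N.
Proof.
move=> sK HN; rewrite -[in RHS](subn0 H).
rewrite -(@card_multiples_in_ball K 1 H 0) ?monic1 ?size_poly1 //.
by congr #|pred_of_set _|; apply/setP => G; rewrite !inE dvd1p andbT.
Qed.

Lemma card_multiples_le1 K D H : (H < size D)%N ->
  (#|[set G in ball_poly K H | (D %| (G : {poly F}))%R]| <= 1)%N.
Proof.
move=> HD; apply/card_le1P => G; rewrite !inE => /andP[GK DG] G'.
rewrite !inE; apply/andP/eqP => [[GK' DG']|-> //].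
apply/val_inj/eqP; rewrite -subr_eq0 /=; apply/eqP.
rewrite -[LHS]/(polyn G' - polyn G).
have : D %| polyn G' - polyn G by rewrite dvdp_sub.
have [->//|ne0] := eqVneq (polyn G' - polyn G) 0.
move=> /(dvdp_leq ne0) /(leq_trans HD); rewrite ltnNge => /negP[].
have -> : polyn G' - polyn G = (polyn G' - K) - (polyn G - K).
  by rewrite opprB addrA subrK.
by rewrite (leq_trans (size_polyD _ _)) // geq_max size_polyN GK' GK.
Qed.

End PolynomialBalls.

Lemma exists_monic_irreducible_divisor (F : finFieldType) (G : {poly F}) :
  (1 < size G)%N -> exists p, [/\ p \is monic, irreducible_poly p & p %| G].
Proof.
elim: {G}_.+1 {-2}G (ltnSn (size G)) => // n IH G Gn G1.
have G0 : G != 0 by rewrite -size_poly_gt0; apply: ltnW.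
have lG0 : lead_coef G != 0 by rewrite lead_coef_eq0.
have [irr|] := boolP (irreducibleb G).
  exists ((lead_coef G)^-1 *: G); split.
  - by rewrite monicE lead_coefZ mulVf.
  - split; first by rewrite size_scale ?invr_neq0.
    move=> d d1; rewrite dvdpZr ?invr_neq0 // => dG.
    rewrite (eqp_trans ((irreducibleP _ irr).2 d d1 dG)) // eqp_sym eqp_scale //.
    by rewrite invr_neq0.
  - by rewrite dvdpZl ?invr_neq0.
rewrite /irreducibleb G1 /= negb_forall => /existsP[d].
rewrite negb_imply -ltnNge -Pdiv.Idomain.dvdpE => /andP[dG d1].
have [|p [pm pi pd]] := IH d _ d1.
  rewrite ltnS in Gn; apply: leq_trans Gn.
  by have := size_npoly d; rewrite -ltnS prednK // ltnW.
by exists p; split => //; exact: dvdp_trans pd dG.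
Qed.

(** * Unique factorisation and valuations *)

Section PrimeFactorisation.
Variables (F : finFieldType) (N : nat).
Local Notation P := {poly_N.+1 F}.

(** The degree is capped at [N] to obtain a finite type, so that products and sums over all relevant
    irreducibles are finite. *)
Definition prime_poly : predArgType :=
  {p : P | (polyn p \is monic) && irreducibleb (polyn p)}.
Definition ppoly (i : prime_poly) : {poly F} := polyn (val i).
Definition pdeg (i : prime_poly) := (size (ppoly i)).-1.
Definition pval (i : prime_poly) (G : {poly F}) : nat :=
  (\sum_(k < N) (ppoly i ^+ k.+1 %| G)%R)%N.

Implicit Types (i j : prime_poly) (G : {poly F}).

Lemma ppoly_monic i : ppoly i \is monic.
Proof. by have /andP[] := valP i. Qed.

Lemma ppoly_irreducible i : irreducible_poly (ppoly i).
Proof. by have /andP[_ /irreducibleP] := valP i. Qed.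

Lemma ppoly_inj : injective ppoly.
Proof. by move=> i j /val_inj/val_inj. Qed.

Lemma ppoly_neq0 i : ppoly i != 0.
Proof. exact: monic_neq0 (ppoly_monic i). Qed.

Lemma pdeg_gt0 i : (0 < pdeg i)%N.
Proof. by have [] := ppoly_irreducible i; rewrite /pdeg; case: size => [|[]]. Qed.

Lemma size_ppoly i : size (ppoly i) = (pdeg i).+1.
Proof. by rewrite prednK // size_poly_gt0 ppoly_neq0. Qed.

Lemma pdeg_leq i : (pdeg i <= N)%N.
Proof. by rewrite -ltnS -size_ppoly size_npoly. Qed.

Lemma size_ppoly_exp i k : size (ppoly i ^+ k) = (k * pdeg i).+1.
Proof. by rewrite mulnC -size_exp prednK // size_poly_gt0 expf_neq0 ?ppoly_neq0. Qed.

Lemma ppoly_coprime i j : i != j -> coprimep (ppoly i) (ppoly j).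
Proof.
move=> ij; rewrite irreducible_poly_coprime; last exact: ppoly_irreducible.
apply: contra ij => ij; rewrite -(inj_eq ppoly_inj) -eqp_monic ?ppoly_monic //.
have [j1 jirr] := ppoly_irreducible j; apply: jirr => //.
by rewrite size_ppoly eqSS -lt0n pdeg_gt0.
Qed.

Lemma dvdp_ppoly_prime i (G G' : {poly F}) :
  (ppoly i %| G * G') = (ppoly i %| G) || (ppoly i %| G').
Proof.
apply/idP/orP => [pGG|[pG|pG]]; last 2 first.
- exact: dvdp_mulr.
- exact: dvdp_mull.
have [|nG] := boolP (ppoly i %| G); first by left.
right; move: pGG; rewrite Gauss_dvdpr // irreducible_poly_coprime //.
exact: ppoly_irreducible.
Qed.

Lemma ex_ppoly G : (1 < size G <= N.+1)%N -> exists i, ppoly i %| G.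
Proof.
move=> /andP[G1 GN].
have [p [pm /irreducibleP pi pG]] := exists_monic_irreducible_divisor G1.
have G0 : G != 0 by rewrite -size_poly_gt0 ltnW.
have sp : (size p <= N.+1)%N := leq_trans (dvdp_leq G0 pG) GN.
have pP : (polyn (npolyp N.+1 p) \is monic) &&
    irreducibleb (polyn (npolyp N.+1 p)) by rewrite npolypK // pm.
by exists (Sub (npolyp N.+1 p) pP); rewrite /ppoly SubK npolypK.
Qed.

Lemma pval_mul i j G : G \is monic -> (size (ppoly j * G)%R <= N.+1)%N ->
  pval i (ppoly j * G) = ((i == j) + pval i G)%N.
Proof.
move=> Gm; have [<- sG|ij _] := eqVneq i j; last first.
  by apply: eq_bigr => k _; rewrite Gauss_dvdpr // coprimep_expl // ppoly_coprime.
have N0 : (0 < N)%N by apply: leq_trans (pdeg_gt0 i) (pdeg_leq i).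
rewrite /pval /= -(big_mkord xpredT (fun k => nat_of_bool (ppoly i ^+ k.+1 %| ppoly i * G))).
rewrite -(big_mkord xpredT (fun k => nat_of_bool (ppoly i ^+ k.+1 %| G))).
have last_term (f : nat -> nat) n : (0 < n)%N ->
    (\sum_(0 <= k < n) f k = \sum_(0 <= k < n.-1) f k + f n.-1)%N.
  by case: n => // n _; rewrite big_nat_recr.
rewrite big_ltn // big_add1 expr1 dvdp_mulIl /= [in RHS]last_term //= (prednK N0).
congr addn.
(* Multiplication by [p] shifts the list of powers by one; the top power drops out because [p * G]
   has degree at most [N]. *)
have -> : (ppoly i ^+ N %| G) = false.
  apply/negP => /(dvdp_leq (monic_neq0 Gm)).
  rewrite size_ppoly_exp => lt; move: sG.
  rewrite size_proper_mul ?size_ppoly ?mulf_neq0 ?lead_coef_eq0 ?ppoly_neq0 ?monic_neq0 //.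
  rewrite addSn /=; have := leq_ltn_trans (leq_pmulr N (pdeg_gt0 i)) lt.
  by move: (pdeg_gt0 i); clear; move: (pdeg i) (size G) => a b; lia.
rewrite addn0; apply: eq_big_nat => k _.
by rewrite [in LHS]exprS dvdp_mul2l // ppoly_neq0.
Qed.

Lemma pval1 i : pval i 1 = 0%N.
Proof.
apply: big1 => k _; apply/eqP; rewrite eqb0; apply/negP => /dvdp_leq.
rewrite oner_neq0 size_poly1 size_ppoly_exp => /(_ isT).
by rewrite ltnS leqn0 muln_eq0 /= -leqn0 leqNgt pdeg_gt0.
Qed.

Lemma poly_factorisation G : G \is monic -> (size G <= N.+1)%N ->
  G = \prod_i ppoly i ^+ pval i G.
Proof.
elim: {G}_.+1 {-2}G (ltnSn (size G)) => // n IH G Gn Gm GN.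
have [G1|G1] := leqP (size G) 1.
  have -> : G = 1.
    move: Gm; rewrite (size1_polyC G1) monicE lead_coefC => /eqP ->.
    by rewrite polyC1.
  by rewrite big1 // => i _; rewrite pval1.
have [|j jG] := @ex_ppoly G; first by rewrite G1.
have GE : G = ppoly j * (G %/ ppoly j) by rewrite mulrC divpK.
have G'm : G %/ ppoly j \is monic.
  by rewrite -(monicMl _ (ppoly_monic j)) -GE.
have sG : size G = (pdeg j + size (G %/ ppoly j)%R)%N.
  rewrite {1}GE size_proper_mul ?size_ppoly ?mulf_neq0 ?lead_coef_eq0 //.
  - exact: ppoly_neq0.
  - exact: monic_neq0.
have sG' : (size (G %/ ppoly j)%R < size G)%N.
  by rewrite sG -add1n leq_add2r pdeg_gt0.
rewrite {1}GE (IH (G %/ ppoly j)) //; last exact: leq_trans (ltnW sG') GN.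
  rewrite (bigD1 j) //= [in RHS](bigD1 j) //= mulrA -exprS; congr (_ ^+ _ * _).
    by rewrite {2}GE pval_mul // -?GE // eqxx.
  apply: eq_bigr => i ij; rewrite {2}GE pval_mul // -?GE //.
  by rewrite (negbTE ij).
by rewrite ltnS in Gn; apply: leq_trans Gn.
Qed.

Lemma pval_gt0 i G : G \is monic -> (size G <= N.+1)%N ->
  (0 < pval i G)%N = (ppoly i %| G).
Proof.
move=> Gm GN; apply/idP/idP => [|iG].
  rewrite lt0n sum_nat_eq0 negb_forall => /existsP[k].
  rewrite /= eqb0 negbK; apply: dvdp_trans.
  by rewrite -[X in X %| _]expr1 dvdp_exp2l.
have N0 : (0 < N)%N by apply: leq_trans (pdeg_gt0 i) (pdeg_leq i).
by rewrite lt0n sum_nat_eq0 negb_forall; apply/existsP; exists (Ordinal N0); rewrite /= expr1 iG.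
Qed.

Lemma sum_pdeg_pval G : G \is monic -> (size G <= N.+1)%N ->
  (\sum_i pdeg i * pval i G)%N = (size G).-1.
Proof.
move=> Gm GN; rewrite [in RHS](poly_factorisation Gm GN) size_prod; last first.
  by move=> i _; rewrite expf_neq0 // ppoly_neq0.
have -> : (\sum_i size (ppoly i ^+ pval i G) =
    \sum_(i : prime_poly) pdeg i * pval i G + #|xpredT : pred prime_poly|)%N.
  rewrite -sum1_card -big_split /=; apply: eq_bigr => i _.
  by rewrite size_ppoly_exp mulnC addn1.
by rewrite -addSn addnK.
Qed.

Lemma eq_prod_pval (A B C D : {poly F}) :
  A \is monic -> B \is monic -> C \is monic -> D \is monic ->
  (size A <= N.+1)%N -> (size B <= N.+1)%N ->
  (size C <= N.+1)%N -> (size D <= N.+1)%N ->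
  (forall i, pval i A + pval i B = pval i C + pval i D)%N -> A * B = C * D.
Proof.
move=> Am Bm Cm Dm sA sB sC sD E.
rewrite (poly_factorisation Am sA) (poly_factorisation Bm sB).
rewrite (poly_factorisation Cm sC) (poly_factorisation Dm sD) -!big_split /=.
by apply: eq_bigr => i _; rewrite -!exprD E.
Qed.

End PrimeFactorisation.

(** * The prime polynomial theorem *)

Section PrimeCounting.
Variables (F : finFieldType) (N : nat).
Local Notation P := {poly_N.+1 F}.
Local Notation q := (#|F|).
Local Notation prime := (@prime_poly F N).
Implicit Types (i j : prime) (n d k : nat).

Lemma card_field_gt1 : (1 < q)%N.
Proof. by rewrite (cardD1 0) (cardD1 1) !inE oner_neq0. Qed.

Lemma card_field_gt0 : (0 < q)%N.
Proof. exact: ltnW card_field_gt1. Qed.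

Lemma ball_monic (K : {poly F}) H G : K \is monic -> (H < size K)%N ->
  G \in ball_poly N K H -> polyn G \is monic /\ size (polyn G) = size K.
Proof.
move=> Km HK; rewrite inE => GK.
have lt : (size (polyn G - K)%R < size K)%N := leq_ltn_trans GK HK.
have -> : polyn G = K + (polyn G - K) by rewrite addrC subrK.
by rewrite monicE lead_coefDl // size_polyDl // -monicE.
Qed.

Definition nprime d := #|[set i : prime | pdeg i == d]%SET|.

(** The sum of the degrees of all monic polynomials of degree [n], after unique factorisation and
    exchange of summations: [q ^ (n - (k + 1) deg p)] counts the multiples of [p ^ (k + 1)]. *)
Definition prime_power_sum n :=
  (\sum_(i : prime) \sum_(k < N)
     if k.+1 * pdeg i <= n then pdeg i * q ^ (n - k.+1 * pdeg i) else 0)%N.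

(* The von Mangoldt function summed over the monic polynomials of degree [n]. *)
Definition prime_power_count n :=
  (\sum_(i : prime) \sum_(k < N) if k.+1 * pdeg i == n then pdeg i else 0)%N.

Lemma prime_power_sumE n : (n <= N)%N -> prime_power_sum n = (n * q ^ n)%N.
Proof.
(* The ball of radius [n] about [X^n] is the set of all monic polynomials of degree [n]. *)
move=> nN; have sX : size ('X^n : {poly F}) = n.+1 by rewrite size_polyXn.
have nX : (n < size ('X^n : {poly F}))%N by rewrite sX.
have -> : (n * q ^ n)%N =
    (\sum_(G in ball_poly N ('X^n : {poly F}) n) (size (polyn G)).-1)%N.
  rewrite (eq_bigr (fun=> n)); last first.
    by move=> G /(ball_monic (monicXn F n) nX)[_ ->]; rewrite sX.
  by rewrite sum_nat_const card_ball_poly ?sX // ?(leqW nN) // mulnC.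
rewrite (eq_bigr (fun G => \sum_(i : prime) pdeg i * pval i (polyn G)))%N; last first.
  by move=> G /(ball_monic (monicXn F n) nX)[Gm _]; rewrite sum_pdeg_pval // size_npoly.
rewrite exchange_big /=; apply: eq_bigr => i _; rewrite -big_distrr /=.
rewrite /pval exchange_big /= big_distrr /=; apply: eq_bigr => k _.
have -> : (\sum_(G in ball_poly N ('X^n : {poly F}) n) (ppoly i ^+ k.+1 %| polyn G)%R)%N =
    #|[set G in ball_poly N ('X^n : {poly F}) n | (ppoly i ^+ k.+1 %| polyn G)%R]|.
  rewrite -sum1_card [RHS](eq_bigl (fun G => (G \in ball_poly N ('X^n : {poly F}) n) &&
    (ppoly i ^+ k.+1 %| polyn G)%R)) => [|G]; last by rewrite inE.
  by rewrite big_mkcondr /=; apply: eq_bigr => G _; case: ifP.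
have sp := size_ppoly_exp i k.+1.
have pm : ppoly i ^+ k.+1 \is monic by rewrite monic_exp // ppoly_monic.
case: leqP => kn; first by rewrite (card_multiples_in_ball pm sp) ?sX ?ltnS ?(leqW nN).
rewrite eq_card0 ?muln0 // => G; rewrite !inE -[(_ <= _)%N]/(_ <= _)%N.
apply/negP => /andP[GX /dvdp_leq pG].
have /(ball_monic (monicXn F n) nX)[Gm sG] : G \in ball_poly N ('X^n : {poly F}) n by rewrite inE.
by have := pG (monic_neq0 Gm); rewrite sp sG sX ltnS leqNgt kn.
Qed.

(** Raising [n] by one multiplies every term already present by [q]; only the prime powers of degree
    exactly [n + 1] are new. *)
Lemma prime_power_sumS n :
  prime_power_sum n.+1 = (q * prime_power_sum n + prime_power_count n.+1)%N.
Proof.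
rewrite /prime_power_sum big_distrr -big_split; apply: eq_bigr => i _.
rewrite big_distrr -big_split; apply: eq_bigr => k _ /=.
case: (ltngtP (k.+1 * pdeg i)%N n.+1) => [|lt|->].
- by rewrite ltnS => le; rewrite le addn0 subSn // expnS mulnCA.
- by rewrite leqNgt (ltn_trans (ltnSn n) lt) muln0.
- by rewrite ltnn muln0 add0n subnn expn0 muln1.
Qed.

Lemma prime_power_countE n : (0 < n <= N)%N -> prime_power_count n = (q ^ n)%N.
Proof.
case: n => // n /= nN; have := prime_power_sumS n.
rewrite !prime_power_sumE ?(ltnW nN) // => E.
apply/eqP; rewrite -(eqn_add2l (q * (n * q ^ n))) -E; apply/eqP.
by rewrite mulnCA -expnS -mulSnr.
Qed.

Lemma nprime_le d : (0 < d <= N)%N -> (d * nprime d <= q ^ d)%N.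
Proof.
move=> dN; rewrite -prime_power_countE // mulnC /nprime -sum_nat_const.
rewrite /prime_power_count big_mkcond /=; apply: leq_sum => i _; rewrite inE.
case: eqP => // <-; have N0 : (0 < N)%N by case/andP: dN => d0; apply: leq_trans.
by rewrite (bigD1 (Ordinal N0)) //= mul1n eqxx leq_addr.
Qed.

Lemma sum_expn_le m : (\sum_(1 <= e < m.+1) q ^ e <= 2 * q ^ m)%N.
Proof.
elim: m => [|m IH]; first by rewrite big_geq.
rewrite big_nat_recr //= mul2n -addnn leq_add2r (leq_trans IH) // expnS.
by rewrite leq_mul2r card_field_gt1 orbT.
Qed.

Lemma sum_pdeg_le m : (m <= N)%N ->
  (\sum_(i : prime | pdeg i < m.+1) pdeg i <= \sum_(1 <= e < m.+1) q ^ e)%N.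
Proof.
elim: m => [|m IH] mN.
  by rewrite [leqRHS]big_geq // big_pred0 // => i; rewrite ltnS leqNgt pdeg_gt0.
rewrite big_nat_recr //= (bigID (fun i => pdeg i < m.+1)%N) /=; apply: leq_add.
  apply: leq_trans (IH (ltnW mN)); rewrite (eq_bigl (fun i => pdeg i < m.+1)%N) //.
  by move=> i; apply: andb_idl => lt; apply: ltn_trans lt _.
have := @nprime_le m.+1; rewrite mN => /(_ isT); apply: leq_trans.
rewrite mulnC /nprime -sum_nat_const; apply: eq_leq.
rewrite [RHS](eq_bigl (fun i : prime => (pdeg i < m.+2) && ~~ (pdeg i < m.+1)))%N.
  by apply: eq_bigr => i; rewrite ltnS -leqNgt -eqn_leq => /eqP.
by move=> i; rewrite inE ltnS -leqNgt -eqn_leq.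
Qed.

(** A proper prime power of degree [d] comes from an irreducible of degree at most [d / 2], with
    only one possible exponent. Their total degree is bounded by a geometric sum, whence the factor
    [2]. *)
Lemma nprime_ge d : (0 < d <= N)%N -> (q ^ d <= d * nprime d + 2 * q ^ d./2)%N.
Proof.
move=> dN; have [d0 dleN] := andP dN; rewrite -prime_power_countE //.
have N0 : (0 < N)%N by apply: leq_trans dleN.
have -> : (d * nprime d = \sum_(i : prime) if pdeg i == d then pdeg i else 0)%N.
  rewrite mulnC /nprime -sum_nat_const big_mkcond /=.
  by apply: eq_bigr => i _; rewrite inE; case: eqP => // ->.
apply: (@leq_trans (\sum_(i : prime) (if pdeg i == d then pdeg i else 0) +
   \sum_(i : prime) if (pdeg i < d./2.+1)%N then pdeg i else 0)%N).
  rewrite -big_split /=; apply: leq_sum => i _.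
  have [/existsP[k /eqP kE]|none] := boolP [exists k : 'I_N, k.+1 * pdeg i == d]%N; last first.
    by rewrite big1 // => k _; move: none; rewrite negb_exists => /forallP/(_ k)/negbTE ->.
  rewrite (bigD1 k) //= kE eqxx big1 ?addn0 => [|l lk]; last first.
    rewrite -kE eqn_pmul2r ?pdeg_gt0 // eqSS.
    by move: lk; rewrite -val_eqE /= => /negbTE ->.
  have [k0|k0] := posnP k; first by rewrite -kE k0 mul1n eqxx leq_addr.
  suff -> : (pdeg i < d./2.+1)%N by rewrite leq_addl.
  rewrite ltnS -kE; apply: (@leq_trans (2 * pdeg i)./2); first by rewrite mul2n doubleK.
  by rewrite half_leq // leq_mul2r ltnS k0 orbT.
rewrite leq_add2l; apply: leq_trans (sum_expn_le _); rewrite -big_mkcond.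
by apply: sum_pdeg_le; apply: leq_trans dleN; rewrite -divn2 leq_div.
Qed.

End PrimeCounting.

(** * Mertens' estimates for sums of [q ^ (- deg p)] *)

Section Mertens.
Variables (R : realType) (F : finFieldType) (N : nat).
Local Notation q := (#|F|).
Local Notation prime := (@prime_poly F N).

Definition psum (Q : {set prime}) : R := \sum_(i in Q) (q%:R^-1) ^+ pdeg i.
Definition prime_range D y : {set prime} := [set i | (D < pdeg i <= y)%N].

Lemma psum_ge0 Q : 0 <= psum Q.
Proof. by apply: sumr_ge0 => i _; rewrite exprn_ge0 // invr_ge0 ler0n. Qed.

Lemma psum_range0 D : psum (prime_range D D) = 0.
Proof. by apply: big_pred0 => i; rewrite inE; case: ltnP => // ?; rewrite leqNgt. Qed.

Lemma psum_rangeS D y : (D <= y)%N ->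
  psum (prime_range D y.+1) =
    psum (prime_range D y) + (@nprime F N y.+1)%:R / q%:R ^+ y.+1.
Proof.
move=> Dy; rewrite /psum (bigID (fun i => pdeg i <= y)%N) /=; congr (_ + _).
  apply: eq_bigl => i; rewrite !inE -andbA; congr (_ && _).
  by apply: andb_idl => /leqW.
rewrite (eq_bigl (fun i => i \in [set i : prime | pdeg i == y.+1]%SET)) => [|i].
  rewrite (eq_bigr (fun=> q%:R^-1 ^+ y.+1)); last first.
    by move=> i; rewrite inE => /eqP ->.
  by rewrite sumr_const -[_ *+ _]mulr_natl exprVn.
rewrite !inE -ltnNge -andbA -eqn_leq eq_sym; apply: andb_idl => /eqP <-.
by rewrite ltnS.
Qed.

Let q_ge2 : (2 : R) <= q%:R.
Proof. by rewrite ler_nat card_field_gt1. Qed.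

Let q_gt0 : (0 : R) < q%:R.
Proof. by apply: lt_le_trans q_ge2. Qed.

(** Degree [y + 1] contributes at most [1 / (y + 1)], and [exp (1 / (y + 1)) <= (y + 1) / y], so the
    bound telescopes with no constant. *)
Lemma exp_psum_le D y : (0 < D <= y)%N -> (y <= N)%N ->
  expR (psum (prime_range D y)) <= y%:R / D%:R.
Proof.
move=> /andP[D0]; have D0R : (D%:R : R) != 0 by rewrite pnatr_eq0 -lt0n.
elim: y => [|y IH]; first by rewrite leqn0 => /eqP D1; rewrite D1 in D0.
rewrite leq_eqVlt => /orP[/eqP <-|]; first by rewrite psum_range0 expR0 divff.
rewrite ltnS => Dy yN; rewrite psum_rangeS // expRD.
have y0 : (0 : R) < y%:R by rewrite ltr0n (leq_trans D0).
have y10 : (0 : R) < y.+1%:R by rewrite ltr0n.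
have -> : y.+1%:R / D%:R = y%:R / D%:R * (y.+1%:R / y%:R) :> R.
  by rewrite [RHS]mulrC mulrA divfK ?gt_eqF.
apply: ler_pM; rewrite ?expR_ge0 //; first by apply: IH => //; apply: ltnW.
have le : (@nprime F N y.+1)%:R / q%:R ^+ y.+1 <= y.+1%:R^-1 :> R.
  rewrite ler_pdivrMr ?exprn_gt0 // ler_pdivlMl // -natrX -natrM ler_nat.
  exact: nprime_le.
apply: (le_trans (_ : _ <= expR y.+1%:R^-1)); first by rewrite ler_expR.
have := expR_ge1Dx (- y.+1%:R^-1 : R); rewrite expRN.
have -> : 1 - y.+1%:R^-1 = (y.+1%:R / y%:R)^-1 :> R.
  rewrite invf_div -[y in y%:R / _](addnK 1) addn1 natrB // mulrBl mul1r.
  by rewrite divff ?gt_eqF.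
by rewrite lef_pV2 ?posrE ?expR_gt0 ?divr_gt0.
Qed.

(** [d - d./2] is half of [d] rounded up, and [q >= 2]; [3 / 4] is a convenient rational above
    [1 / sqrt 2]. *)
Lemma inv_pow_half d : (q%:R ^- (d - d./2) : R) <= (3 / 4) ^+ d.
Proof.
apply: (@le_trans _ _ ((1 / 2 : R) ^+ (d - d./2))).
  rewrite -exprVn; apply: lerXn2r; rewrite ?nnegrE ?divr_ge0 ?invr_ge0 ?ler0n //.
  by rewrite mul1r lef_pV2 ?posrE.
elim/ltn_ind: d => -[|[|d]] IH; first by rewrite !expr0.
  by rewrite !expr1; lra.
rewrite /= (_ : d.+2 - d./2.+1 = (d - d./2).+1)%N; last first.
  by rewrite subSS subSn // -divn2 leq_div.
rewrite exprS !exprS mulrA; apply: ler_pM; rewrite ?exprn_ge0 ?divr_ge0 //.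
  by lra.
exact: IH.
Qed.

(** The lower bound for [nprime] loses at most [2 (3/4)^j] at degree [j]. The losses over all
    [j >= 1] sum to [6], and the induction carries their partial sum [6 (1 - (3/4)^y)]. *)
Lemma exp_psum_ge D y : (D <= y <= N)%N ->
  y.+1%:R / D.+1%:R * expR (- 6) <= expR (psum (prime_range D y)).
Proof.
move=> /andP[Dy yN]; apply: (@le_trans _ _ (y.+1%:R / D.+1%:R *
    expR (- (6 * (1 - (3 / 4) ^+ y))))).
  rewrite ler_pM2l ?divr_gt0 ?ltr0n // ler_expR lerN2.
  by rewrite ler_piMr // gerBl exprn_ge0 //; lra.
elim: y Dy yN => [|y IH] Dy yN.
  move: Dy; rewrite leqn0 => /eqP ->; rewrite divff ?pnatr_eq0 // mul1r.
  by rewrite ler_expR psum_range0 expr0 subrr mulr0 oppr0.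
move: Dy; rewrite leq_eqVlt => /orP[/eqP ->|].
  rewrite divff ?pnatr_eq0 // mul1r psum_range0 expR0 -[leRHS]expR0 ler_expR.
  by rewrite oppr_le0 mulr_ge0 // subr_ge0 exprn_ile1 //; lra.
rewrite ltnS => Dy; rewrite psum_rangeS // expRD.
have -> : y.+2%:R / D.+1%:R = y.+1%:R / D.+1%:R * (y.+2%:R / y.+1%:R) :> R.
  by rewrite [RHS]mulrC mulrA divfK ?pnatr_eq0.
have -> : expR (- (6 * (1 - (3 / 4) ^+ y.+1))) =
    expR (- (6 * (1 - (3 / 4) ^+ y))) * expR (- (2 * (3 / 4) ^+ y.+1)) :> R.
  by rewrite -expRD; congr expR; rewrite !exprS; field.
rewrite mulrACA; apply: ler_pM; rewrite ?mulr_ge0 ?divr_ge0 ?expR_ge0 ?ler0n //.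
  by apply: IH => //; apply: ltnW.
have y0 : (0 : R) < y.+1%:R by rewrite ltr0n.
have qy0 : (0 : R) < q%:R ^+ y.+1 by rewrite exprn_gt0.
have half : (y.+1./2 <= y.+1)%N by rewrite -divn2 leq_div.
have le : y.+1%:R^-1 - 2 * (3 / 4) ^+ y.+1 <=
    (@nprime F N y.+1)%:R / q%:R ^+ y.+1 :> R.
  have := @nprime_ge F N y.+1; rewrite ltnS yN => /(_ isT).
  rewrite -(ler_nat R) natrD !natrM !natrX => le.
  apply: (@le_trans _ _ (y.+1%:R^-1 - 2 * q%:R ^- (y.+1 - y.+1./2))).
    by rewrite lerB // ler_pM2l // inv_pow_half.
  have y1 : y.+1%:R^-1 <= 1 :> R by rewrite invf_le1 // ler1n.
  apply: (@le_trans _ _ (y.+1%:R^-1 * (1 - 2 * q%:R ^- (y.+1 - y.+1./2)))).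
    rewrite mulrBr mulr1 lerB // ler_piMl // mulr_ge0 // invr_ge0 exprn_ge0 //.
  rewrite mulrC ler_pdivrMr // mulrAC ler_pdivlMr // mulrBl mul1r.
  rewrite -mulrA; have -> : q%:R ^- (y.+1 - y.+1./2) * q%:R ^+ y.+1 = q%:R ^+ y.+1./2 :> R.
    by rewrite -[X in _ * _ ^+ X](subnK half) exprD mulKf // expf_neq0 ?gt_eqF.
  by rewrite lerBlDr mulrC.
apply: (@le_trans _ _ (expR y.+1%:R^-1 * expR (- (2 * (3 / 4) ^+ y.+1)))).
  rewrite ler_pM2r ?expR_gt0 //; apply: le_trans (expR_ge1Dx _).
  by rewrite -[y.+2]addn1 natrD mulrDl divff ?gt_eqF // mul1r.
by rewrite -expRD ler_expR.
Qed.

End Mertens.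

(** * Bonferroni's inequalities and the mean of [2 ^ (- omega)] *)

Section Sieve.
Variables (R : realType) (F : finFieldType) (N : nat).
Local Notation q := (#|F|).
Local Notation prime := (@prime_poly F N).
Local Notation P := {poly_N.+1 F}.
Implicit Types (Q T : {set prime}) (K G : {poly F}) (H y : nat).

Definition prime_divisors Q G : {set prime} :=
  [set i in Q | (ppoly i %| G)%R].

Definition omega Q G := #|prime_divisors Q G|.

Lemma coprimep_prod_ppoly i (s : seq prime) : i \notin s ->
  coprimep (ppoly i) (\prod_(j <- s) ppoly j).
Proof.
elim: s => [|j s IH]; first by rewrite big_nil coprimep1.
rewrite inE negb_or => /andP[ij iS].
by rewrite big_cons coprimepMr ppoly_coprime ?IH.
Qed.

Lemma dvdp_prod_ppoly Q T G : T \subset Q ->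
  (\prod_(i in T) ppoly i %| G) = (T \subset prime_divisors Q G).
Proof.
move=> TQ; apply/idP/fintype.subsetP => [TG i iT|TG].
  by rewrite inE (fintype.subsetP TQ) // (dvdp_trans _ TG) // (bigD1 i) //= dvdp_mulIl.
have {TG} TG i : i \in enum T -> ppoly i %| G.
  by rewrite mem_enum => /TG; rewrite inE => /andP[].
rewrite -big_enum /=; elim: (enum T) (enum_uniq T) TG => [|i s IH].
  by rewrite big_nil dvd1p.
move=> /= /andP[iS sU] sG; rewrite big_cons Gauss_dvdp ?coprimep_prod_ppoly //.
by rewrite sG ?mem_head //= IH // => j js; apply: sG; rewrite inE js orbT.
Qed.

Lemma size_prod_ppoly T :
  size (\prod_(i in T) ppoly i) = (\sum_(i in T) pdeg i).+1.
Proof.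
rewrite size_prod => [|i _]; last exact: ppoly_neq0.
rewrite -sum1_card (eq_bigr (fun i => pdeg i + 1)%N) => [|i _].
  by rewrite big_split /= -addSn addnK.
by rewrite size_ppoly addn1.
Qed.

Lemma card_ball_dvd_prod Q T K H : T \subset Q ->
  (size K <= N.+1)%N -> (H <= N.+1)%N -> (\sum_(i in T) pdeg i <= H)%N ->
  (#|[set G in ball_poly N K H | T \subset prime_divisors Q G]|%:R : R) =
    q%:R ^+ H * \prod_(i in T) q%:R^-1 ^+ pdeg i.
Proof.
move=> TQ sK HN TH.
have -> : #|[set G in ball_poly N K H | T \subset prime_divisors Q G]| =
    (q ^ (H - \sum_(i in T) pdeg i))%N.
  rewrite -(@card_multiples_in_ball _ N K _ _ _ _ (size_prod_ppoly T)) //.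
    by congr #|pred_of_set _|; apply/setP => G; rewrite !inE (dvdp_prod_ppoly _ TQ).
  by apply: monic_prod => i _; exact: ppoly_monic.
rewrite natrX expfB_cond; last first.
  by rewrite pnatr_eq0 gtn_eqF ?card_field_gt0.
congr (_ * _); rewrite -prodrXr -prodfV; apply: eq_bigr => i _.
by rewrite exprVn.
Qed.

(** By Pascal's rule the signed error at [(n + 1, J + 1)] is the one at [(n, J + 1)] plus [x] times
    the one at [(n, J)]. *)
Lemma bonferroni (x : R) n J : 0 <= x <= 1 ->
  0 <= (-1) ^+ J * (\sum_(j < J.+1) 'C(n, j)%:R * (- x) ^+ j - (1 - x) ^+ n).
Proof.
move=> x01; elim: n J => [|n IH] J.
  rewrite expr0 (bigD1 ord0) //= bin0 expr0 mulr1 big1 ?addr0 ?subrr ?mulr0 //.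
  by move=> j j0; rewrite bin0n (negbTE (_ : (j : nat) != 0)%N) ?mul0r.
case: J => [|J].
  rewrite big_ord1 bin0 !expr0 !mul1r subr_ge0 exprn_ile1 //; lra.
have -> : \sum_(j < J.+2) 'C(n.+1, j)%:R * (- x) ^+ j =
  \sum_(j < J.+2) 'C(n, j)%:R * (- x) ^+ j -
    x * \sum_(j < J.+1) 'C(n, j)%:R * (- x) ^+ j.
  rewrite big_ord_recl [in RHS]big_ord_recl !bin0 -addrA; congr (_ + _).
  rewrite mulr_sumr -sumrB; apply: eq_bigr => j _ /=.
  by rewrite /bump /= add1n binS natrD mulrDl exprS; ring.
rewrite [X in _ * (_ - X)]exprS; set a := \sum_(_ < J.+2) _; set b := \sum_(_ < _) _.
have := IH J.+1; have := IH J; rewrite -/a -/b exprS.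
move: ((-1) ^+ J) ((1 - x) ^+ n) (a) (b) => s e {}a {}b h1 h2.
have -> : -1 * s * (a - x * b - (1 - x) * e) = -1 * s * (a - e) + x * (s * (b - e)).
  by ring.
by rewrite addr_ge0 // mulr_ge0 //; case/andP: x01.
Qed.

Lemma prod_one_plus Q (x : prime -> R) :
  \prod_(i in Q) (1 + x i) = \sum_(T : {set prime} | T \subset Q) \prod_(i in T) x i.
Proof.
transitivity (\prod_i ((if i \in Q then x i else 0) + 1)).
  rewrite big_mkcond; apply: eq_bigr => i _.
  by case: ifP; rewrite ?add0r // addrC.
rewrite bigA_distr big_mkcond /=; rewrite [RHS]big_mkcond /=; apply: eq_bigr => T _.
case: ifPn => TQ.
  rewrite [RHS]big_mkcond /=; apply: eq_bigr => i _.
  by case: ifPn => // iT; rewrite (fintype.subsetP TQ).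
have /subsetPn[i iT iQ] := TQ.
by rewrite (bigD1 i) //= iT (negbTE iQ) mul0r.
Qed.

Lemma half_pow_omega_le Q G J : ~~ odd J ->
  (2 : R)^-1 ^+ omega Q G <=
    \sum_(T : {set prime} | (T \subset prime_divisors Q G) && (#|T| <= J)%N)
      (- 2^-1) ^+ #|T|.
Proof.
move=> evJ; have := @bonferroni 2^-1 (omega Q G) J.
rewrite -signr_odd (negbTE evJ) expr0 mul1r subr_ge0 => /(_ _)/le_trans.
have -> : 1 - 2^-1 = 2^-1 :> R by lra.
apply; first by apply/andP; split; lra.
rewrite [leRHS](partition_big (fun T : {set prime} => inord #|T| : 'I_J.+1) xpredT) //=.
apply: ler_sum => j _.
rewrite -cards_draws -sum1_card natr_sum mulr_suml.
rewrite [leLHS](eq_bigl (fun T : {set prime} => [&& T \subset prime_divisors Q G,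
    (#|T| <= J)%N & (inord #|T| == j :> 'I_J.+1)])) => [|T].
  rewrite [leRHS](eq_bigl (fun T : {set prime} => [&& T \subset prime_divisors Q G,
    (#|T| <= J)%N & (inord #|T| == j :> 'I_J.+1)])) => [|T]; last by rewrite andbA.
  apply: ler_sum => T /and3P[_ TJ /eqP <-].
  by rewrite mul1r inordK.
rewrite inE; congr (_ && _); apply/eqP/andP => [TJ|[TJ /eqP <-]]; last by rewrite inordK.
by rewrite -ltnS TJ ltn_ord -TJ -val_eqE /= inordK // TJ.
Qed.

(** Expanding [(1 - 1/2) ^ omega] and stopping at an even order [J] gives an upper bound. Since
    [J * y <= H], the multiples of every product involved are counted exactly. Completing the sum
    over [T] yields the product of the [1 - q ^ (- deg p) / 2], and the tail gains
    [2 ^ (- #|T|) <= 2 ^ (- J)]. *)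
Lemma sum_half_pow_omega Q K H J y : ~~ odd J -> (J * y <= H)%N ->
  (forall i, i \in Q -> (pdeg i <= y)%N) ->
  (size K <= N.+1)%N -> (H <= N.+1)%N ->
  \sum_(G in ball_poly N K H) (2 : R)^-1 ^+ omega Q G <=
    q%:R ^+ H * (expR (- (psum R Q / 2)) + 2^-1 ^+ J * expR (psum R Q)).
Proof.
move=> evJ JyH Qy sK HN; set x := fun i : prime => (q%:R : R)^-1 ^+ pdeg i.
have x01 i : 0 <= x i <= 1.
  rewrite exprn_ge0 ?invr_ge0 //= exprn_ile1 // ?invr_ge0 //.
  by rewrite invf_le1 ?ltr0n ?ler1n card_field_gt0.
apply: (@le_trans _ _ (\sum_(G in ball_poly N K H)
    \sum_(T : {set prime} | (T \subset Q) && (#|T| <= J)%N)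
      (T \subset prime_divisors Q G)%:R * (- 2^-1) ^+ #|T|)).
  apply: ler_sum => G _; apply: le_trans (half_pow_omega_le _ _ evJ) _.
  rewrite le_eqVlt; apply/orP; left; apply/eqP.
  rewrite [RHS](bigID (fun T : {set prime} => T \subset prime_divisors Q G)) /=.
  rewrite [X in _ + X]big1 ?addr0 => [|T /andP[_ /negbTE ->]]; last by rewrite mul0r.
  rewrite (eq_bigl (fun T : {set prime} => (T \subset Q) && (#|T| <= J)%N &&
    (T \subset prime_divisors Q G))); first by apply: eq_bigr => T /andP[_ ->]; rewrite mul1r.
  move=> T; rewrite -andbA andbC [RHS]andbC -!andbA; congr (_ && _).
  symmetry; apply: andb_idr => TG.
  by apply: (fintype.subset_trans TG); apply/fintype.subsetP => i; rewrite inE => /andP[].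
rewrite exchange_big /= (eq_bigr (fun T : {set prime} =>
    q%:R ^+ H * \prod_(i in T) (- (x i / 2)))) => [|T /andP[TQ TJ]]; last first.
  rewrite -mulr_suml (_ : \sum_(G in _) _ =
      #|[set G in ball_poly N K H | T \subset prime_divisors Q G]|%:R); last first.
    rewrite -sum1_card natr_sum [RHS](eq_bigl (fun G : {poly_N.+1 F} =>
      (G \in ball_poly N K H) && (T \subset prime_divisors Q G))) => [|G]; last by rewrite inE.
    by rewrite big_mkcondr /=; apply: eq_bigr => G _; case: ifP.
  rewrite (card_ball_dvd_prod TQ) //; last first.
    apply: (@leq_trans (\sum_(i in T) y)).
      by apply: leq_sum => i /(fintype.subsetP TQ)/Qy.
    by rewrite sum_nat_const (leq_trans _ JyH) // leq_mul2r TJ orbT.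
  rewrite -mulrA; congr (_ * _); rewrite -prodr_const -big_split /=.
  by apply: eq_bigr => i _; rewrite mulrN.
rewrite -mulr_sumr ler_wpM2l ?exprn_ge0 //.
have -> : \sum_(T : {set prime} | (T \subset Q) && (#|T| <= J)%N) \prod_(i in T) (- (x i / 2)) =
  \prod_(i in Q) (1 + - (x i / 2)) -
  \sum_(T : {set prime} | (T \subset Q) && ~~ (#|T| <= J)%N) \prod_(i in T) (- (x i / 2)).
  by rewrite prod_one_plus [X in _ = X - _](bigID (fun T : {set prime} => #|T| <= J)%N) /= addrK.
apply: lerD.
  rewrite /psum mulr_suml -sumrN expR_sum; apply: ler_prod => i _.
  rewrite (le_trans _ (expR_ge1Dx _)) ?andbT; last by [].
  by have := x01 i; lra.
apply: (le_trans (ler_norm _)); rewrite normrN; apply: (le_trans (ler_norm_sum _ _ _)).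
apply: (@le_trans _ _ (2^-1 ^+ J * \prod_(i in Q) (1 + x i))); last first.
  rewrite ler_wpM2l ?exprn_ge0 ?invr_ge0 // /psum expR_sum.
  apply: ler_prod => i _; rewrite expR_ge1Dx andbT.
  by have /andP[x0 _] := x01 i; rewrite addr_ge0.
rewrite prod_one_plus mulr_sumr [leLHS]big_mkcondr /=.
apply: ler_sum => T _; case: ifPn => [TJ|_]; last first.
  rewrite mulr_ge0 ?exprn_ge0 ?invr_ge0 //.
  by apply: prodr_ge0 => i _; have /andP[] := x01 i.
rewrite normr_prod (eq_bigr (fun i => 2^-1 * x i)) => [|i _]; last first.
  have /andP[x0 _] := x01 i.
  by rewrite normrN ger0_norm ?divr_ge0 // mulrC.
rewrite big_split /= prodr_const ler_wpM2r //.
  by apply: prodr_ge0 => i _; have /andP[] := x01 i.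
by rewrite ler_wiXn2l ?invr_ge0 ?invf_le1 ?ler1n //; apply: ltnW; rewrite ltnNge.
Qed.

End Sieve.

(** * Turán's variance bound for [omega] *)

Section OmegaVariance.
Variables (R : realType) (F : finFieldType) (N : nat).
Local Notation q := (#|F|).
Local Notation prime := (@prime_poly F N).
Variables (Q : {set prime}) (K : {poly F}) (H y : nat).
Hypotheses (sK : (size K <= N.+1)%N) (HN : (H <= N.+1)%N) (yH : (2 * y <= H)%N)
  (Qy : forall i, i \in Q -> (pdeg i <= y)%N).

Let x (i : prime) : R := q%:R^-1 ^+ pdeg i.
Let b (i : prime) (G : {poly F}) : R := (ppoly i %| G)%R%:R.

Lemma omega_sum G : (omega Q G)%:R = \sum_(i in Q) b i G.
Proof.
rewrite /omega -sum1_card natr_sum (eq_bigl (fun i => (i \in Q) && (ppoly i %| G))).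
  by rewrite big_mkcondr; apply: eq_bigr => i _; rewrite /b; case: (_ %| _).
by move=> i; rewrite inE.
Qed.

Lemma sum_subset_divisors (T : {set prime}) : T \subset Q ->
  (\sum_(i in T) pdeg i <= H)%N ->
  \sum_(G in ball_poly N K H) (T \subset prime_divisors Q G)%:R =
    q%:R ^+ H * \prod_(i in T) x i.
Proof.
move=> TQ TH; rewrite -(card_ball_dvd_prod R TQ sK HN TH) -sum1_card natr_sum.
rewrite [RHS](eq_bigl (fun G : {poly_N.+1 F} =>
  (G \in ball_poly N K H) && (T \subset prime_divisors Q G))) => [|G]; last by rewrite inE.
by rewrite big_mkcondr /=; apply: eq_bigr => G _; case: ifP.
Qed.

Lemma sum_dvd_ball i : i \in Q ->
  \sum_(G in ball_poly N K H) b i G = q%:R ^+ H * x i.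
Proof.
move=> iQ; rewrite (_ : x i = \prod_(k in [set i]%SET) x k); last by rewrite big_set1.
rewrite -sum_subset_divisors ?finset.sub1set //.
  by apply: eq_bigr => G _; rewrite finset.sub1set inE iQ.
by rewrite big_set1 (leq_trans (Qy iQ)) // (leq_trans _ yH) // leq_pmull.
Qed.

Lemma sum_dvd_pair_ball i j : i \in Q -> j \in Q -> i != j ->
  \sum_(G in ball_poly N K H) b i G * b j G = q%:R ^+ H * (x i * x j).
Proof.
move=> iQ jQ ij; rewrite (_ : x i * x j = \prod_(k in [set i; j]%SET) x k).
  rewrite -sum_subset_divisors; last first.
  - by rewrite big_setU1 ?inE // big_set1 (leq_trans _ yH) // mul2n -addnn leq_add ?Qy.
  - by rewrite finset.subUset !finset.sub1set iQ.
  apply: eq_bigr => G _; rewrite finset.subUset !finset.sub1set !inE iQ jQ /= /b -natrM.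
  by rewrite mulnb.
by rewrite big_setU1 ?inE // big_set1.
Qed.

(** Since [2 y <= H], divisibility by two distinct irreducibles of [Q] is exactly uncorrelated on
    the ball, so only the diagonal survives. *)
Lemma omega_variance :
  \sum_(G in ball_poly N K H) ((omega Q G)%:R - psum R Q) ^+ 2 <=
    q%:R ^+ H * psum R Q.
Proof.
have -> : \sum_(G in ball_poly N K H) ((omega Q G)%:R - psum R Q) ^+ 2 =
    \sum_(i in Q) \sum_(j in Q) \sum_(G in ball_poly N K H)
      (b i G - x i) * (b j G - x j).
  rewrite (eq_bigr (fun G : {poly_N.+1 F} => \sum_(i in Q) \sum_(j in Q)
      (b i G - x i) * (b j G - x j))); last first.
    by move=> G _; rewrite omega_sum /psum -sumrB expr2 big_distrlr.
  by rewrite exchange_big /=; apply: eq_bigr => i _; rewrite exchange_big.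
have sx c : \sum_(G in ball_poly N K H) c = q%:R ^+ H * c :> R.
  by rewrite sumr_const card_ball_poly // -[c *+ _]mulr_natl natrX.
rewrite /psum mulr_sumr; apply: ler_sum => i iQ.
rewrite (bigD1 i) //= [X in _ + X]big1 ?addr0 => [|j /andP[jQ ji]].
  apply: (@le_trans _ _ (\sum_(G in ball_poly N K H) (b i G - 2 * x i * b i G + x i ^+ 2))).
    apply: ler_sum => G _; rewrite le_eqVlt; apply/orP; left; apply/eqP.
    have : b i G * b i G = b i G by rewrite /b -natrM mulnb andbb.
    by move: (b i G) (x i) => u v uu; rewrite mulrBl mulrBr uu; ring.
  rewrite !big_split /= sumrN -mulr_sumr sum_dvd_ball // sx.
  have q0 : 0 <= q%:R ^+ H :> R by rewrite exprn_ge0.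
  have -> : q%:R ^+ H * x i - 2 * x i * (q%:R ^+ H * x i) + q%:R ^+ H * x i ^+ 2 =
     q%:R ^+ H * x i - q%:R ^+ H * x i ^+ 2 by ring.
  by rewrite gerBl mulr_ge0 // sqr_ge0.
rewrite (eq_bigr (fun G : {poly_N.+1 F} => b i G * b j G - x j * b i G - x i * b j G + x i * x j)).
  rewrite !big_split /= !sumrN -!mulr_sumr sum_dvd_pair_ball // 1?eq_sym //.
  by rewrite !sum_dvd_ball // sx; ring.
by move=> G _; ring.
Qed.

End OmegaVariance.

Lemma size_sub_monic (F : fieldType) (A B : {poly F}) m : A \is monic -> B \is monic ->
  size A = m.+1 -> size B = m.+1 -> (size (A - B)%R <= m)%N.
Proof.
rewrite !monicE /lead_coef => /eqP Am /eqP Bm sA sB; apply/leq_sizeP => j.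
rewrite leq_eqVlt coefB => /orP[/eqP <-|mj]; last by rewrite !nth_default ?sA ?sB ?subrr.
by move: Am Bm; rewrite sA sB /= => -> ->; rewrite subrr.
Qed.

Lemma monic_gcd_factor (F : fieldType) (A B : {poly F}) : A \is monic -> B \is monic ->
  exists g a b : {poly F}, [/\ g \is monic, a \is monic & b \is monic] /\
    [/\ A = g * a, B = g * b & coprimep a b].
Proof.
move=> Am Bm; set e := gcdp A B; have e0 : e != 0.
  by rewrite gcdp_eq0 negb_and (monic_neq0 Am).
have le0 : lead_coef e != 0 by rewrite lead_coef_eq0.
set g := (lead_coef e)^-1 *: e.
have gm : g \is monic by rewrite monicE lead_coefZ mulVf.
have gA : g %| A by rewrite dvdpZl ?invr_neq0 // dvdp_gcdl.
have gB : g %| B by rewrite dvdpZl ?invr_neq0 // dvdp_gcdr.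
have AE : A = g * (A %/ g) by rewrite mulrC divpK.
have BE : B = g * (B %/ g) by rewrite mulrC divpK.
exists g, (A %/ g), (B %/ g); split; split => //.
- by rewrite -(monicMl _ gm) -AE.
- by rewrite -(monicMl _ gm) -BE.
have : gcdp A B %= g * gcdp (A %/ g) (B %/ g).
  by rewrite {1}AE {1}BE eqp_sym; exact: mulp_gcdr.
have ge : g %= e by rewrite eqp_scale ?invr_neq0.
move=> /(eqp_trans ge); rewrite -{1}[g]mulr1 eqp_mul2l ?monic_neq0 //.
by rewrite eqp_sym gcdp_eqp1.
Qed.

(** * Counting the nondiagonal solutions of [F1 F2 = G1 G2] *)

Section Energy.
Variables (R : realType) (F : finFieldType) (N H : nat) (K : {poly F}).
Local Notation q := (#|F|).
Local Notation P := {poly_N.+1 F}.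
Hypotheses (Km : K \is monic) (sK : size K = N.+1) (HN : (H <= N)%N).
Variables (S : {set P}) (w : {poly F} -> R) (Lam : R) (beta : nat -> R).
Hypotheses (SK : S \subset ball_poly N K H) (w0 : forall G, 0 <= w G)
  (beta0 : forall m, 0 <= beta m)
  (wS : forall (G : P) (g a : {poly F}), G \in S -> polyn G = g * a -> 1 <= Lam * (w g * w a))
  (wb : forall m K' H', K' \is monic -> size K' = m.+1 ->
    (m <= H' + (N - H))%N -> (H' <= m)%N -> (m < H)%N -> (N - m < H)%N ->
    \sum_(G in ball_poly N K' H') w (polyn G) <= beta m * q%:R ^+ H').

(** The intervals come from differences of elements of [S]: [a (k - g) = G2 - F1] places [k] near
    [g], [g (b - a) = G1 - F1] places [b] near [a], and [g a = F1] places [a] near [K %/ g]. The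
    degrees are [m] for [g], [k] and [N - m] for [a], [b]. *)
Let tuples m : {set (P * P) * (P * P)} :=
  [set t | [&& t.1.1 \in ball_poly N 'X^m m,
     t.1.2 \in ball_poly N (polyn t.1.1) (H - (N - m)),
     t.2.1 \in ball_poly N (K %/ polyn t.1.1) (H - m) &
     t.2.2 \in ball_poly N (polyn t.2.1) (H - m)]].

(* [F1 = g a, F2 = k b, G1 = g b, G2 = k a], where [g = gcd (F1, G1)]. *)
Let quad (t : (P * P) * (P * P)) : (P * P) * (P * P) :=
  ((npolyp N.+1 (polyn t.1.1 * polyn t.2.1), npolyp N.+1 (polyn t.1.2 * polyn t.2.2)),
   (npolyp N.+1 (polyn t.1.1 * polyn t.2.2), npolyp N.+1 (polyn t.1.2 * polyn t.2.1))).

Let quad_weight (t : (P * P) * (P * P)) : R :=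
  w (polyn t.1.1) * w (polyn t.1.2) * w (polyn t.2.1) * w (polyn t.2.2).

Variable Z : {set (P * P) * (P * P)}.
Hypothesis Zspec : forall z, z \in Z ->
  [&& [&& z.1.1 \in S, z.1.2 \in S, z.2.1 \in S & z.2.2 \in S],
     z.1.1 != z.2.1, z.1.1 != z.2.2 &
     polyn z.1.1 * polyn z.1.2 == polyn z.2.1 * polyn z.2.2].

Let S_monic G : G \in S -> polyn G \is monic /\ size (polyn G) = N.+1.
Proof.
move=> /(fintype.subsetP SK)/(ball_monic Km); rewrite sK; apply.
by rewrite ltnS.
Qed.

Let size_mul_monic (A B : {poly F}) : A \is monic -> B != 0 ->
  size (A * B) = ((size A).-1 + size B)%N.
Proof.
move=> Am B0; rewrite size_monicM //.
by have := monic_neq0 Am; rewrite -size_poly_gt0; case: (size A).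
Qed.

Let size_subS (G G' : P) : G \in S -> G' \in S ->
  (size (polyn G - polyn G')%R <= H)%N.
Proof.
move=> /(fintype.subsetP SK) + /(fintype.subsetP SK); rewrite !inE => GK GK'.
have -> : polyn G - polyn G' = (polyn G - K) - (polyn G' - K) by ring.
by rewrite (leq_trans (size_polyD _ _)) // geq_max size_polyN GK.
Qed.

(** Coprimality of [a] and [b] forces [a] to divide [G2], which defines [k]. The solution being
    nondiagonal, [b - a] and [k - g] are nonzero, and their multiples of size at most [H] give
    [m < H] and [N - m < H]. *)
Let quad_surj z : z \in Z -> exists m : 'I_H, exists t,
  [/\ (N - m < H)%N, t \in tuples m, quad t = z & 1 <= Lam ^+ 2 * quad_weight t].
Proof.
case: z => -[F1 F2] [G1 G2] /Zspec /= /and4P[/and4P[F1S F2S G1S G2S] n1 n2 /eqP E].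
have [F1m F1s] := S_monic F1S; have [G1m G1s] := S_monic G1S.
have [F2m F2s] := S_monic F2S; have [G2m G2s] := S_monic G2S.
have [g [a [b [[gm am bm] [F1E G1E ab]]]]] := monic_gcd_factor F1m G1m.
have [g0 a0 b0] : [/\ g != 0, a != 0 & b != 0] by rewrite !monic_neq0.
have E2 : a * polyn F2 = b * polyn G2.
  by apply: (mulfI g0); rewrite !mulrA -F1E -G1E.
have aG2 : a %| polyn G2 by rewrite -(@Gauss_dvdpr _ _ b) // -E2 dvdp_mulIl.
pose k := polyn G2 %/ a; have G2E : polyn G2 = k * a by rewrite divpK.
have km : k \is monic by rewrite -(monicMr _ am) -G2E.
have F2E : polyn F2 = k * b by apply: (mulfI a0); rewrite E2 G2E; ring.
have k0 := monic_neq0 km.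
have [m gs] : exists m, size g = m.+1.
  by exists (size g).-1; rewrite prednK // size_poly_gt0.
have sa : (m + size a = N.+1)%N by rewrite -F1s F1E size_mul_monic // gs.
have sb : (m + size b = N.+1)%N by rewrite -G1s G1E size_mul_monic // gs.
have a_gt0 : (0 < size a)%N by rewrite size_poly_gt0.
have sk : (size k + (size a).-1 = N.+1)%N.
  by rewrite -G2s G2E mulrC size_mul_monic // addnC.
have abn : b - a != 0.
  rewrite subr_eq0; apply: contra n1 => /eqP ba.
  by apply/eqP/val_inj; rewrite /= F1E G1E ba.
have kgn : k - g != 0.
  rewrite subr_eq0; apply: contra n2 => /eqP kg.
  by apply/eqP/val_inj; rewrite /= F1E G2E kg.
have sba : (m + size (b - a)%R <= H)%N.
  by have := size_subS G1S F1S; rewrite F1E G1E -mulrBr size_mul_monic // gs.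
have skg : ((N - m) + size (k - g)%R <= H)%N.
  have := size_subS G2S F1S; rewrite F1E G2E (mulrC k) (mulrC g) -mulrBr size_mul_monic //.
  suff -> : (size a).-1 = (N - m)%N by [].
  by clear -sa a_gt0; move: (size a) sa a_gt0 => s sa a_gt0; lia.
have ba_gt0 : (0 < size (b - a)%R)%N by rewrite size_poly_gt0.
have kg_gt0 : (0 < size (k - g)%R)%N by rewrite size_poly_gt0.
have mH : (m < H)%N by apply: leq_trans sba; rewrite -addn1 leq_add2l.
have NmH : (N - m < H)%N by apply: leq_trans skg; rewrite -addn1 leq_add2l.
have [gN aN bN kN] : [/\ (size g <= N.+1)%N, (size a <= N.+1)%N,
    (size b <= N.+1)%N & (size k <= N.+1)%N].
  split; first by rewrite gs ltnS ltnW // (leq_trans mH).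
  - by rewrite -sa leq_addl.
  - by rewrite -sb leq_addl.
  - by rewrite -sk leq_addr.
pose t : (P * P) * (P * P) := ((npolyp N.+1 g, npolyp N.+1 k), (npolyp N.+1 a, npolyp N.+1 b)).
exists (Ordinal mH), t; split => //=.
- rewrite !inE /= !npolypK //; apply/and4P; split.
  + by apply: size_sub_monic; rewrite ?monicXn ?size_polyXn.
  + by rewrite leq_subRL // ltnW.
  + have KE := divp_eq K g.
    have [->|ne0] := eqVneq (a - K %/ g) 0; first by rewrite size_poly0.
    have sgK : (size (K %% g)%R <= m)%N by rewrite -ltnS -gs ltn_modpN0.
    have : (size (g * (a - K %/ g))%R <= H)%N.
      have -> : g * (a - K %/ g) = (polyn F1 - K) + K %% g.
        by rewrite [X in _ - X + _]KE F1E; ring.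
      rewrite (leq_trans (size_polyD _ _)) // geq_max (leq_trans sgK (ltnW mH)) andbT.
      by have /(fintype.subsetP SK) := F1S; rewrite inE.
    by rewrite size_mul_monic // gs /= leq_subRL // ltnW.
  + by rewrite leq_subRL // ltnW.
- congr (_, _, (_, _)); apply: val_inj; rewrite /= ?npolypK ?F1E ?F2E ?G1E ?G2E //.
  + by rewrite -F1E F1s.
  + by rewrite -F2E F2s.
  + by rewrite -G1E G1s.
  + by rewrite -G2E G2s.
rewrite /quad_weight /= !npolypK //.
have -> : Lam ^+ 2 * (w g * w k * w a * w b) =
  (Lam * (w g * w a)) * (Lam * (w k * w b)) by ring.
by rewrite mulr_ege1 ?(wS F1S F1E) ?(wS F2S F2E).
Qed.

(** Each solution is the image of a tuple of weight at least [Lam ^ (- 2)]. The total weight of the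
    tuples is then summed over [b], [a], [k], [g] in this order, since the interval of each variable
    depends on those summed after it. *)
Lemma energy_bound :
  #|Z|%:R <= Lam ^+ 2 * (\sum_(m < H | (N - m < H)%N) beta m ^+ 2 * beta (N - m) ^+ 2)
    * q%:R ^+ (3 * H - N).
Proof.
have qw_ge0 t : 0 <= Lam ^+ 2 * quad_weight t.
  by rewrite mulr_ge0 ?sqr_ge0 // !mulr_ge0.
apply: (@le_trans _ _ (\sum_(z in Z) \sum_(m < H | (N - m < H)%N) \sum_(t in tuples m)
   (quad t == z)%:R * (Lam ^+ 2 * quad_weight t))).
  rewrite -sum1_card natr_sum; apply: ler_sum => z zZ.
  have [m [t [mN tm tz ge1]]] := quad_surj zZ.
  rewrite (bigD1 m) //= (bigD1 t) //= tz eqxx mul1r -addrA.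
  apply: (le_trans ge1); rewrite lerDl addr_ge0 //.
    by apply: sumr_ge0 => u _; rewrite mulr_ge0.
  by apply: sumr_ge0 => l _; apply: sumr_ge0 => u _; rewrite mulr_ge0.
rewrite exchange_big /= -mulrA mulr_suml mulr_sumr; apply: ler_sum => m mN.
rewrite exchange_big /=.
apply: (@le_trans _ _ (\sum_(t in tuples m) Lam ^+ 2 * quad_weight t)).
  apply: ler_sum => t _; rewrite -mulr_suml ler_piMl //.
  rewrite big_mkcond (bigD1 (quad t)) //= eqxx big1 ?addr0 => [|z zt].
    by case: ifP.
  by rewrite eq_sym (negbTE zt) if_same.
rewrite -mulr_sumr ler_wpM2l ?sqr_ge0 //.
have mH := ltn_ord m.
have mle : (m <= N)%N by rewrite ltnW // (leq_trans mH).
have -> : \sum_(t in tuples m) quad_weight t =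
  \sum_(g in ball_poly N 'X^m m) \sum_(k in ball_poly N (polyn g) (H - (N - m)))
  \sum_(a in ball_poly N (K %/ polyn g) (H - m))
  \sum_(b in ball_poly N (polyn a) (H - m))
     w (polyn g) * w (polyn k) * w (polyn a) * w (polyn b).
  rewrite pair_big_dep /= [RHS](eq_bigr (fun p : P * P =>
    \sum_(r : P * P | (r.1 \in ball_poly N (K %/ polyn p.1) (H - m)) &&
      (r.2 \in ball_poly N (polyn r.1) (H - m)))
      w (polyn p.1) * w (polyn p.2) * w (polyn r.1) * w (polyn r.2))); last first.
    by move=> p _; rewrite pair_big_dep.
  by rewrite pair_big_dep /=; apply: eq_bigl => t; rewrite inE -andbA.
have X_m : 'X^m \is @monic F := monicXn F m.
have sX : size ('X^m : {poly F}) = m.+1 by rewrite size_polyXn.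
apply: (@le_trans _ _ (\sum_(g in ball_poly N 'X^m m) w (polyn g) *
   (beta m * q%:R ^+ (H - (N - m)) *
   (beta (N - m) * q%:R ^+ (H - m) * (beta (N - m) * q%:R ^+ (H - m)))))).
  apply: ler_sum => g gX.
  have [gm gs] : polyn g \is monic /\ size (polyn g) = m.+1.
    by have := ball_monic X_m _ gX; rewrite sX; apply.
  have -> : \sum_(k in ball_poly N (polyn g) (H - (N - m)))
      \sum_(a in ball_poly N (K %/ polyn g) (H - m))
      \sum_(b in ball_poly N (polyn a) (H - m))
         w (polyn g) * w (polyn k) * w (polyn a) * w (polyn b) =
    w (polyn g) * ((\sum_(k in ball_poly N (polyn g) (H - (N - m))) w (polyn k)) *
      (\sum_(a in ball_poly N (K %/ polyn g) (H - m)) w (polyn a) *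
        \sum_(b in ball_poly N (polyn a) (H - m)) w (polyn b))).
    rewrite mulr_suml mulr_sumr; apply: eq_bigr => k _; rewrite mulrA mulr_sumr.
    by apply: eq_bigr => a _; rewrite !mulr_sumr; apply: eq_bigr => b _; rewrite !mulrA.
  rewrite ler_wpM2l //; apply: ler_pM; rewrite ?sumr_ge0 //.
  - by move=> a _; rewrite mulr_ge0 // sumr_ge0.
  - apply: wb => //; first by clear -mle HN mN; lia.
    by clear -mle HN mN; lia.
  have Kg := divp_eq K (polyn g).
  have Kgm : K %/ polyn g \is monic /\ size (K %/ polyn g) = (N - m).+1.
    have sKg : size (K %/ polyn g) = (N - m).+1.
      by rewrite size_divp ?monic_neq0 // sK gs /= subSn.
    split => //; rewrite -(monicMr _ gm).
    have lt : (size (K %% polyn g)%R < size (K %/ polyn g * polyn g)%R)%N.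
      rewrite (@leq_trans (size (polyn g))) ?ltn_modpN0 ?monic_neq0 //.
      by rewrite size_Mmonic ?sKg -?size_poly_gt0 ?sKg // addSn /= leq_addl.
    by move: Km; rewrite {1}Kg !monicE lead_coefDl.
  apply: (@le_trans _ _ (\sum_(a in ball_poly N (K %/ polyn g) (H - m))
      w (polyn a) * (beta (N - m) * q%:R ^+ (H - m)))).
    apply: ler_sum => a aK; rewrite ler_wpM2l //.
    have := ball_monic Kgm.1 _ aK; rewrite Kgm.2 => /(_ _)[|am as_].
      by clear -mle HN mH; lia.
    by apply: wb => //; rewrite ?subKn //; clear -mle HN mH; lia.
  rewrite -mulr_suml ler_wpM2r ?mulr_ge0 ?exprn_ge0 //.
  by apply: wb; rewrite ?subKn //; case: Kgm => //; clear -mle HN mH; lia.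
rewrite -mulr_suml.
apply: (@le_trans _ _ (beta m * q%:R ^+ m * (beta m * q%:R ^+ (H - (N - m)) *
   (beta (N - m) * q%:R ^+ (H - m) * (beta (N - m) * q%:R ^+ (H - m)))))).
  rewrite ler_wpM2r ?mulr_ge0 ?exprn_ge0 //.
  by apply: wb => //; clear -mle HN mH; lia.
(* The exponent adds up the lengths of the four intervals, for [g], [k], [a] and [b]. *)
have -> : (3 * H - N = m + (H - (N - m)) + ((H - m) + (H - m)))%N.
  by clear -mle HN mH mN; lia.
by rewrite !exprD le_eqVlt; apply/orP; left; apply/eqP; ring.
Qed.

End Energy.


(** * Choice of the subset *)

Section Admissible.
Variables (R : realType) (F : finFieldType) (N h : nat) (K : {poly F}).
Local Notation q := (#|F|).
Local Notation P := {poly_N.+1 F}.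
Local Notation prime := (@prime_poly F N).
Local Notation A := (short_interval N K h).
Local Notation H := h.+1.
Hypotheses (Km : K \is monic) (sK : size K = N.+1) (hN : (h.+1 < N)%N).

Definition exponents (G : P) (i : prime) : nat := pval i (polyn G).

(* The existence of the data on which the error term of [char_bound] depends. *)
Definition admissible (delta : R) : Prop :=
  exists (S : {set P}) (sel : P -> prime),
    let pe := (#|sel_pairs exponents S sel| + #|offdiag_quads exponents S|)%:R
      / #|A|%:R ^+ 2 : R in
    [/\ S \subset A, forall G, G \in S -> (0 < exponents G (sel G))%N,
      1 - #|S|%:R / #|A|%:R <= delta, pe <= delta &
      pe * ((sel_weight exponents S sel)%:R / #|A|%:R) <= delta].

Lemma short_intervalE : A = ball_poly N K H.
Proof.
apply/setP => G; rewrite !inE; apply/and3P/idP => [[]//|GK].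
have [Gm Gs] : polyn G \is monic /\ size (polyn G) = size K.
  have GB : G \in ball_poly N K H by rewrite inE.
  by apply: (ball_monic Km _ GB); rewrite sK ltnW // ltnS ltnW.
by rewrite Gm Gs sK.
Qed.

Let HN : (H <= N)%N. Proof. exact: ltnW. Qed.

Lemma card_short_interval : #|A| = (q ^ H)%N.
Proof. by rewrite short_intervalE card_ball_poly ?sK // leqW. Qed.

Let X : R := q%:R ^+ H.
Let q1 : (1 : R) <= q%:R.
Proof. by rewrite ler1n card_field_gt0. Qed.
Let q0 : (0 : R) < q%:R.
Proof. exact: lt_le_trans q1. Qed.
Let X0 : 0 < X.
Proof. by rewrite exprn_gt0. Qed.

Let cardA : #|A|%:R = X.
Proof. by rewrite card_short_interval natrX. Qed.

Variables (S : {set P}) (sel : P -> prime).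
Hypotheses (SA : S \subset A) (selS : forall G, G \in S -> ppoly (sel G) %| polyn G).

Let S_monic G : G \in S -> polyn G \is monic.
Proof. by move=> /(fintype.subsetP SA); rewrite inE => /and3P[]. Qed.

Let exponents_gt0 G i : G \in S -> (0 < exponents G i)%N = (ppoly i %| polyn G).
Proof. by move=> GS; rewrite /exponents pval_gt0 ?S_monic ?size_npoly. Qed.

Lemma admissibleI (delta p e W : R) : 0 <= p -> 0 <= e ->
  1 - #|S|%:R / X <= delta ->
  #|sel_pairs exponents S sel|%:R <= p * X ^+ 2 ->
  #|offdiag_quads exponents S|%:R <= e * X ^+ 2 ->
  (sel_weight exponents S sel)%:R <= W * X ->
  p + e <= delta -> (p + e) * W <= delta -> admissible delta.
Proof.
move=> p0 e0 hth hp he hW h1 h2; exists S, sel; rewrite cardA /=.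
have pe : (#|sel_pairs exponents S sel| + #|offdiag_quads exponents S|)%:R / X ^+ 2 <= p + e.
  by rewrite ler_pdivrMr ?exprn_gt0 // natrD mulrDl lerD.
split => //; first by move=> G GS; rewrite exponents_gt0 // selS.
  exact: le_trans pe h1.
apply: le_trans h2; apply: ler_pM => //; first by rewrite divr_ge0 ?ler0n ?exprn_ge0.
  by rewrite divr_ge0 ?ler0n ?(ltW X0).
by rewrite ler_pdivrMr.
Qed.

Lemma sel_pairs_le (c : R) : 0 <= c ->
  (forall G, G \in S ->
     #|[set g in ball_poly N K H | (ppoly (sel G) %| polyn g)%R]|%:R <= c) ->
  #|sel_pairs exponents S sel|%:R <= X * c.
Proof.
move=> c0 hc; rewrite -sum1_card natr_sum.
rewrite (eq_bigl (fun x : P * P => (x.1 \in S) && ((x.2 \in S) &&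
    (ppoly (sel x.1) %| polyn x.2)))); last first.
  by move=> x; rewrite inE; do 2 case: (boolP (_ \in S)) => //= ?; rewrite exponents_gt0.
rewrite -(pair_big_dep (fun G => G \in S)
  (fun G g => (g \in S) && (ppoly (sel G) %| polyn g)) (fun _ _ => 1%:R)) /=.
apply: (@le_trans _ _ (\sum_(G in S) c)).
  apply: ler_sum => G GS; apply: le_trans (hc _ GS).
  rewrite -natr_sum sum1_card ler_nat subset_leq_card //.
  apply/fintype.subsetP => g; rewrite unfold_in => /andP[gS dvd].
  by rewrite !inE dvd andbT; have := fintype.subsetP SA _ gS; rewrite inE => /and3P[].
rewrite sumr_const -[_ *+ _]mulr_natl ler_wpM2r // -cardA ler_nat.
exact: subset_leq_card.
Qed.

Lemma sel_weight_le (T : {set prime}) : (forall G, G \in S -> sel G \in T) ->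
  (sel_weight exponents S sel <=
    \sum_(i in T) #|[set g in ball_poly N K H | (ppoly i %| polyn g)%R]|)%N.
Proof.
move=> selT; rewrite /sel_weight big_mkcond [leqRHS]big_mkcond /=.
apply: leq_sum => i _; case: imsetP => [[G GS ->]|//]; rewrite selT //.
apply: subset_leq_card; apply/fintype.subsetP => g; rewrite !inE => /andP[gS].
rewrite exponents_gt0 // => ->; rewrite andbT.
by have := fintype.subsetP SA _ gS; rewrite inE => /and3P[].
Qed.

Lemma offdiag_quads_le (w : {poly F} -> R) (Lam : R) (beta : nat -> R) :
  (forall G, 0 <= w G) -> (forall m, 0 <= beta m) ->
  (forall (G : P) (g a : {poly F}), G \in S -> polyn G = g * a ->
     1 <= Lam * (w g * w a)) ->
  (forall m K' H', K' \is monic -> size K' = m.+1 ->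
    (m <= H' + (N - H))%N -> (H' <= m)%N -> (m < H)%N -> (N - m < H)%N ->
    \sum_(G in ball_poly N K' H') w (polyn G) <= beta m * q%:R ^+ H') ->
  #|offdiag_quads exponents S|%:R <=
    Lam ^+ 2 * (\sum_(m < H | (N - m < H)%N) beta m ^+ 2 * beta (N - m)%N ^+ 2)
      * q%:R ^- (N - H) * X ^+ 2.
Proof.
move=> w0 beta0 wS wb; have SK : S \subset ball_poly N K H by rewrite -short_intervalE.
apply: (le_trans (@energy_bound R F N H K Km sK HN S w Lam beta SK w0 beta0 wS wb _ _)).
  move=> z; rewrite inE => /and4P[zS -> -> /forallP E]; rewrite zS /=.
  have /and4P[z1 z2 z3 z4] := zS.
  apply/eqP; apply: (@eq_prod_pval F N); rewrite ?S_monic ?size_npoly // => i.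
  exact/eqP/E.
move: (sqr_ge0 Lam); move: (Lam ^+ 2) => L2 L20.
rewrite -!mulrA; apply: ler_wpM2l => //.
(* If [2 H <= N], no [m] satisfies both [m < H] and [N - m < H]; otherwise the subtractions of
   natural numbers are exact. *)
have [NH|NH] := leqP (2 * H) N.
  rewrite big_pred0 ?mul0r // => m; have := ltn_ord m.
  by move: HN NH; case: m => m /= _ HN' NH mH; apply/negbTE; rewrite -leqNgt; lia.
apply: ler_wpM2l; first by apply: sumr_ge0 => m _; rewrite mulr_ge0 ?sqr_ge0.
rewrite -exprM le_eqVlt; apply/orP; left; apply/eqP.
have -> : (3 * H - N = H * 2 - (N - H))%N by move: HN NH; lia.
rewrite expfB_cond ?gt_eqF //= ?add0n 1?mulrC //.
by move: HN NH; lia.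
Qed.

End Admissible.

Section CountingBounds.
Variables (R : realType) (F : finFieldType) (N : nat).
Local Notation q := (#|F|).
Local Notation prime := (@prime_poly F N).

Lemma card_dvd_ball (K : {poly F}) H (i : prime) : (size K <= N.+1)%N -> (H <= N)%N ->
  (pdeg i <= H)%N ->
  #|[set G in ball_poly N K H | (ppoly i %| polyn G)%R]|%:R =
    q%:R ^+ H * q%:R^-1 ^+ pdeg i :> R.
Proof.
move=> sK HN iH.
rewrite (card_multiples_in_ball (ppoly_monic i) (size_ppoly i) iH sK (leqW HN)).
by rewrite natrX expfB_cond ?exprVn // pnatr_eq0 gtn_eqF ?card_field_gt0.
Qed.

Lemma psum_range_le y : (y <= N)%N -> psum R (prime_range F N 0 y) <= y%:R.
Proof.
elim: y => [|y IH] yN; first by rewrite psum_range0.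
rewrite psum_rangeS // -[y.+1]addn1 natrD addn1; apply: lerD; first exact/IH/ltnW.
rewrite ler_pdivrMr ?exprn_gt0 ?ltr0n ?card_field_gt0 // mul1r -natrX ler_nat.
by apply: leq_trans (@nprime_le F N y.+1 _); rewrite ?leq_pmull.
Qed.

Lemma harmonic_le k : \sum_(1 <= m < 2 ^ k) (m%:R^-1 : R) <= k%:R.
Proof.
elim: k => [|k IH]; first by rewrite big_geq.
have k0 : (0 < 2 ^ k)%N by rewrite expn_gt0.
rewrite (@big_cat_nat _ _ _ (2 ^ k)%N) //=; last by rewrite leq_exp2l.
rewrite -[k.+1]addn1 natrD addn1; apply: lerD => //.
apply: (@le_trans _ _ (\sum_(2 ^ k <= m < 2 ^ k.+1) ((2 ^ k)%:R^-1 : R))).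
  rewrite !big_nat; apply: ler_sum => m /andP[km _].
  by rewrite lef_pV2 ?posrE ?ltr0n ?ler_nat // (leq_trans k0).
rewrite sumr_const_nat expnS mul2n -addnn addnK -[_ *+ _]mulr_natl divff //.
Qed.

End CountingBounds.

(** * Admissible subsets for bounded and for large [h] *)

Section Cases.
Variables (R : realType) (F : finFieldType) (N h : nat) (K : {poly F}).
Local Notation q := (#|F|).
Local Notation P := {poly_N.+1 F}.
Local Notation prime := (@prime_poly F N).
Local Notation A := (short_interval N K h).
Local Notation H := h.+1.
Hypotheses (Km : K \is monic) (sK : size K = N.+1) (hN : (h.+1 < N)%N).

Let HN : (H <= N)%N. Proof. exact: ltnW. Qed.
Let N0 : (0 < N)%N. Proof. exact: leq_ltn_trans hN. Qed.
Let X : R := q%:R ^+ H.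
Let q1 : (1 : R) <= q%:R.
Proof. by rewrite ler1n card_field_gt0. Qed.
Let q0 : (0 : R) < q%:R.
Proof. exact: lt_le_trans q1. Qed.
Let X0 : 0 < X.
Proof. by rewrite exprn_gt0. Qed.
Let qV1 : (q%:R : R)^-1 <= 1.
Proof. by rewrite invf_le1. Qed.
Let qV0 : 0 <= (q%:R : R)^-1.
Proof. by rewrite invr_ge0 ltW. Qed.

Let A_ball : A = ball_poly N K H.
Proof. exact: short_intervalE. Qed.
Let cardA : #|A|%:R = X.
Proof. by rewrite card_short_interval // natrX. Qed.
Let A_spec (G : P) : G \in A -> polyn G \is monic /\ size (polyn G) = N.+1.
Proof. by rewrite inE => /and3P[-> /eqP -> _]. Qed.

(** The energy bound with constant weight [1]: each of the at most [H] degrees [m] contributes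
    [1]. *)
Let trivial_energy (S : {set P}) : S \subset A ->
  #|offdiag_quads (@exponents F N) S|%:R <= H%:R * q%:R ^- (N - H) * X ^+ 2 :> R.
Proof.
move=> SA.
have := @offdiag_quads_le R F N h K Km sK hN S SA (fun=> 1) 1 (fun=> 1).
rewrite !expr1n mul1r => /(_ _ _ _ _)/le_trans; apply => //.
- by move=> *; rewrite !mulr1.
- move=> m K' H' _ sK' _ H'm mH _; rewrite sumr_const card_ball_poly ?sK'.
  + by rewrite mul1r natrX.
  + by rewrite ltnS (leq_trans (ltnW mH)).
  + by rewrite leqW // (leq_trans H'm) // (leq_trans (ltnW mH)).
apply: ler_wpM2r; first by rewrite exprn_ge0 // ltW.
apply: ler_wpM2r; first by rewrite invr_ge0 exprn_ge0 // ltW.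
rewrite mul1r (eq_bigr (fun=> 1)) => [|m _]; last by rewrite mulr1.
by rewrite sumr_const ler_nat (leq_trans (max_card _)) // card_ord.
Qed.

(** Here [S = A] and any irreducible divisor may be selected: pairs have density at most [1 / q],
    which is small when [h] is bounded and [q ^ h] is large, and [W] is at most [H + 1]. *)
Lemma admissible_small (delta c : R) : N%:R * q%:R ^- (N - H) <= c ->
  q%:R^-1 <= c -> 2 * c * (H.+1)%:R <= delta -> admissible N h K delta.
Proof.
move=> hc qc hdelta; have [i0 _] : exists i : prime, ppoly i %| 'X.
  by apply: ex_ppoly; rewrite size_polyX /= ltnS.
pose sel (G : P) := odflt i0 [pick i | ppoly i %| polyn G].
have selA G : G \in A -> ppoly (sel G) %| polyn G.
  move=> /A_spec[_ sG]; rewrite /sel; case: pickP => //= none.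
  by have [|i] := @ex_ppoly F N (polyn G); rewrite ?none // sG ltnS N0 leqnn.
have c0 : 0 <= c by apply: le_trans qc.
have e0 : 0 <= N%:R * q%:R ^- (N - H) :> R by rewrite mulr_ge0 // invr_ge0 exprn_ge0 // ltW.
have d0 : 2 * c <= delta.
  apply: le_trans hdelta; rewrite ler_peMr ?mulr_ge0 // ler1n //.
have count (i : prime) :
    #|[set G in ball_poly N K H | (ppoly i %| polyn G)%R]|%:R <= X * q%:R^-1.
  have [iH|iH] := leqP (pdeg i) H.
    rewrite card_dvd_ball ?sK //; apply: ler_wpM2l; first exact: ltW.
    by rewrite -{2}[q%:R^-1]expr1; apply: ler_wiXn2l; rewrite ?qV0 ?pdeg_gt0.
  apply: (@le_trans _ _ 1).
    by rewrite lern1; apply: card_multiples_le1; rewrite size_ppoly ltnS ltnW.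
  by rewrite /X exprS mulrC mulrA mulVf ?gt_eqF // mul1r exprn_ege1.
apply: (@admissibleI R F N h K Km sK hN A sel _ selA delta q%:R^-1
  (N%:R * q%:R ^- (N - H)) H.+1%:R) => //.
- by rewrite cardA divff ?gt_eqF // subrr; apply: le_trans d0; rewrite mulr_ge0.
- rewrite [leRHS]mulrC [X in X * _]expr2 -mulrA.
  exact: (sel_pairs_le Km sK hN).
- apply: (le_trans (trivial_energy (fintype.subxx _))); apply: ler_wpM2r.
    by rewrite exprn_ge0 // ltW.
  by apply: ler_wpM2r; rewrite ?ler_nat // invr_ge0 exprn_ge0 // ltW.
- apply: (@le_trans _ _ (\sum_(i in sel @: A)
      #|[set g in ball_poly N K H | (ppoly i %| polyn g)%R]|)%:R).
    rewrite ler_nat; apply: sel_weight_le => // G GA; exact: imset_f.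
  rewrite natr_sum (bigID (fun i => pdeg i <= H)%N) /= -[H.+1]addn1 natrD mulrDl mul1r.
  apply: lerD.
    apply: (@le_trans _ _ (X * psum R (prime_range F N 0 H))); last first.
      by rewrite mulrC; apply: ler_wpM2r; [exact: ltW|exact: psum_range_le].
    rewrite /psum mulr_sumr big_mkcondl /=; rewrite [leLHS]big_mkcond [leRHS]big_mkcond /=.
    apply: ler_sum => i _; rewrite inE pdeg_gt0 /=; case: ifP => // iH.
    rewrite card_dvd_ball ?sK //; case: ifP => // _.
    by rewrite mulr_ge0 ?exprn_ge0 // ltW.
  apply: (@le_trans _ _ (\sum_(i in sel @: A) 1)).
    rewrite big_mkcondr /=; apply: ler_sum => i _; case: ifP => // iH.
    rewrite lern1; apply: card_multiples_le1.
    by rewrite size_ppoly ltnS ltnW // ltnNge iH.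
  by rewrite sumr_const -[leRHS]/X -cardA ler_nat leq_imset_card.
- by apply: le_trans d0; rewrite mulrDl mul1r addrC lerD.
- apply: le_trans hdelta; apply: ler_wpM2r => //.
  by rewrite mulrDl mul1r addrC lerD.
Qed.

Section LargeInterval.
Variables (l : nat).
Hypotheses (l0 : (0 < l)%N) (hl : (h < 2 ^ l)%N) (lh : (16 * l * l <= h)%N).

Let y := (h %/ (16 * l))%N.
Let Q := prime_range F N l y.
Let sigma : R := psum R Q.

Let l16 : (0 < 16 * l)%N. Proof. by rewrite muln_gt0. Qed.

Let ly : (l <= y)%N.
Proof. by rewrite leq_divRL // mulnC. Qed.

Let yh : (y * (16 * l) <= h)%N.
Proof. exact: leq_divM. Qed.

Let yN : (y <= N)%N.
Proof. by rewrite (leq_trans (leq_div _ _)) // ltnW // ltnW. Qed.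

Let y2H : (2 * y <= H)%N.
Proof.
apply: leq_trans (leqnSn _); apply: leq_trans yh; rewrite mulnC leq_mul2l.
by apply/orP; right; rewrite (@leq_trans 16) // leq_pmulr.
Qed.

Let Qdeg i : i \in Q -> (l < pdeg i <= y)%N.
Proof. by rewrite inE. Qed.

Lemma exp_psum_le_nat m : (l <= m <= N)%N -> expR (psum R (prime_range F N l m)) <= m%:R.
Proof.
move=> /andP[lm mN]; apply: le_trans (exp_psum_le R F _ mN) _; first by rewrite l0.
by rewrite ler_pdivrMr ?ltr0n // ler_peMr // ler1n.
Qed.

Lemma sieve_weight m (K' : {poly F}) H' : (0 < m <= h)%N -> size K' = m.+1 ->
  (m <= H' + 2 * l)%N -> (H' <= m)%N ->
  \sum_(G in ball_poly N K' H') (2 : R)^-1 ^+ omega Q (polyn G) <=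
    Num.sqrt (66 * expR 6 * l%:R ^+ 2 / m%:R) * q%:R ^+ H'.
Proof.
move=> /andP[m0 mh] sK' mH' H'm; have mN : (m <= N)%N by rewrite (leq_trans mh) // ltnW // ltnW.
have mR0 : (0 : R) < m%:R by rewrite ltr0n.
have lR0 : (0 : R) < l%:R by rewrite ltr0n.
have sKN : (size K' <= N.+1)%N by rewrite sK'.
have HN' : (H' <= N.+1)%N by rewrite leqW // (leq_trans H'm).
have E6 : (1 : R) <= expR 6 by rewrite -expR0 ler_expR.
have [ml|lm] := ltnP m (16 * l * l).
  apply: (@le_trans _ _ (\sum_(G in ball_poly N K' H') 1)).
    by apply: ler_sum => G _; rewrite exprn_ile1 // invf_le1 // ler1n.
  rewrite sumr_const card_ball_poly // natrX ler_peMl ?exprn_ge0 ?(ltW q0) //.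
  rewrite -[leLHS]sqrtr1 ler_sqrt ?divr_ge0 ?mulr_ge0 ?exprn_ge0 ?expR_ge0 ?ler0n //.
  rewrite ler_pdivlMr // mul1r; apply: (@le_trans _ _ (16 * l%:R ^+ 2)).
    by rewrite expr2 mulrA -!natrM ler_nat ltnW.
  rewrite ler_wpM2r ?sqr_ge0 //.
  by move: E6; move: (expR 6) => e6; lra.
pose ym := (m %/ (16 * l))%N; pose Qm := prime_range F N l ym.
have lym : (l <= ym)%N by rewrite leq_divRL // mulnC.
have ymN : (ym <= N)%N by rewrite (leq_trans (leq_div _ _)).
have ymm : (ym * (16 * l) <= m)%N by exact: leq_divM.
have ymy : (ym <= y)%N by exact: leq_div2r.
have JH : (8 * l * ym <= H')%N.
  rewrite -(leq_pmul2l (isT : 0 < 2)%N) (_ : 2 * (8 * l * ym) = ym * (16 * l))%N; last by ring.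
  apply: (leq_trans ymm); move: mH' lm l0 => mH' lm l0'.
  have : (16 * l <= 16 * l * l)%N by rewrite leq_pmulr.
  by clear -mH' lm; move: (16 * l * l)%N lm => z lm; lia.
have oddJ : ~~ odd (8 * l) by rewrite oddM.
have deg_m (i : prime) : i \in Qm -> (pdeg i <= ym)%N by rewrite inE => /andP[].
apply: (@le_trans _ _ (\sum_(G in ball_poly N K' H') (2 : R)^-1 ^+ omega Qm (polyn G))).
  apply: ler_sum => G _; apply: ler_wiXn2l; rewrite ?invr_ge0 ?invf_le1 ?ler1n //.
  apply: subset_leq_card; apply/fintype.subsetP => i; rewrite !inE => /andP[/andP[-> iy] ->].
  by rewrite (leq_trans iy).
apply: le_trans (@sum_half_pow_omega R F N Qm K' H' _ ym oddJ JH deg_m sKN HN') _.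
rewrite mulrC ler_wpM2r ?exprn_ge0 ?(ltW q0) //.
set s := psum R Qm; set b := _ + _.
have b0 : 0 <= b by rewrite addr_ge0 ?expR_ge0 ?mulr_ge0 ?exprn_ge0 ?invr_ge0 ?expR_ge0.
rewrite -[b]ger0_norm // -sqrtr_sqr; apply: ler_wsqrtr.
have e1 : expR (- s) <= 32 * expR 6 * l%:R ^+ 2 / m%:R.
  have := @exp_psum_ge R F N l ym; rewrite lym ymN -/Qm -/s => /(_ isT) ge.
  rewrite expRN -[leRHS]invrK lef_pV2 ?posrE ?expR_gt0 ?invr_gt0 ?divr_gt0 ?mulr_gt0 ?expR_gt0 ?exprn_gt0 //.
  apply: le_trans ge; rewrite invf_div expRN.
  have -> : m%:R / (32 * expR 6 * l%:R ^+ 2) = m%:R / (16 * l%:R) / (2 * l%:R) * (expR 6)^-1 :> R.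
    move: (expR 6) E6 (l%:R : R) lR0 (m%:R : R) => e e1 a a0 b'.
    by field; rewrite !gt_eqF // (lt_le_trans _ e1).
  apply: ler_wpM2r; first by rewrite invr_ge0 expR_ge0.
  apply: ler_pM; rewrite ?divr_ge0 ?invr_ge0 ?mulr_ge0 ?ler0n //.
    rewrite ler_pdivrMr ?mulr_gt0 // -natrM -natrM ler_nat ltnW //.
    by rewrite -ltn_divLR // ltnSn.
  rewrite lef_pV2 ?posrE ?mulr_gt0 // -?natrM ?ler_nat ?ltr0n //.
  by rewrite mul2n -addnn -addn1 leq_add2l.
have e2 : expR s <= m%:R.
  by apply: (le_trans (exp_psum_le_nat _)); rewrite ?lym // ler_nat leq_div.
have mpow : (m%:R : R) <= 2 ^+ l by rewrite -natrX ler_nat ltnW // (leq_ltn_trans mh).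
have e3 : (2^-1 ^+ (8 * l) * expR s) ^+ 2 <= m%:R^-1.
  have p0 : (0 : R) < 2 ^+ l by rewrite exprn_gt0.
  apply: (@le_trans _ _ (((2 ^+ l)^-1 ^+ 8 * 2 ^+ l) ^+ 2)).
    rewrite lerXn2r ?nnegrE ?mulr_ge0 ?exprn_ge0 ?expR_ge0 ?invr_ge0 ?(ltW p0) //.
    rewrite mulnC exprM exprVn; apply: ler_wpM2l; last exact: le_trans e2 mpow.
    by rewrite exprn_ge0 // invr_ge0 ltW.
  apply: (@le_trans _ _ (2 ^+ l)^-1); last by rewrite lef_pV2 ?posrE.
  have : (1 : R) <= 2 ^+ l by rewrite exprn_ege1 // ler1n.
  move: (2 ^+ l) p0 => t t0 t1.
  have -> : (t^-1 ^+ 8 * t) ^+ 2 = t^-1 * t^-1 ^+ 13 by field; rewrite gt_eqF.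
  rewrite ler_piMr ?invr_ge0 ?(ltW t0) // exprn_ile1 ?invr_ge0 ?(ltW t0) //.
  by rewrite invf_le1.
have e4 : expR (- (s / 2)) ^+ 2 = expR (- s).
  by rewrite expr2 -expRD; congr expR; field.
apply: (@le_trans _ _ (2 * expR (- s) + 2 * m%:R^-1)).
  rewrite -e4; apply: (@le_trans _ _ (2 * expR (- (s / 2)) ^+ 2 +
      2 * (2^-1 ^+ (8 * l) * expR s) ^+ 2)); last by rewrite lerD2l ler_pM2l.
  rewrite /b; move: (expR (- (s / 2))) (2^-1 ^+ (8 * l) * expR s) => u v.
  rewrite -subr_ge0 (_ : _ - _ = (u - v) ^+ 2) ?sqr_ge0 //; ring.
have l1 : (1 : R) <= l%:R ^+ 2 by rewrite exprn_ege1 // ler1n.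
apply: (@le_trans _ _ (2 * (32 * expR 6 * l%:R ^+ 2 / m%:R) + 2 * m%:R^-1)).
  by rewrite lerD2r ler_pM2l.
rewrite -subr_ge0.
have -> : 66 * expR 6 * l%:R ^+ 2 / m%:R - (2 * (32 * expR 6 * l%:R ^+ 2 / m%:R) + 2 * m%:R^-1)
   = 2 * (expR 6 * l%:R ^+ 2 - 1) * m%:R^-1 :> R by ring.
rewrite !mulr_ge0 ?invr_ge0 ?ler0n // subr_ge0.
exact: mulr_ege1.
Qed.

Let sigma0 : 0 <= sigma. Proof. exact: psum_ge0. Qed.

Let yl : (y <= 2 ^ l)%N.
Proof. by rewrite (leq_trans (leq_div _ _)) // ltnW. Qed.

Lemma psum_large_le : sigma <= l%:R.
Proof.
rewrite -ler_expR; apply: (le_trans (exp_psum_le_nat _)); first by rewrite ly yN.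
apply: (@le_trans _ _ (2 ^+ l)); first by rewrite -natrX ler_nat.
rewrite -[l%:R]mulr1 expRM_natl; apply: lerXn2r; rewrite ?nnegrE ?expR_ge0 //.
by apply: le_trans (expR_ge1Dx 1); rewrite -natr1.
Qed.

Let qVl (i : prime) : i \in Q -> (q%:R^-1 : R) ^+ pdeg i <= 2^-1 ^+ l.
Proof.
move=> /Qdeg/andP[li _]; apply: (@le_trans _ _ (2^-1 ^+ pdeg i)).
  by rewrite lerXn2r ?nnegrE ?invr_ge0 // ?lef_pV2 ?posrE // ler_nat card_field_gt1.
by apply: ler_wiXn2l (ltnW li); rewrite ?invr_ge0 ?invf_le1 ?ler1n.
Qed.

Let count (i : prime) : i \in Q ->
  #|[set G in ball_poly N K H | (ppoly i %| polyn G)%R]|%:R = X * q%:R^-1 ^+ pdeg i.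
Proof.
move=> /Qdeg/andP[_ iy]; rewrite card_dvd_ball ?sK //.
by rewrite (leq_trans iy) // (leq_trans _ y2H) // leq_pmull.
Qed.

Variable eps : R.
Hypotheses (eps0 : 0 < eps) (eps1 : eps <= 1) (sigma_gt0 : 0 < sigma).

Let S : {set P} := [set G in A | (`|(omega Q (polyn G))%:R - sigma| < eps * sigma) &&
  [forall (i : prime | i \in Q), ~~ (ppoly i ^+ 2 %| polyn G)]].

Let SA : S \subset A.
Proof. by apply/fintype.subsetP => G; rewrite inE => /andP[]. Qed.

Let es0 : 0 < eps * sigma. Proof. by rewrite mulr_gt0. Qed.

Let card_exceptional : #|A :\: S|%:R <= X * ((eps ^+ 2 * sigma)^-1 + l%:R / 2 ^+ l).
Proof.
have sqcount (i : prime) : i \in Q ->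
    \sum_(G in ball_poly N K H) (ppoly i ^+ 2 %| polyn G)%R%:R <=
    X * (q%:R^-1 ^+ pdeg i * 2^-1 ^+ l).
  move=> iQ; have /andP[_ iy] := Qdeg iQ.
  have iH : (2 * pdeg i <= H)%N by apply: leq_trans y2H; rewrite leq_mul2l iy orbT.
  have -> : \sum_(G in ball_poly N K H) (ppoly i ^+ 2 %| polyn G)%R%:R =
      #|[set G in ball_poly N K H | (ppoly i ^+ 2 %| polyn G)%R]|%:R :> R.
    rewrite -sum1_card natr_sum [RHS](eq_bigl (fun G : P => (G \in ball_poly N K H) &&
      (ppoly i ^+ 2 %| polyn G)%R)) => [|G]; last by rewrite inE.
    by rewrite big_mkcondr /=; apply: eq_bigr => G _; case: ifP.
  rewrite (card_multiples_in_ball (monic_exp _ (ppoly_monic i)) (size_ppoly_exp i 2)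
    iH _ (leqW HN)) ?sK //.
  rewrite natrX expfB_cond; last by rewrite gt_eqF //= add0n.
  rewrite mul2n -addnn exprD invfM -!exprVn; apply: ler_wpM2l; first exact: ltW.
  by apply: ler_wpM2l; rewrite ?exprn_ge0 ?qVl.
apply: (@le_trans _ _ (\sum_(G in ball_poly N K H)
  (((omega Q (polyn G))%:R - sigma) ^+ 2 / (eps * sigma) ^+ 2 +
   \sum_(i in Q) (ppoly i ^+ 2 %| polyn G)%R%:R))).
  rewrite -sum1_card natr_sum big_mkcond [leRHS]big_mkcond /=.
  apply: ler_sum => G _; rewrite -A_ball finset.in_setD [G \in S]finset.in_set.
  have t0 : 0 <= ((omega Q (polyn G))%:R - sigma) ^+ 2 / (eps * sigma) ^+ 2.
    by rewrite divr_ge0 ?sqr_ge0.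
  case: (boolP (G \in A)) => GA; rewrite ?andbF //= ?andbT; case: ifPn => //.
    rewrite negb_and -leNgt => /orP[far|]; last first.
      rewrite negb_forall => /existsP[ i ].
      rewrite negb_imply negbK => /andP[iQ idvd].
      rewrite -[leLHS]add0r; apply: lerD => //.
      rewrite (bigD1 i) //= idvd lerDl sumr_ge0 //.
    rewrite -[leLHS]addr0; apply: lerD; last by rewrite sumr_ge0.
    by rewrite ler_pdivlMr ?exprn_gt0 // mul1r -(@real_normK _ (_ - sigma)) ?num_real //
        lerXn2r ?nnegrE ?(ltW es0).
  by move=> _; rewrite addr_ge0 // sumr_ge0.
rewrite big_split /= -mulr_suml mulrDr; apply: lerD.
  rewrite ler_pdivrMr ?exprn_gt0 //.
  have := @omega_variance R F N Q K H y; rewrite sK => /(_ (leqnn _) _ y2H _) /le_trans.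
  apply; [by rewrite leqW|by move=> i /Qdeg/andP[]|].
  rewrite -/sigma -/X; move: (X) (sigma) sigma_gt0 (eps) eps0 => x s s0 e e0.
  have -> : x / (e ^+ 2 * s) * (e * s) ^+ 2 = x * s by field; rewrite !gt_eqF.
  by [].
rewrite exchange_big /=; apply: (@le_trans _ _ (\sum_(i in Q) X * (q%:R^-1 ^+ pdeg i * 2^-1 ^+ l))).
  by apply: ler_sum => i; exact: sqcount.
rewrite -mulr_sumr -mulr_suml -exprVn; apply: ler_wpM2l; first exact: ltW.
by apply: ler_wpM2r; rewrite ?exprn_ge0 ?invr_ge0 // psum_large_le.
Qed.

Let theta_bound : 1 - #|S|%:R / X <= (eps ^+ 2 * sigma)^-1 + l%:R / 2 ^+ l.
Proof.
have -> : 1 - #|S|%:R / X = #|A :\: S|%:R / X.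
  rewrite -[X in X - _](divff (lt0r_neq0 X0)) -mulrBl -cardA -natrB ?subset_leq_card //.
  by rewrite cardsD (finset.setIidPr SA).
by rewrite ler_pdivrMr // mulrC.
Qed.

Lemma omega_mul (G : P) (g a : {poly F}) : G \in S -> polyn G = g * a ->
  omega Q (polyn G) = (omega Q g + omega Q a)%N.
Proof.
rewrite inE => /and3P[_ _ /forallP sqf] GE; rewrite /omega -cardsUI.
rewrite [X in (_ + X)%N]eq_card0 ?addn0 => [|i]; last first.
  rewrite !inE; apply/negP => /andP[/andP[iQ ig] /andP[_ ia]].
  by have := sqf i; rewrite inE iQ GE expr2 dvdp_mul.
congr #|pred_of_set _|; apply/setP => i.
by rewrite !inE GE dvdp_ppoly_prime -andb_orr.
Qed.

Let harmonic_pair_sum :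
  \sum_(m < H | (N - m < H)%N) ((m%:R * (N - m)%N%:R)^-1 : R) <=
  2 * (\sum_(1 <= m < N) (m%:R^-1 : R)) / N%:R.
Proof.
have NR : (N%:R : R) != 0 by rewrite pnatr_eq0 -lt0n.
apply: (@le_trans _ _ (\sum_(1 <= m < N) (m%:R * (N - m)%N%:R)^-1 : R)).
  rewrite big_mkcond /= -(big_mkord xpredT (fun m => if (N - m < H)%N then
    (m%:R * (N - m)%N%:R)^-1 else 0)) big_ltn //= subn0 ltnNge HN /= add0r.
  rewrite [leRHS](@big_cat_nat _ _ _ H) //=.
  rewrite -[leLHS]addr0; apply: lerD; last first.
    by apply: sumr_ge0 => m _; rewrite invr_ge0 mulr_ge0.
  by apply: ler_sum => m _; case: ifP => // _; rewrite invr_ge0 mulr_ge0.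
apply: (@le_trans _ _ (\sum_(1 <= m < N) (m%:R^-1 + (N - m)%N%:R^-1) / N%:R)).
  rewrite !big_nat; apply: ler_sum => m /andP[m1 mN].
  have mR : (m%:R : R) != 0 by rewrite pnatr_eq0 -lt0n.
  have NmR : ((N - m)%N%:R : R) != 0 by rewrite pnatr_eq0 -lt0n subn_gt0.
  have : (N%:R : R) = m%:R + (N - m)%N%:R by rewrite -natrD subnKC // ltnW.
  move: NR mR NmR; move: (N%:R : R) (m%:R : R) ((N - m)%N%:R : R) => a b c a0 b0 c0 abc.
  rewrite le_eqVlt; apply/orP; left; apply/eqP.
  have -> : b^-1 + c^-1 = a / (b * c) by rewrite abc; field; rewrite b0 c0.
  by field; rewrite a0 b0 c0.
rewrite -mulr_suml big_split /= [X in _ + X](_ : _ = \sum_(1 <= m < N) (m%:R^-1 : R)).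
  by rewrite -mulr2n mulr_natl.
rewrite [LHS]big_nat_rev /= !big_nat; apply: eq_bigr => m /andP[m1 mN].
by rewrite add1n subSS subKn // ltnW.
Qed.

Let half_pow : (16 * l * l < 2 ^ l)%N.
Proof. exact: leq_ltn_trans lh hl. Qed.

Definition energy_factor : R :=
  expR (2 * ln 2 * (1 + eps) * sigma) *
  ((66 * expR 6 * l%:R ^+ 2) ^+ 2 * (4 * l%:R) / N%:R).

Let large_energy : (N - H < 2 * l)%N ->
  #|offdiag_quads (@exponents F N) S|%:R <=
    energy_factor * q%:R ^- (N - H) * X ^+ 2.
Proof.
move=> Nl; pose C := 66 * expR 6 * l%:R ^+ 2 : R.
have C0 : 0 <= C by rewrite !mulr_ge0 ?expR_ge0 ?exprn_ge0.
pose w (G : {poly F}) : R := 2^-1 ^+ omega Q G.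
pose Lam : R := expR (ln 2 * (1 + eps) * sigma).
apply: (le_trans (@offdiag_quads_le R F N h K Km sK hN S SA w Lam
  (fun m => Num.sqrt (C / m%:R)) _ _ _ _)).
- by move=> G; rewrite exprn_ge0 // invr_ge0.
- by move=> m; rewrite sqrtr_ge0.
- move=> G g a GS GE; rewrite /w -exprD -(omega_mul GS GE).
  have -> : 2^-1 ^+ omega Q (polyn G) = expR (- (ln 2 * (omega Q (polyn G))%:R)) :> R.
    by rewrite expRN mulrC expRM_natl lnK ?posrE // exprVn.
  rewrite /Lam -expRD -[leLHS]expR0 ler_expR -mulrA -mulrBr.
  rewrite mulr_ge0 ?ln_ge0 ?ler1n // subr_ge0.
  have := GS; rewrite inE => /and3P[_ close _].
  by have := le_lt_trans (ler_norm _) close; move=> close'; lra.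
- move=> m K' H' _ sK' mH' H'm mH NmH; apply: sieve_weight => //.
    apply/andP; split; last by [].
    rewrite lt0n; apply: contraTN NmH => /eqP ->.
    by rewrite subn0 -leqNgt.
  by rewrite (leq_trans mH') // leq_add2l ltnW.
apply: ler_wpM2r; first by rewrite exprn_ge0 // ltW.
apply: ler_wpM2r; first by rewrite invr_ge0 exprn_ge0 // ltW.
have -> : Lam ^+ 2 = expR (2 * ln 2 * (1 + eps) * sigma).
  by rewrite expr2 -expRD; congr expR; ring.
rewrite /energy_factor -/C; apply: ler_wpM2l; first exact: expR_ge0.
rewrite (eq_bigr (fun m : 'I_H => C ^+ 2 * (m%:R * (N - m)%N%:R)^-1)) => [|m _]; last first.
  by rewrite !sqr_sqrtr ?divr_ge0 // mulrACA -invfM -expr2.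
rewrite -mulr_sumr -mulrA; apply: ler_wpM2l; first exact: sqr_ge0.
apply: (le_trans harmonic_pair_sum); apply: ler_wpM2r; first by rewrite invr_ge0.
have -> : 4 * l%:R = 2 * (2 * l%:R) :> R by ring.
apply: ler_wpM2l => //; apply: (@le_trans _ _ l.+1%:R); last first.
  by rewrite -natrM ler_nat mul2n -addnn -addn1 leq_add2l.
apply: le_trans (@harmonic_le R l.+1).
have NB : (N <= 2 ^ l.+1)%N.
  have : (2 * l <= 2 ^ l)%N.
    apply: leq_trans (ltnW half_pow); rewrite leq_mul2r; apply/orP; right.
    by rewrite (@leq_trans 16) // leq_pmulr.
  move: Nl hl HN; rewrite expnS; move: (2 ^ l)%N => p; clear; lia.
rewrite [leRHS](@big_cat_nat _ _ _ N) //= lerDl.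
by apply: sumr_ge0 => m _; rewrite invr_ge0.
Qed.

Let sel_exists : exists sel : P -> prime,
  forall G, G \in S -> sel G \in Q /\ ppoly (sel G) %| polyn G.
Proof.
have [i0 _] : exists i : prime, ppoly i %| 'X.
  by apply: ex_ppoly; rewrite size_polyX /= ltnS.
exists (fun G => odflt i0 [pick i in Q | ppoly i %| polyn G]) => G.
rewrite inE => /and3P[_ close _]; case: pickP => /= [i /andP[]//|none].
have : omega Q (polyn G) = 0%N.
  by apply: eq_card0 => i; rewrite inE; exact: none.
move=> om0; move: close; rewrite om0 sub0r normrN (ger0_norm sigma0).
by rewrite ltNge ler_piMl.
Qed.

Lemma admissible_large (delta E : R) :
  (eps ^+ 2 * sigma)^-1 + l%:R / 2 ^+ l <= delta ->
  2 / h%:R <= E -> energy_factor * q%:R ^- (N - H) <= E ->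
  (2^-1 ^+ l + E) * l%:R <= delta -> admissible N h K delta.
Proof.
move=> hth E1 E2 hE; have [sel selP] := sel_exists.
have p0 : 0 <= 2^-1 ^+ l :> R by rewrite exprn_ge0 // invr_ge0.
have hR : (0 : R) < h%:R.
  by rewrite ltr0n (leq_trans _ lh) // !muln_gt0 l0.
have E0 : 0 <= E by apply: le_trans E1; rewrite divr_ge0 // ltW.
apply: (@admissibleI R F N h K Km sK hN S sel SA _ delta (2^-1 ^+ l) E l%:R) => //.
- by move=> G /selP[].
- exact: le_trans theta_bound hth.
- rewrite [leRHS]mulrC [X in X * _]expr2 -mulrA.
  apply: (sel_pairs_le Km sK hN SA) => [|G /selP[GQ _]].
    by rewrite mulr_ge0 // ltW.
  by rewrite count //; apply: ler_wpM2l; [exact: ltW|exact: qVl].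
- have [Nl|Nl] := ltnP (N - H) (2 * l).
    apply: (le_trans (large_energy Nl)); apply: ler_wpM2r => //.
    by rewrite exprn_ge0 // ltW.
  apply: (le_trans (trivial_energy SA)); apply: ler_wpM2r.
    by rewrite exprn_ge0 // ltW.
  apply: le_trans E1.
  have h2 : (h%:R : R) ^+ 2 <= q%:R ^+ (N - H).
    apply: (@le_trans _ _ (2 ^+ (2 * l))).
      rewrite mulnC exprM; apply: lerXn2r; rewrite ?nnegrE ?exprn_ge0 //.
      by rewrite -natrX ler_nat ltnW.
    apply: (@le_trans _ _ (q%:R ^+ (2 * l))).
      by apply: lerXn2r; rewrite ?nnegrE // ler_nat card_field_gt1.
    by apply: ler_weXn2l.
  rewrite ler_pdivrMr ?exprn_gt0 // mulrAC ler_pdivlMr //.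
  apply: (@le_trans _ _ (2 * h%:R ^+ 2)); last by rewrite ler_pM2l.
  rewrite expr2 mulrA; apply: ler_wpM2r => //; rewrite -natrM ler_nat mul2n -addnn.
  by rewrite -addn1 leq_add2l -(ltr0n R).
- apply: (@le_trans _ _ (\sum_(i in Q)
      #|[set g in ball_poly N K H | (ppoly i %| polyn g)%R]|)%:R).
    by rewrite ler_nat; apply: (sel_weight_le SA) => G /selP[].
  rewrite natr_sum (eq_bigr (fun i : prime => X * q%:R^-1 ^+ pdeg i)) => [|i]; last exact: count.
  rewrite -mulr_sumr mulrC; apply: ler_wpM2r; first exact: ltW.
  exact: psum_large_le.
- apply: le_trans hE; rewrite ler_peMr ?addr_ge0 // ler1n //.
Qed.

End LargeInterval.

End Cases.

Lemma exp_dominates (R : realType) (c B : R) (j : nat) : 0 < c ->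
  exists k0 : nat, forall k, (k0 <= k)%N -> B * k.+1%:R ^+ j <= expR (c * k%:R).
Proof.
move=> c0; pose r : R := c / j.+1%:R; have r0 : 0 < r by rewrite divr_gt0.
pose M := `|B| * expR c / r ^+ j.+1.
have M0 : 0 <= M by rewrite divr_ge0 ?mulr_ge0 ?expR_ge0 ?exprn_ge0 ?(ltW r0).
exists (Num.bound M) => k kM.
have k1 : M <= k.+1%:R.
  by rewrite ltW // (lt_le_trans (archi_boundP M0)) // ler_nat (leq_trans kM).
have -> : expR (c * k%:R) = expR (r * k.+1%:R) ^+ j.+1 / expR c.
  rewrite -expRM_natl -expRN -expRD; congr expR; rewrite -[k.+1]addn1 natrD /r.
  by rewrite mulrA [_ * (c / _)]mulrC divfK ?pnatr_eq0 //; ring.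
rewrite ler_pdivlMr ?expR_gt0 //.
apply: (@le_trans _ _ ((r * k.+1%:R) ^+ j.+1)); last first.
  apply: lerXn2r; rewrite ?nnegrE ?expR_ge0 //.
    by apply: mulr_ge0 => //; exact: ltW.
  by apply: le_trans (expR_ge1Dx _); rewrite lerDr.
rewrite exprMn [k.+1%:R ^+ j.+1]exprS mulrA [leLHS]mulrAC; apply: ler_wpM2r; first exact: exprn_ge0.
apply: (@le_trans _ _ (`|B| * expR c)); first by rewrite ler_pM2r ?expR_gt0 ?ler_norm.
by rewrite -ler_pdivrMl ?exprn_gt0 // mulrC.
Qed.

Lemma admissible_eventually (R : realType) (c0 delta : R) :
  2 * ln 2 - 1 < c0 -> 0 < delta ->
  exists h0, forall (F : finFieldType) N h (K : {poly F}), K \is monic ->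
    size K = N.+1 -> (h.+1 < N)%N -> (h0 <= h)%N ->
    N%:R `^ c0 <= #|F|%:R ^+ (N - h.+1) :> R -> admissible N h K delta.
Proof.
move=> hc0 d0; have ln2 : (0 : R) < ln 2 by rewrite ln_gt0 // ltr1n.
pose g := c0 + 1 - 2 * ln 2; have g0 : 0 < g by rewrite /g; lra.
pose eps := Num.min 1 (g / (4 * ln 2)).
have eps0 : 0 < eps by rewrite /eps lt_min ltr01 divr_gt0 // mulr_gt0.
have eps1 : eps <= 1 by rewrite /eps ge_min lexx.
have epsg : 2 * ln 2 * eps <= g / 2.
  apply: (@le_trans _ _ (2 * ln 2 * (g / (4 * ln 2)))).
    by rewrite ler_pM2l ?mulr_gt0 // /eps ge_min lexx orbT.
  rewrite le_eqVlt; apply/orP; left; apply/eqP.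
  by move: ln2; clear; move: (ln 2) => t t0; field; rewrite gt_eqF.
pose c1 : R := ln 2 * Num.min 1 (g / 2).
have c10 : 0 < c1 by rewrite mulr_gt0 // lt_min ltr01 divr_gt0.
pose T : R := 2 / (eps ^+ 2 * delta).
have T0 : 0 < T by rewrite divr_gt0 // mulr_gt0 ?exprn_gt0.
pose C : R := (66 * expR 6) ^+ 2 * 4.
have C0 : 0 <= C by rewrite mulr_ge0 ?sqr_ge0.
pose B : R := 16 + 32 * expR (6 + T) + 6 / delta + 3 * C / delta.
have [k0 hk0] := @exp_dominates R c1 B 6 c10.
exists (2 ^ k0.+1)%N => F N h K Km sK hN h0 hq.
have hpos : (0 < h)%N by apply: leq_trans h0; rewrite expn_gt0.
have /andP[kh hk] := trunc_log_bounds (isT : 1 < 2)%N hpos.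
move: (trunc_log 2 h) kh hk => k kh hk.
have k0k : (k0 <= k)%N.
  by have := leq_ltn_trans h0 hk; rewrite ltn_exp2l // ltnS => /ltnW.
have {hk0 h0 k0k k0}big := hk0 k k0k.
have l1 : (1 : R) <= k.+1%:R by rewrite ler1n.
have B0 (b : R) j : (j <= 6)%N -> 0 <= b <= B -> b * k.+1%:R ^+ j <= expR (c1 * k%:R).
  move=> j6 /andP[b0 bB]; apply: le_trans big; apply: ler_pM; rewrite ?exprn_ge0 //.
  by apply: ler_weXn2l.
have e0 : 0 <= expR (6 + T) by apply: expR_ge0.
have d1 : 0 <= 6 / delta by rewrite divr_ge0 // ltW.
have d2 : 0 <= 3 * C / delta by rewrite divr_ge0 ?mulr_ge0 // ltW.
have p2k : expR (c1 * k%:R) <= 2 ^+ k.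
  apply: (@le_trans _ _ (expR (ln 2 * k%:R))).
    by rewrite ler_expR ler_wpM2r // /c1 ler_piMr ?(ltW ln2) // ge_min lexx.
  by rewrite mulrC expRM_natl lnK // posrE.
have hR : (2 : R) ^+ k <= h%:R by rewrite -natrX ler_nat.
have pk0 : (0 : R) < 2 ^+ k by rewrite exprn_gt0.
have lh : (16 * k.+1 * k.+1 <= h)%N.
  rewrite -(ler_nat R) !natrM -mulrA -expr2; apply: le_trans hR.
  by apply: le_trans p2k; apply: B0 => //; rewrite /B; lra.
set l := k.+1 in lh hk l1 B0 big *.
pose y := (h %/ (16 * l))%N; pose sigma := psum R (prime_range F N l y).
have l16 : (0 < 16 * l)%N by rewrite muln_gt0.
have ly : (l <= y)%N by rewrite leq_divRL // mulnC.
have hNle : (h <= N)%N by rewrite ltnW // ltnW.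
have yN : (y <= N)%N by rewrite (leq_trans (leq_div _ _)).
have lR : (0 : R) < l%:R by rewrite ltr0n.
have sigmaT : T <= sigma.
  have := @exp_psum_ge R F N l y; rewrite ly yN -/sigma => /(_ isT).
  move=> ge; rewrite -ler_expR; apply: le_trans ge.
  apply: (@le_trans _ _ (h%:R / (32 * l%:R ^+ 2) * expR (- 6))).
    have hT : 32 * expR (6 + T) * l%:R ^+ 2 <= h%:R.
      by apply: le_trans hR; apply: le_trans p2k; apply: B0 => //; rewrite /B; lra.
    rewrite expRN ler_pdivlMr ?expR_gt0 // -expRD ler_pdivlMr ?mulr_gt0 ?exprn_gt0 //.
    by rewrite mulrA [expR _ * 32]mulrC [T + 6]addrC.
  apply: ler_wpM2r; first exact: expR_ge0.
  have -> : h%:R / (32 * l%:R ^+ 2) = h%:R / (16 * l%:R) / (2 * l%:R) :> R.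
    by move: lR; clear; move: (l%:R : R) (h%:R : R) => a b a0; field; rewrite gt_eqF.
  apply: ler_pM; rewrite ?divr_ge0 ?invr_ge0 ?mulr_ge0 //.
    rewrite ler_pdivrMr ?mulr_gt0 // -natrM -natrM ler_nat ltnW //.
    by rewrite -ltn_divLR // ltnSn.
  rewrite lef_pV2 ?posrE ?mulr_gt0 // -?natrM ?ler_nat ?ltr0n //.
  by rewrite mul2n -addnn -addn1 leq_add2l.
have sigma0 : 0 < sigma by apply: lt_le_trans sigmaT.
have lk : l%:R / 2 ^+ k <= delta / 6.
  rewrite ler_pdivrMr // mulrC -ler_pdivrMr ?divr_gt0 // invf_div mulrC.
  by apply: le_trans p2k; rewrite -[l%:R]expr1; apply: B0; rewrite // /B; lra.
have ll : l%:R / 2 ^+ l <= delta / 6.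
  apply: le_trans lk; apply: ler_wpM2l; first exact: ltW.
  by rewrite lef_pV2 ?posrE ?exprn_gt0 // exprS ler_peMl ?(ltW pk0) // ler1n.
pose E : R := 2 / 2 ^+ k + C * l%:R ^+ 5 * expR (- (c1 * k%:R)).
have E20 : 0 <= C * l%:R ^+ 5 * expR (- (c1 * k%:R)).
  by rewrite !mulr_ge0 ?exprn_ge0 ?expR_ge0.
apply: (@admissible_large R F N h K Km sK hN l isT hk lh eps eps0 eps1 sigma0 delta E).
- rewrite -/y -/sigma; apply: (@le_trans _ _ (delta / 2 + delta / 6)); last by lra.
  apply: lerD => //.
  apply: (@le_trans _ _ (eps ^+ 2 * T)^-1).
    have e2 : 0 < eps ^+ 2 by exact: exprn_gt0.
    rewrite lef_pV2; first exact: ler_wpM2l (ltW e2) _ _ sigmaT.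
      by rewrite posrE (mulr_gt0 e2 sigma0).
    by rewrite posrE (mulr_gt0 e2 T0).
  rewrite le_eqVlt; apply/orP; left; apply/eqP; rewrite /T.
  by move: d0 eps0; clear; move: (eps) (delta) => a b b0 a0; field; rewrite !gt_eqF.
- rewrite /E -[leLHS]addr0; apply: lerD => //.
  by rewrite ler_pM2l // lef_pV2 ?posrE // (lt_le_trans pk0).
- rewrite /E -[leLHS]add0r; apply: lerD; first by rewrite divr_ge0 // ltW.
  rewrite /energy_factor -/y -/sigma.
  have NR : (0 : R) < N%:R by rewrite ltr0n (leq_trans hpos).
  have sN : sigma <= ln (N%:R : R).
    rewrite -ler_expR lnK ?posrE //; apply: le_trans (exp_psum_le R F _ yN) _.
      by rewrite ly.
    rewrite ler_pdivrMr // -natrM ler_nat; apply: (leq_trans yN); exact: leq_pmulr.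
  have lnN : k%:R * ln 2 <= ln (N%:R : R).
    rewrite -ler_expR lnK ?posrE // expRM_natl lnK ?posrE //.
    by rewrite (le_trans hR) // ler_nat.
  have N1 : 0 <= ln (N%:R : R) by rewrite ln_ge0 // ler1n (leq_trans hpos).
  have qN : #|F|%:R ^- (N - h.+1) <= expR (- (c0 * ln (N%:R : R))).
    rewrite expRN lef_pV2 ?posrE ?expR_gt0 ?exprn_gt0 ?ltr0n ?card_field_gt0 //.
    by move: hq; rewrite /powR gt_eqF.
  have NV : (N%:R : R)^-1 = expR (- ln N%:R) by rewrite expRN lnK ?posrE.
  have a0 : 0 <= 2 * ln 2 * (1 + eps) by apply: mulr_ge0; rewrite ?mulr_ge0 ?addr_ge0 ?ltW.
  apply: (@le_trans _ _ (C * l%:R ^+ 5 * (expR (2 * ln 2 * (1 + eps) * ln N%:R) *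
      expR (- ln N%:R) * expR (- (c0 * ln N%:R))))).
    have -> : expR (2 * ln 2 * (1 + eps) * sigma) *
        ((66 * expR 6 * l%:R ^+ 2) ^+ 2 * (4 * l%:R) / N%:R) * #|F|%:R ^- (N - h.+1) =
      C * l%:R ^+ 5 * (expR (2 * ln 2 * (1 + eps) * sigma) * N%:R^-1 * #|F|%:R ^- (N - h.+1)).
      rewrite /C; clear; move: (expR (_ * sigma)) (expR 6) (l%:R : R) (N%:R^-1 : R) (_ ^- _).
      by move=> *; ring.
    rewrite NV; apply: ler_wpM2l; first by rewrite mulr_ge0 ?exprn_ge0.
    apply: ler_pM => //; rewrite ?mulr_ge0 ?expR_ge0 ?invr_ge0 ?exprn_ge0 //.
    by apply: ler_wpM2r; rewrite ?expR_ge0 // ler_expR; apply: ler_wpM2l.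
  apply: ler_wpM2l; first by rewrite mulr_ge0 ?exprn_ge0.
  rewrite -!expRD ler_expR.
  apply: (@le_trans _ _ (- (g / 2) * ln N%:R)).
    rewrite -subr_ge0 (_ : _ - _ = (g / 2 - 2 * ln 2 * eps) * ln N%:R).
      by rewrite mulr_ge0 // subr_ge0.
    by rewrite /g; move: (ln N%:R) (ln 2) (eps) => u v w; field.
  rewrite mulNr lerN2; apply: (@le_trans _ _ (g / 2 * (k%:R * ln 2))); last first.
    by rewrite ler_pM2l // divr_gt0.
  have -> : c1 * k%:R = Num.min 1 (g / 2) * (k%:R * ln 2).
    by rewrite /c1 mulrAC mulrC [ln 2 * _]mulrC.
  apply: ler_wpM2r; first by rewrite mulr_ge0 // ltW.
  by rewrite ge_min lexx orbT.
have Cl : C * l%:R ^+ 6 * expR (- (c1 * k%:R)) <= delta / 3.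
  rewrite expRN ler_pdivrMr ?expR_gt0 // -ler_pdivrMl ?divr_gt0 // invf_div mulrA.
  rewrite [3 / delta * C]mulrAC; apply: B0 => //.
  apply/andP; split => //; rewrite /B; move: d1 e0; move: (6 / delta) (expR _) => u v u0 v0.
  by lra.
rewrite /E; apply: (@le_trans _ _ (l%:R / 2 ^+ l + 2 * (l%:R / 2 ^+ k) +
  C * l%:R ^+ 6 * expR (- (c1 * k%:R)))); last by lra.
rewrite le_eqVlt; apply/orP; left; apply/eqP.
rewrite exprVn [l%:R ^+ 6]exprS; move: (l%:R : R) ((2 ^+ l)^-1 : R) ((2 ^+ k)^-1 : R) => u v w.
by move: (expR _) (C) => e D; ring.
Qed.


(** * The central limit theorem *)

Section ComplexMeasurable.
Context (d : measure_display) (T : measurableType d) (R : realType).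
Implicit Types Z W : T -> R[i].

Definition cmeasurable Z := measurable_fun setT (fun w => complex.Re (Z w)) /\
  measurable_fun setT (fun w => complex.Im (Z w)).

Lemma cmeasurable_cst z : cmeasurable (cst z).
Proof. by split; exact: measurable_cst. Qed.

Lemma cmeasurableD Z W : cmeasurable Z -> cmeasurable W ->
  cmeasurable (fun w => Z w + W w).
Proof.
move=> [Zr Zi] [Wr Wi]; split.
  by under eq_fun do rewrite complex_ReD; exact: measurable_funD.
have -> : (fun w => complex.Im (Z w + W w)) = (fun w => complex.Im (Z w) + complex.Im (W w)).
  by apply/funext => w; case: (Z w) (W w) => [a b] [a' b'].
exact: measurable_funD.
Qed.

Lemma cmeasurableM Z W : cmeasurable Z -> cmeasurable W ->
  cmeasurable (fun w => Z w * W w).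
Proof.
move=> [Zr Zi] [Wr Wi]; split.
  under eq_fun do rewrite complex_ReM.
  by apply: measurable_funB; exact: measurable_funM.
under eq_fun do rewrite complex_ImM.
by apply: measurable_funD; exact: measurable_funM.
Qed.

Lemma cmeasurableX Z n : cmeasurable Z -> cmeasurable (fun w => Z w ^+ n).
Proof.
move=> mZ; elim: n => [|n IH].
  by under eq_fun do rewrite expr0; exact: cmeasurable_cst.
by under eq_fun do rewrite exprS; exact: cmeasurableM.
Qed.

Lemma cmeasurable_prod (I : Type) (s : seq I) (Z : I -> T -> R[i]) :
  (forall i, cmeasurable (Z i)) -> cmeasurable (fun w => \prod_(i <- s) Z i w).
Proof.
move=> mZ; elim: s => [|i s IH].
  by under eq_fun do rewrite big_nil; exact: cmeasurable_cst.
by under eq_fun do rewrite big_cons; exact: cmeasurableM.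
Qed.

Lemma cmeasurable_sum (I : Type) (s : seq I) (Q : pred I) (Z : I -> T -> R[i]) :
  (forall i, cmeasurable (Z i)) -> cmeasurable (fun w => \sum_(i <- s | Q i) Z i w).
Proof.
move=> mZ; elim: s => [|i s IH].
  by under eq_fun do rewrite big_nil; exact: cmeasurable_cst.
under eq_fun do rewrite big_cons; case: (Q i) => //.
exact: cmeasurableD.
Qed.

Lemma cmeasurable_pair Z : cmeasurable Z <->
  measurable_fun setT (fun w => complex_pair (Z w)).
Proof.
split=> [[Zr Zi]|mZ]; first exact: measurable_fun_pair.
split.
  exact: (measurableT_comp measurable_fst mZ).
exact: (measurableT_comp measurable_snd mZ).
Qed.

Lemma cbounded_cmeasurable Z : cbounded Z -> cmeasurable Z.
Proof. by case=> -[Zr _] [Zi _]; split. Qed.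

End ComplexMeasurable.

Section SteinhausModel.
Context (R : realType) (F : finFieldType) (N h : nat) (K : {poly F}).
Context (d : measure_display) (T : measurableType d) (P : probability T R).
Variable f : {poly F} -> T -> R[i].
Hypotheses (Km : K \is monic) (sK : size K = N.+1) (hN : (h.+1 < N)%N)
  (hf : steinhaus P f).
Local Notation prime := (@prime_poly F N).
Local Notation A := (short_interval N K h).
Local Notation poly := {poly_N.+1 F}.

Let ppoly_mem (i : prime) : monic_irreducible (ppoly i).
Proof. by split; [exact: ppoly_monic|exact: ppoly_irreducible]. Qed.

(* [f P] lies on the unit circle only almost surely. *)
Definition steinhaus_unit (i : prime) (w : T) : R[i] := unit_part (f (ppoly i) w).
Local Notation Y := steinhaus_unit.

Let cmeasurable_prime (i : prime) : cmeasurable (f (ppoly i)).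
Proof. by apply/cmeasurable_pair; exact: (steinhaus_measurable hf (ppoly_mem i)). Qed.

Let cbounded_Y i : cbounded (Y i).
Proof.
have mX := steinhaus_measurable hf (ppoly_mem i).
have [[mr [Mr br]] [mi [Mi bi]]] := cbounded_unit_part R.
have YE w : Y i w = unit_part (Complex (complex_pair (f (ppoly i) w)).1 (complex_pair (f (ppoly i) w)).2).
  by rewrite /Y /complex_pair /=; case: (f _ w).
split; split.
- by under eq_fun do rewrite YE; exact: (measurableT_comp mr mX).
- by exists Mr => w; rewrite YE.
- by under eq_fun do rewrite YE; exact: (measurableT_comp mi mX).
- by exists Mi => w; rewrite YE.
Qed.

Let normY i w : Y i w * (Y i w)^*%C = 1.
Proof. exact: unit_partE. Qed.

Let orthY (k : R[i]) (b c : prime -> nat) p : b p != c p ->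
  Ex P (fun w => complex.Re (k * mono Y b c w)) = 0.
Proof.
move=> bc; pose lift (b : prime -> nat) (G : {poly F}) : nat :=
  if [pick i : prime | ppoly i == G] is Some i then b i else 0%N.
have liftE e i : lift e (ppoly i) = e i.
  rewrite /lift; case: pickP => [j /eqP/ppoly_inj -> //|/(_ i)].
  by rewrite eqxx.
rewrite -(@unit_part_orthogonal _ _ _ P _ (@monic_irreducible F) f _ _ _
  [seq ppoly i | i <- enum prime] (lift b) (lift c) (ppoly p) k) //.
- congr Ex; apply/funext => w; rewrite /mono big_map big_enum /=.
  by congr (complex.Re (_ * _)); apply: eq_bigr => i _; rewrite !liftE.
- exact: (steinhaus_measurable hf).
- exact: (steinhaus_uniform hf).
- exact: (steinhaus_independent hf).
- by rewrite map_inj_uniq ?enum_uniq //; exact: ppoly_inj.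
- by move=> G /mapP[ i _ ->].
- by apply: map_f; rewrite mem_enum.
- by rewrite !liftE.
Qed.

Let steinhaus_mono (G : poly) w : G \in A ->
  f (polyn G) w = \prod_(i : prime) f (ppoly i) w ^+ pval i (polyn G).
Proof.
rewrite inE => /and3P[Gm _ _].
pose e (j : 'I_#|{: prime}|) : prime := enum_val j.
rewrite {1}(poly_factorisation Gm (size_npoly G)).
have re (V : comNzRingType) (g : prime -> V) : \prod_i g i = \prod_j g (e j).
  by rewrite (reindex e) //; apply: onW_bij; exact: enum_val_bij.
rewrite !re (steinhaus_factor hf) // => j l /ppoly_inj; exact: enum_val_inj.
Qed.

Let al : R := (Num.sqrt (#|A|%:R : R))^-1.

Let cardA : (0 < #|A|)%N.
Proof. by rewrite card_short_interval // expn_gt0 card_field_gt0. Qed.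

Let al2 : al ^+ 2 * #|A|%:R = 1.
Proof.
rewrite /al exprVn sqr_sqrtr ?ler0n // mulVf //.
by rewrite pnatr_eq0 -lt0n.
Qed.

Local Notation expo := (@exponents F N).
Let nil : prime -> nat := fun=> 0%N.

Definition unit_sum (w : T) : R[i] := (al%:C)%C * \sum_(G in A) mono Y (expo G) nil w.

Let expo_inj (G G' : poly) : G \in A -> G' \in A ->
  [forall i, expo G i == expo G' i] = (G == G').
Proof.
move=> GA GA'; apply/forallP/eqP => [E|-> //].
move: GA GA'; rewrite !inE => /and3P[Gm _ _] /and3P[Gm' _ _].
apply: val_inj => /=; rewrite (poly_factorisation Gm (size_npoly G)).
rewrite (poly_factorisation Gm' (size_npoly G')); apply: eq_bigr => i _.
by have /eqP := E i; rewrite /exponents => ->.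
Qed.

Let N0 : (0 < N)%N. Proof. exact: leq_ltn_trans hN. Qed.

Let expo_deg (G : poly) : G \in A -> (\sum_i pdeg i * expo G i = N)%N.
Proof.
rewrite inE => /and3P[Gm /eqP Gs _].
by rewrite sum_pdeg_pval ?size_npoly // Gs.
Qed.

Let cbounded_mono_nil (b : prime -> nat) : cbounded (mono Y b nil).
Proof.
apply: cbounded_prod => i; apply: cboundedM; apply: cboundedX => //.
exact: cbounded_conj.
Qed.

Let Re_unit_sum (xi : R[i]) w :
  complex.Re (xi * unit_sum w) = al * \sum_(G in A) uval Y expo xi G w.
Proof.
rewrite /unit_sum mulrCA complex_ReM /= mul0r subr0; congr (_ * _).
by rewrite mulr_sumr raddf_sum.
Qed.

Let bounded_Re xi : bounded_measurable (fun w => complex.Re (xi * unit_sum w)).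
Proof.
under eq_fun do rewrite Re_unit_sum; apply: bounded_measurableZ.
apply: bounded_measurable_sum => G.
by have [] := cboundedZ xi (cbounded_mono_nil (expo G)).
Qed.

Let ReE z : complex.Re z = complex.Re (1 * z) :> R.
Proof. by rewrite mul1r. Qed.

Let ImE z : complex.Im z = complex.Re (Complex 0 (-1) * z) :> R.
Proof. by rewrite complex_ReM /=; ring. Qed.

Lemma cbounded_unit_sum : cbounded unit_sum.
Proof.
split; first by under eq_fun do rewrite ReE; exact: bounded_Re.
by under eq_fun do rewrite ImE; exact: bounded_Re.
Qed.

Let second_moment xi : Ex P (fun w => complex.Re (xi * unit_sum w) ^+ 2) =
  (complex.Re xi ^+ 2 + complex.Im xi ^+ 2) / 2.
Proof.
under eq_fun do rewrite Re_unit_sum.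
rewrite (@Ex_sum_uval_sqr _ _ _ P _ Y cbounded_Y normY orthY _ expo A (@pdeg F N) N xi
  expo_inj N0 expo_deg cardA al al2 A (fintype.subxx _)).
by rewrite mulfK // pnatr_eq0 -lt0n.
Qed.

Lemma Ex_unit_sum_sqr :
  Ex P (fun w => complex.Re (unit_sum w) ^+ 2 + complex.Im (unit_sum w) ^+ 2) <= 1.
Proof.
have [br bi] := cbounded_unit_sum.
rewrite ExD; [|exact: bounded_measurableX|exact: bounded_measurableX].
have -> : (fun w => complex.Re (unit_sum w) ^+ 2) = (fun w => complex.Re (1 * unit_sum w) ^+ 2).
  by apply/funext => w; rewrite -ReE.
have -> : (fun w => complex.Im (unit_sum w) ^+ 2) =
    (fun w => complex.Re (Complex 0 (-1) * unit_sum w) ^+ 2).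
  by apply/funext => w; rewrite -ImE.
by rewrite !second_moment /=; lra.
Qed.

Lemma char_unit_sum (a b c delta : R) : 0 < delta <= 1 ->
  admissible N h K (delta ^+ 2) ->
  `|Ex P (fun w => cos (a * complex.Re (unit_sum w) + b * complex.Im (unit_sum w) + c)) -
    cos c * expR (- ((a ^+ 2 + b ^+ 2) / 4))| <=
  (9 * ((a ^+ 2 + b ^+ 2) / 2) ^+ 2 + 2 * ((a ^+ 2 + b ^+ 2) / 2) + 2) * delta.
Proof.
move=> d01 [S [sel [SA selS th pe peW]]].
have := @char_bound _ _ _ P _ Y cbounded_Y normY orthY _ expo A S sel (@pdeg F N) N
  (Complex a (- b)) expo_inj N0 expo_deg SA cardA selS al al2 delta c d01 th pe peW.
rewrite /= sqrrN -mulrA -invfM (_ : 2 * 2 = 4 :> R); last by ring.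
congr (`|Ex P _ - _| <= _); apply/funext => w; congr (cos (_ + c)).
by rewrite -Re_unit_sum complex_ReM /=; ring.
Qed.

Lemma cmeasurable_normalized_sum : cmeasurable (normalized_sum f A).
Proof.
have -> : normalized_sum f A = fun w => (al%:C)%C * \sum_(G in A)
    \prod_(i : prime) f (ppoly i) w ^+ pval i (polyn G).
  apply/funext => w; congr (_ * _); apply: eq_bigr => G GA.
  exact: steinhaus_mono.
apply: cmeasurableM; first exact: cmeasurable_cst.
apply: cmeasurable_sum => G; apply: cmeasurable_prod => i.
exact: cmeasurableX.
Qed.

Lemma Ex_normalized_sum (g : R * R -> R) : measurable_fun setT g ->
  Ex P (fun w => g (complex_pair (normalized_sum f A w))) =
  Ex P (fun w => g (complex_pair (unit_sum w))).
Proof.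
move=> mg.
pose E (i : prime) := [set w | complex.Re (f (ppoly i) w) ^+ 2 + complex.Im (f (ppoly i) w) ^+ 2 != 1].
have mE i : measurable (E i).
  have [mr mi] := cmeasurable_prime i.
  have mb : measurable_fun setT (fun w =>
      complex.Re (f (ppoly i) w) ^+ 2 + complex.Im (f (ppoly i) w) ^+ 2 == 1).
    by apply: measurable_fun_eqr => //; apply: measurable_funD; apply: measurable_funX.
  have := mb measurableT [set false] I; rewrite setTI.
  by congr measurable; apply/seteqP; split => w /=; [move/negbT|move/negbTE].
have nullE : measurable (\big[setU/set0]_(i : prime) E i) /\
    P (\big[setU/set0]_(i : prime) E i) = 0%E.
  apply: (big_ind (fun B => measurable B /\ P B = 0%E)) => [|B C [mB B0] [mC C0]|i _].
  - by split; [exact: measurable0|exact: measure0].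
  - split; first exact: measurableU.
    apply/eqP; rewrite eq_le measure_ge0 andbT.
    by apply: (le_trans (measureU2 P mB mC)); rewrite [X in (X + _)%E]B0 [X in (_ + X)%E]C0 adde0.
  - by split => //; exact: (unit_part_ae (steinhaus_uniform hf) (ppoly_mem i)).
apply: (@Ex_ae_eq _ _ _ P _ _ (\big[setU/set0]_(i : prime) E i)).
- by case: nullE.
- by case: nullE.
- apply: (measurableT_comp mg); apply/cmeasurable_pair.
  exact: cmeasurable_normalized_sum.
- apply: (measurableT_comp mg); apply/cmeasurable_pair.
  exact/cbounded_cmeasurable/cbounded_unit_sum.
move=> w nE; congr (g (complex_pair (_ * _))); apply: eq_bigr => G GA.
rewrite steinhaus_mono // /mono; apply: eq_bigr => i _.
rewrite expr0 mulr1 /steinhaus_unit /unit_part; congr (_ ^+ _).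
case: ifPn => // ne; exfalso; apply: nE.
by rewrite (bigD1 i) //=; left.
Qed.

End SteinhausModel.

Lemma clt_of_admissible (R : realType) (F : nat -> finFieldType) (N h : nat -> nat)
    (K : forall n, {poly (F n)}) (d : nat -> measure_display)
    (T : forall n, measurableType (d n)) (P : forall n, probability (T n) R)
    (f : forall n, {poly (F n)} -> T n -> complex R) :
  (forall n, K n \is monic) -> (forall n, size (K n) = (N n).+1) ->
  (forall n, (h n).+1 < N n)%N -> (forall n, steinhaus (P n) (f n)) ->
  (forall delta : R, 0 < delta ->
    \forall n \near \oo, admissible (N n) (h n) (K n) delta) ->
  cvg_in_distribution P
    (fun n w => normalized_sum (f n) (short_interval (N n) (K n) (h n)) w)
    (complex_normal R).
Proof.
move=> Km sK hN hf adm g cg [M gM].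
have mg := continuous_plane_measurable cg gM.
pose Z n := @unit_sum R (F n) (N n) (h n) (K n) (d n) (T n) (f n).
have charZ a b c : Ex (P n) (fun w => cos (a * complex.Re (Z n w) + b * complex.Im (Z n w) + c))
    @[n --> \oo] --> Ex (complex_normal R) (fun z : plane R => cos (a * z.1 + b * z.2 + c)).
  rewrite complex_normal_cos; apply/cvgrPdist_le => e e0.
  set v := (a ^+ 2 + b ^+ 2) / 2; pose C := 9 * v ^+ 2 + 2 * v + 2.
  have v0 : 0 <= v by rewrite divr_ge0 // addr_ge0 // sqr_ge0.
  have C0 : 0 < C by rewrite ltr_wpDl // addr_ge0 // mulr_ge0 // sqr_ge0.
  pose delta := Num.min 1 (e / C).
  have delta0 : 0 < delta by rewrite lt_min ltr01 divr_gt0.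
  have delta1 : delta <= 1 by rewrite ge_min lexx.
  have : \forall n \near \oo, admissible (N n) (h n) (K n) (delta ^+ 2).
    by apply: adm; rewrite exprn_gt0.
  apply: filterS => n adm_n; rewrite distrC.
  apply: (le_trans (char_unit_sum (Km n) (sK n) (hN n) (hf n) a b c _ adm_n)).
    by rewrite delta0.
  by rewrite -/v -/C mulrC -ler_pdivlMr // ge_min lexx orbT.
have bZ n : cbounded (Z n) by exact: cbounded_unit_sum (hf n).
have lim := weak_convergence cg gM bZ
  (fun n => Ex_unit_sum_sqr (Km n) (sK n) (hN n) (hf n)) charZ.
have bg : bounded_measurable (fun z : plane R => g z) by split; [exact: mg|exists M].
rewrite (Ex_EFin _ bg).
rewrite (_ : (fun n => _) = EFin \o (fun n => Ex (P n) (fun w => g (complex_pair (Z n w))))).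
  by apply/fine_cvgP; split; [exact: nearW|exact: lim].
apply/funext => n /=; rewrite -(Ex_normalized_sum (N n) (h n) (K n) (hf n) mg).
rewrite Ex_EFin //; split; last by exists M.
apply: (measurableT_comp mg); apply/cmeasurable_pair.
exact: cmeasurable_normalized_sum (hf n).
Qed.

Lemma pow_sub_ge (R : realType) (x B c : R) (N H : nat) : 0 < x -> 0 < B -> (H <= N)%N ->
  `|x ^+ H| <= c * `|x ^+ N / B| -> B <= c * x ^+ (N - H).
Proof.
move=> x0 B0 HN; have xH : 0 < x ^+ H by rewrite exprn_gt0.
rewrite !ger0_norm ?divr_ge0 ?exprn_ge0 ?(ltW x0) ?(ltW B0) // mulrA ler_pdivlMr //.
by rewrite -[in X in _ <= X -> _](subnK HN) exprD mulrA [x ^+ H * B]mulrC ler_pM2r.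
Qed.

Lemma ln2_lt1 (R : realType) : ln 2 < 1 :> R.
Proof.
rewrite -ltr_expR lnK ?posrE //.
exact: (@le_lt_trans _ _ (1 + 1) _ _ _ (expR_gt1Dx (oner_neq0 R))).
Qed.

Theorem theorem2p1 (R : realType)
    (F : nat -> finFieldType) (N h : nat -> nat)
    (K : forall n, {poly (F n)})
    (d : nat -> measure_display) (T : forall n, measurableType (d n))
    (P : forall n, probability (T n) R)
    (f : forall n, {poly (F n)} -> T n -> complex R)
    (hN : forall n, (3 <= N n)%N)
    (hKmonic : forall n, K n \is monic)
    (hKdeg : forall n, size (K n) = (N n).+1)
    (hh : forall n, (1 <= h n <= N n - 2)%N)
    (hf : forall n, steinhaus (P n) (f n)) :
  let q := fun n => (#|F n|%:R : R) in
  let S := fun n (w : T n) =>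
    normalized_sum (f n) (short_interval (N n) (K n) (h n)) w in
  (* case (a) *)
  ((q n ^+ h n) @[n --> \oo] --> +oo ->
   (fun n => q n ^+ (h n).+1 : R^o) =o_\oo
     (fun n => q n ^+ N n / (N n)%:R : R^o) ->
   cvg_in_distribution P S (complex_normal R)) /\
  (* case (b) *)
  (h n @[n --> \oo] --> \oo ->
   (exists c : R, 2 * ln 2 - 1 < c /\
     (fun n => q n ^+ (h n).+1 : R^o) =o_\oo
       (fun n => q n ^+ N n / ((N n)%:R `^ c) : R^o)) ->
   cvg_in_distribution P S (complex_normal R)).
Proof.
have Nh n : ((h n).+1 < N n)%N.
  by have := hh n; have := hN n; clear; move: (h n) (N n) => a b; lia.
have q0 n : (0 : R) < #|F n|%:R by rewrite ltr0n card_field_gt0.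
have NR n : (0 : R) < (N n)%:R by rewrite ltr0n (leq_ltn_trans _ (Nh n)).
move=> q S; split=> [qh /eqoP o|hoo [c [hc /eqoP o]]];
  apply: (clt_of_admissible hKmonic hKdeg Nh hf) => delta delta0.
- have c1 : 2 * ln 2 - 1 < 1 :> R by have := ln2_lt1 R; lra.
  have [h0 large] := admissible_eventually c1 delta0.
  pose c := Num.min 1 (delta / (2 * h0.+2%:R)).
  have c0 : 0 < c by rewrite lt_min ltr01 divr_gt0 // mulr_gt0.
  have cle1 : c <= 1 by rewrite ge_min lexx.
  have cd : 2 * c * h0.+2%:R <= delta.
    by rewrite mulrAC mulrC -ler_pdivlMr ?mulr_gt0 // ge_min lexx orbT.
  have big : \forall n \near \oo, c^-1 ^+ h0 < q n ^+ h n.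
    by move/cvgryPgt : qh; apply.
  apply: filterS2 big (o c c0) => n big on.
  have Nq := pow_sub_ge (q0 n) (NR n) (ltnW (Nh n)) on.
  have Q0 : 0 < q n ^+ (N n - (h n).+1) by rewrite exprn_gt0 // q0.
  have [hl|hs] := leqP h0 (h n).
    apply: large => //; rewrite powRr1 ?(ltW (NR n)) //.
    by apply: (le_trans Nq); rewrite ler_piMl // ltW.
  apply: (@admissible_small R _ _ _ _ (hKmonic n) (hKdeg n) (Nh n) delta c).
  + by rewrite ler_pdivrMr.
  + rewrite leNgt; apply/negP => lt; move: big; rewrite ltNge => /negP[].
    have cq : q n <= c^-1 by rewrite -[q n]invrK lef_pV2 ?posrE ?invr_gt0 ?q0 // ltW.
    apply: (@le_trans _ _ (c^-1 ^+ h n)).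
      by apply: lerXn2r cq; rewrite nnegrE ?invr_ge0 ltW ?q0.
    by apply: ler_weXn2l (ltnW hs); rewrite invf_ge1.
  + apply: le_trans cd; rewrite ler_pM2l ?mulr_gt0 // ler_nat !ltnS; exact: ltnW.
have [h0 large] := admissible_eventually hc delta0.
have big : \forall n \near \oo, (h0 <= h n)%N by move/cvgnyPge : hoo; apply.
apply: filterS2 big (o 1 ltr01) => n big on; apply: large => //.
have := pow_sub_ge (q0 n) (powR_gt0 c (NR n)) (ltnW (Nh n)) on.
by rewrite mul1r.
Qed.
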